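(* Consider the $\mathcal{S}$-$\mathcal{AB}$ iteration described in the context, and suppose that Assumptions 1 (objective function) and 2 (weight matrices and networks), as written out in the context, hold. Let $L:=\max_{1\le i\le n}\sqrt{\mathbb{E}[L_i^2(\zeta_i)]}$ and let the step-size be $\alpha_k=a/(k+b)^{\alpha}$ with $\alpha\in(1/2,1)$ and positive scalars $a,b$ satisfying $\frac{a}{b^{\alpha}}\le\min\{1,\frac{n}{u^\intercal v L}\}$. Then for every $i\in\mathcal{V}$, $$\frac{1}{\sqrt{k}}\sum_{t=0}^{k-1}\left(x_{i,t}-x^*\right)\stackrel{d}{\longrightarrow}N\left(\mathbf{0},\mathbf{H}^{-1}\mathbf{S}\mathbf{H}^{-1}\right)\quad(k\to\infty),$$ where $\mathbf{H}:=\nabla^2 f(x^* )$ and $\mathbf{S}:=\mathrm{Cov}\left(\sum_{j=1}^n\nabla g_j(x^*;\zeta_j)\right)$.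
   Context: Notation. $\|\cdot\|$ is the Euclidean norm, $\mathbf{1}$ the all-ones vector, $\stackrel{d}{\to}$ convergence in distribution, $\mathrm{Cov}(\xi)$ the covariance matrix of a random vector $\xi$, and $N(m,\Sigma)$ the normal distribution with mean $m$ and covariance $\Sigma$. Problem. Let $\mathcal{V}=\{1,\dots,n\}$ be a set of agents. Agent $j$ has the cost $f_j(x)=\mathbb{E}[g_j(x;\zeta_j)]$, $x\in\mathbb{R}^d$, where $\zeta_j$ is a random variable on a probability space $(\Omega,\mathcal{F},\mathrm{P})$. The problem is to minimize $f(x)=\sum_{j=1}^n f_j(x)$ over $\mathbb{R}^d$; $x^*$ denotes its optimal solution. Gradients $\nabla g_i$ are with respect to $x$. $\mathcal{S}$-$\mathcal{AB}$ iteration. Given weight matrices $\mathbf{A}=(a_{ij}),\mathbf{B}=(b_{ij})\in\mathbb{R}^{n\times n}$, step-sizes $\alpha_k>0$, and initial values $x_{i,0}\in\mathbb{R}^d$, set $y_{i,0}=\nabla g_i(x_{i,0};\zeta_{i,0})$ and, for $k\ge0$ and $i\in\mathcal{V}$, $$x_{i,k+1}=\sum_{j=1}^n a_{ij}x_{j,k}-\alpha_k y_{i,k},$$ $$y_{i,k+1}=\sum_{j=1}^n b_{ij}y_{j,k}+\nabla g_i(x_{i,k+1};\zeta_{i,k+1})-\nabla g_i(x_{i,k};\zeta_{i,k}),$$ where the vectors $(\zeta_{1,k},\dots,\zeta_{n,k})$, $k\ge0$, are i.i.d. copies of $(\zeta_1,\dots,\zeta_n)$. Assumption 1 (objective function).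 (i) $f$ is differentiable and $\mu$-strongly convex ($\mu>0$): $f(y)\ge f(x)+\langle\nabla f(x),y-x\rangle+\frac{\mu}{2}\|x-y\|^2$ for all $x,y\in\mathbb{R}^d$. (ii) There is $c>0$ with $\|\nabla f(x)-\nabla^2 f(x^* )(x-x^* )\|\le c\|x-x^*\|^2$ for all $x\in\mathbb{R}^d$. (iii) For each $i\in\mathcal{V}$, $g_i(\cdot;\zeta_i)$ is differentiable and there are constants $p>2$, $U_1>0$ such that for all $x,y\in\mathbb{R}^d$: $\mathbb{E}[\|\nabla g_i(x;\zeta_i)-\nabla f_i(x)\|^p]\le U_1^{p/2}$ and $\|\nabla g_i(x;\zeta_i)-\nabla g_i(y;\zeta_i)\|\le L_i(\zeta_i)\|x-y\|$, where $L_i(\zeta_i)$ is a positive random variable with $\mathbb{E}[L_i^p(\zeta_i)]<\infty$. Assumption 2 (weight matrices and networks). For a nonnegative matrix $\mathbf{M}\in\mathbb{R}^{n\times n}$, the directed graph induced by $\mathbf{M}$ has node set $\mathcal{V}$ and an edge $(j,i)$ (from $j$ to $i$) iff $\mathbf{M}_{ij}>0$. Let $\mathcal{G}_A$ and $\mathcal{G}_{B^\intercal}$ be the graphs induced by $\mathbf{A}$ and $\mathbf{B}^\intercal$. (i) $\mathbf{A}$ is nonnegative and row stochastic ($\mathbf{A}\mathbf{1}=\mathbf{1}$), $\mathbf{B}$ is nonnegative and column stochastic ($\mathbf{1}^\intercal\mathbf{B}=\mathbf{1}^\intercal$), and $\mathbf{A}_{ii}>0$, $\mathbf{B}_{ii}>0$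 for all $i$. (ii) $\mathcal{G}_A$ and $\mathcal{G}_{B^\intercal}$ each contain at least one (directed) spanning tree, and at least one node is a root of spanning trees of both, i.e. $\mathcal{R}_A\cap\mathcal{R}_{B^\intercal}\neq\emptyset$, where $\mathcal{R}_A$ (resp. $\mathcal{R}_{B^\intercal}$) is the set of roots of all spanning trees of $\mathcal{G}_A$ (resp. $\mathcal{G}_{B^\intercal}$). Under Assumption 2, $u^\intercal$ denotes the nonnegative left eigenvector of $\mathbf{A}$ for eigenvalue $1$ with $u^\intercal\mathbf{1}=n$, and $v$ the nonnegative right eigenvector of $\mathbf{B}$ for eigenvalue $1$ with $\mathbf{1}^\intercal v=n$; one has $u^\intercal v>0$. *)

(* Defs.v *)
From mathcomp Require Import all_boot all_order all_algebra finmap.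
From mathcomp Require Import all_classical all_reals all_analysis.

Set Implicit Arguments.
Unset Strict Implicit.
Unset Printing Implicit Defensive.

Import Order.TTheory GRing.Theory Num.Theory.
Import numFieldNormedType.Exports.

Local Open Scope classical_set_scope.
Local Open Scope ring_scope.

Section euclidean.
Context {R : realType} {d : nat}.
Implicit Types (x y : 'cV[R]_d) (f : 'cV[R]_d -> R).

(* The library norm `|x| on matrices is the sup norm. *)
Definition dotp x y : R := \sum_(i < d) x i 0 * y i 0.
Definition enorm x : R := Num.sqrt (dotp x x).

Definition grad f x : 'cV[R]_d := \col_(i < d) 'D_(delta_mx i 0) f x.

Definition hessian f x : 'M[R]_d :=
  \matrix_(i < d, j < d) 'D_(delta_mx i 0) (fun y => grad f y j 0) x.

Definition strongly_convex (mu : R) f :=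
  forall x y,
    f x + dotp (grad f x) (y - x) + mu / 2 * enorm (x - y) ^+ 2 <= f y.

End euclidean.

Section random_elements.
Context {R : realType} {dT : measure_display} {T : measurableType dT}
  (P : probability T R).

Definition same_distribution d' (E : measurableType d') (X Y : T -> E) :=
  forall C : set E, measurable C -> P (X @^-1` C) = P (Y @^-1` C).

Definition mutually_independent d' (E : measurableType d') (X : nat -> T -> E) :=
  forall (K : {fset nat}) (C : nat -> set E), (forall k, measurable (C k)) ->
    P (\bigcap_(k in [set` K]) X k @^-1` C k)
    = (\prod_(k <- K) P (X k @^-1` C k))%E.

Definition iid_copies d' (E : measurableType d') (X : T -> E)
    (Xs : nat -> T -> E) :=
  (forall k, same_distribution (Xs k) X) /\ mutually_independent Xs.

Definition joint n dZ (Z : measurableType dZ) (zeta : 'I_n -> T -> Z)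
  (w : T) : n.-tuple Z := [tuple zeta i w | i < n].

Definition cov_mx d (X : T -> 'cV[R]_d) : 'M[R]_d :=
  \matrix_(i < d, j < d)
    fine (covariance P (fun w => X w i 0) (fun w => X w j 0)).

End random_elements.

Definition borel_cV (R : realType) (d : nat) :=
  g_sigma_algebraType (@open 'cV[R]_d).

Definition cvg_in_distribution (R : realType) dT (T : measurableType dT)
    (P : probability T R) d (X : nat -> T -> 'cV[R]_d)
    (nu : probability (borel_cV R d) R) :=
  (forall k, measurable_fun [set: T] (X k : T -> borel_cV R d)) /\
  forall h : 'cV[R]_d -> R, continuous h ->
    (exists M : R, forall x, `|h x| <= M) ->
    ('E_P[h \o X k] @[k --> \oo] --> 'E_nu[h])%E.

(* One-dimensional normal law with mean m and variance s2. The library's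
   normal_prob takes a standard deviation and is not the point mass when that
   deviation is 0. *)
Definition normal_law (R : realType) (m s2 : R) : set R -> \bar R :=
  if s2 == 0 then \d_m else normal_prob m (Num.sqrt s2).

(* nu = N(m, Sigma), with Sigma possibly singular: every linear functional t of
   a vector with law nu has the law N(t^T m, t^T Sigma t). *)
Definition is_mvnormal (R : realType) d (m : 'cV[R]_d) (Sigma : 'M[R]_d)
    (nu : probability (borel_cV R d) R) :=
  [/\ Sigma^T = Sigma,
      forall t : 'cV[R]_d, 0 <= dotp t (Sigma *m t)
    & forall (t : 'cV[R]_d) (C : set R), measurable C ->
        nu [set x : 'cV[R]_d | C (dotp t x)]
        = normal_law (dotp t m) (dotp t (Sigma *m t)) C].

Section network.
Context {R : realType} {n : nat}.
Implicit Types M A B : 'M[R]_n.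

(* edge M j i : there is an edge from j to i *)
Definition edge M : rel 'I_n := fun j i => 0 < M i j.

(* t is the edge relation of a spanning tree, rooted at r and directed away
   from r, of the digraph e. *)
Definition spanning_tree (e t : rel 'I_n) (r : 'I_n) :=
  [/\ forall j i, t j i -> e j i,
      forall j, ~~ t j r,
      forall i, i != r -> exists! j, t j i
    & forall i, connect t r i].

Definition roots M : set 'I_n :=
  [set r | exists t : rel 'I_n, spanning_tree (edge M) t r].

Definition row_stochastic M :=
  (forall i j, 0 <= M i j) /\ M *m const_mx 1 = const_mx 1 :> 'cV_n.

Definition column_stochastic M :=
  (forall i j, 0 <= M i j) /\ const_mx 1 *m M = const_mx 1 :> 'rV_n.

Definition network_assumption A B :=
  [/\ row_stochastic A,
      column_stochastic B,
      forall i, 0 < A i i /\ 0 < B i i,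
      roots A !=set0 /\ roots B^T !=set0
    & roots A `&` roots B^T !=set0].

Definition left_perron A (u : 'cV[R]_n) :=
  [/\ u^T *m A = u^T, forall i, 0 <= u i 0 & \sum_(i < n) u i 0 = n%:R].

Definition right_perron B (v : 'cV[R]_n) :=
  [/\ B *m v = v, forall i, 0 <= v i 0 & \sum_(i < n) v i 0 = n%:R].

End network.

Section stochastic_problem.
Context {R : realType} {dT dZ : measure_display} {T : measurableType dT}
  {Z : measurableType dZ} (P : probability T R) {n d : nat}.
Variables (g : 'I_n -> 'cV[R]_d -> Z -> R) (zeta : 'I_n -> {RV P >-> Z}).

Definition local_cost (j : 'I_n) (x : 'cV[R]_d) : R :=
  fine 'E_P[g j x \o zeta j].

Definition cost (x : 'cV[R]_d) : R := \sum_(j < n) local_cost j x.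

(* What is implicit in writing local_cost as an expectation. *)
Definition cost_well_defined :=
  forall j x, measurable_fun [set: Z] (g j x) /\
    P.-integrable [set: T] (EFin \o (g j x \o zeta j)).

Definition sgrad (j : 'I_n) (x : 'cV[R]_d) (z : Z) : 'cV[R]_d :=
  grad (fun x' => g j x' z) x.

Definition objective_assumption (Lip : 'I_n -> Z -> R) (xstar : 'cV[R]_d) :=
  [/\ (forall x, differentiable cost x) /\
      (exists2 mu : R, 0 < mu & strongly_convex mu cost),
      exists2 c : R, 0 < c & forall x,
        enorm (grad cost x - hessian cost xstar *m (x - xstar))
        <= c * enorm (x - xstar) ^+ 2
    & forall i,
      [/\ forall z x, differentiable (fun x' => g i x' z) x,
          measurable_fun [set: Z] (Lip i),
          {ae distribution P (zeta i), forall z, 0 < Lip i z /\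
            forall x y, enorm (sgrad i x z - sgrad i y z)
                        <= Lip i z * enorm (x - y)}
        & exists p U1 : R,
          [/\ 2 < p, 0 < U1,
              forall x,
                ('E_P[fun w => (enorm (sgrad i x (zeta i w)
                                       - grad (local_cost i) x) `^ p)%R]
                 <= (U1 `^ (p / 2))%:E)%E
            & ('E_P[fun w => (Lip i (zeta i w) `^ p)%R] < +oo)%E]]].

Definition max_lipschitz (Lip : 'I_n -> Z -> R) : R :=
  \big[Num.max/0]_(i < n)
    Num.sqrt (fine 'E_P[fun w => (Lip i (zeta i w) ^+ 2)%R]).

(* zetas k i is the sample zeta_(i,k); step k is the step-size alpha_k. *)
Definition SAB_iteration (A B : 'M[R]_n) (step : nat -> R)
    (zetas : nat -> 'I_n -> {RV P >-> Z}) (x0 : 'I_n -> 'cV[R]_d)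
    (x y : nat -> 'I_n -> T -> 'cV[R]_d) :=
  [/\ forall i w, x 0%N i w = x0 i,
      forall i w, y 0%N i w = sgrad i (x0 i) (zetas 0%N i w),
      forall k i w,
        x k.+1 i w = \sum_(j < n) A i j *: x k j w - step k *: y k i w
    & forall k i w,
        y k.+1 i w = \sum_(j < n) B i j *: y k j w
          + sgrad i (x k.+1 i w) (zetas k.+1 i w)
          - sgrad i (x k i w) (zetas k i w)].

End stochastic_problem.

(* Main.v *)
(* Write X_k for the matrix with rows x_(i,k) - x*, G_k for the matrix of
   sampled gradients, pi = u^T / n and w = v / n. The tracker is Y_k =
   G_k + (I - B) Q_k, where Q_(k+1) = B Q_k - (I - w 1^T) G_k and Q_0 = 0. This
   turns the iteration into a stochastic gradient recursion for the corrected
   center phi_k = pi X_k - alpha_k pi Q_k, namely phi_(k+1) =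
   phi_k - alpha_k gamma 1^T G_k + (alpha_k - alpha_(k+1)) pi Q_(k+1), with
   gamma = u^T v / n^2 > 0, coupled to contractions for the disagreement
   (I - 1 pi) X_k and for Q_k. A Lyapunov argument gives E|Q_k|^2 = O(1),
   E|(I - 1 pi) X_k|^2 = O(alpha_k^2) and E|phi_k|^2 = O(alpha_k). Solving the
   recursion for phi_k H and averaging, x_(i,t) - x* equals -H^(-1) times the
   gradient noise at x*, up to terms whose sums are o(sqrt k) in L^1: a
   telescoping sum (Abel summation), the linearization error, and a martingale
   of small variance. What remains is a sum of i.i.d. vectors. Its
   characteristic functions converge to those of the normal law, and since
   cosines of linear forms approximate continuous functions on boxes (Bernstein
   polynomials in sines), tightness gives convergence in distribution. *)
From HB Require Import structures.
From mathcomp Require Import all_boot all_order all_algebra finmap.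
From mathcomp Require Import all_classical all_reals all_analysis.
From mathcomp Require Import measurable_realfun zify ring lra.
Require Import Defs.

Set Implicit Arguments.
Unset Strict Implicit.
Unset Printing Implicit Defensive.

Import Order.TTheory GRing.Theory Num.Theory.
Import numFieldNormedType.Exports.

Local Open Scope classical_set_scope.
Local Open Scope ring_scope.

(** * Matrix norms and powers of stochastic matrices *)

Section frobenius.
Context {R : realType}.

(** The tracking variable mixes samples of different times: y_k contains the gradient at the current
    sample and differences of earlier ones, so it cannot be handled as a function of the past plus
    centred noise. Splitting off G_k leaves Q_k, which depends on earlier samples only. Then X_k and
    Q_k are both determined by the past, and all fresh randomness of time k enters through G_k. The
    matrix (I - B) Q_k has bounded but not vanishing second moment, so its image under pi would
    disturb the mean at order alpha_k. Subtracting alpha_k pi Q_k turns it into a term weighted by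
    alpha_k - alpha_(k+1) = o(alpha_k^2). Each bound on the exponent has its own role. From alpha >
    1/2 the sum of the alpha_t with t < k is o(sqrt k), which disposes of errors of mean size
    O(alpha_t). From alpha < 1 one has 1/k = o(alpha_k), which disposes of the boundary term phi_k /
    alpha_k of the telescoping sum, whose size is alpha_k^(-1/2). Limits are tested with the
    functions cos (c + <t, x>), so that no complex numbers occur. *)

Definition fdot m p (M N : 'M[R]_(m, p)) : R := \sum_i \sum_j M i j * N i j.
(** The squared norm is polynomial in the entries, so that expansions, measurability and integration
    need no square roots. *)
Definition fro2 m p (M : 'M[R]_(m, p)) : R := fdot M M.

Lemma fdotC m p (M N : 'M[R]_(m, p)) : fdot M N = fdot N M.
Proof. by apply: eq_bigr => i _; apply: eq_bigr => j _; rewrite mulrC. Qed.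

Lemma fdotDl m p (M N K : 'M[R]_(m, p)) : fdot (M + N) K = fdot M K + fdot N K.
Proof.
rewrite /fdot -big_split; apply: eq_bigr => i _; rewrite -big_split.
by apply: eq_bigr => j _; rewrite mxE mulrDl.
Qed.

Lemma fdotZl m p c (M K : 'M[R]_(m, p)) : fdot (c *: M) K = c * fdot M K.
Proof.
rewrite /fdot mulr_sumr; apply: eq_bigr => i _; rewrite mulr_sumr.
by apply: eq_bigr => j _; rewrite mxE mulrA.
Qed.

Lemma fdotDr m p (M N K : 'M[R]_(m, p)) : fdot K (M + N) = fdot K M + fdot K N.
Proof. by rewrite fdotC fdotDl !(fdotC K). Qed.

Lemma fdotZr m p c (M K : 'M[R]_(m, p)) : fdot K (c *: M) = c * fdot K M.
Proof. by rewrite fdotC fdotZl (fdotC K). Qed.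

Lemma fro2_ge0 m p (M : 'M[R]_(m, p)) : 0 <= fro2 M.
Proof. by do 2! [apply: sumr_ge0 => ? _]; rewrite -expr2 sqr_ge0. Qed.

Lemma fro2Z m p c (M : 'M[R]_(m, p)) : fro2 (c *: M) = c ^+ 2 * fro2 M.
Proof. by rewrite /fro2 fdotZl fdotZr mulrA expr2. Qed.

Lemma fro2N m p (M : 'M[R]_(m, p)) : fro2 (- M) = fro2 M.
Proof. by rewrite -scaleN1r fro2Z sqrrN expr1n mul1r. Qed.

Lemma fro20 m p : fro2 (0 : 'M[R]_(m, p)) = 0.
Proof. by rewrite -(scale0r (0 : 'M[R]_(m, p))) fro2Z expr0n mul0r. Qed.

Lemma fro2D m p (M N : 'M[R]_(m, p)) :
  fro2 (M + N) = fro2 M + 2 * fdot M N + fro2 N.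
Proof. by rewrite /fro2 fdotDl !fdotDr (fdotC N M); ring. Qed.

Lemma fdot_young m p (M N : 'M[R]_(m, p)) e : 0 < e ->
  2 * fdot M N <= e * fro2 M + e^-1 * fro2 N.
Proof.
move=> e0; rewrite /fro2 /fdot !mulr_sumr -big_split ler_sum// => i _.
rewrite !mulr_sumr -big_split ler_sum// => j _ /=.
set a := M i j; set b := N i j.
have -> : e * (a * a) + e^-1 * (b * b) =
    2 * (a * b) + e^-1 * (e * a - b) ^+ 2 by field; rewrite gt_eqF.
by rewrite lerDl mulr_ge0 ?sqr_ge0// invr_ge0 ltW.
Qed.

Lemma fro2D_le m p (M N : 'M[R]_(m, p)) e : 0 < e ->
  fro2 (M + N) <= (1 + e) * fro2 M + (1 + e^-1) * fro2 N.
Proof. by move=> /(fdot_young M N); rewrite fro2D; lra. Qed.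

Lemma fro2D2 m p (M N : 'M[R]_(m, p)) :
  fro2 (M + N) <= 2 * fro2 M + 2 * fro2 N.
Proof. by have := fdot_young M N ltr01; rewrite fro2D invr1; lra. Qed.

(** Cauchy-Schwarz: the sum of the squares (B a_i - D b_i)^2 equals B (B A - D^2). If B = 0 then
    every b_i vanishes. *)
Lemma sqr_sumM_le (I : finType) (a b : I -> R) :
  (\sum_i a i * b i) ^+ 2 <= (\sum_i a i ^+ 2) * (\sum_i b i ^+ 2).
Proof.
pose A := \sum_i a i ^+ 2; pose B := \sum_i b i ^+ 2;
  pose D := \sum_i a i * b i.
rewrite -/A -/B -/D.
have : 0 <= \sum_i (B * a i - D * b i) ^+ 2 by apply: sumr_ge0 => i _;
  exact: sqr_ge0.
have -> : \sum_i (B * a i - D * b i) ^+ 2 = B * (B * A - D ^+ 2).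
  under eq_bigr do rewrite sqrrB !exprMn.
  rewrite big_split sumrB /= -!mulr_sumr.
  have -> : \sum_i (B * a i * (D * b i)) *+ 2 = 2 * B * D * D.
    transitivity (\sum_i (2 * B * D) * (a i * b i)); last by rewrite -mulr_sumr.
    by apply: eq_bigr => i _; rewrite mulr2n; ring.
  by rewrite -/A -/B; ring.
have B0 : 0 <= B by apply: sumr_ge0 => i _; exact: sqr_ge0.
move: B0; rewrite le_eqVlt => /predU1P[B0 _|B0].
  have b0 i : b i = 0.
    apply/eqP; rewrite -sqrf_eq0; apply/eqP.
    have /eqP := esym B0.
    by rewrite psumr_eq0 => [/allP/(_ i (mem_index_enum _))/eqP//|j _];
      exact: sqr_ge0.
  by rewrite -B0 mulr0 /D big1 ?expr0n// => i _; rewrite b0 mulr0.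
by rewrite pmulr_rge0// subr_ge0 mulrC.
Qed.

Lemma fro2_mulmx m n p (A : 'M[R]_(m, n)) (M : 'M[R]_(n, p)) :
  fro2 (A *m M) <= fro2 A * fro2 M.
Proof.
have -> : fro2 A * fro2 M =
    \sum_i \sum_j (\sum_k A i k ^+ 2) * (\sum_k M k j ^+ 2).
  rewrite /fro2 /fdot mulr_suml; apply: eq_bigr => i _.
  rewrite (exchange_big _ _ _ _ _ (fun k j => M k j * M k j)) mulr_sumr.
  by apply: eq_bigr => j _; congr (_ * _); apply: eq_bigr => k _; rewrite expr2.
do 2! [apply: ler_sum => ? _]; rewrite mxE -expr2; exact: sqr_sumM_le.
Qed.

Lemma fro2_tr m p (M : 'M[R]_(m, p)) : fro2 M^T = fro2 M.
Proof.
rewrite /fro2 /fdot exchange_big; apply: eq_bigr => i _.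
by apply: eq_bigr => j _; rewrite !mxE.
Qed.

Lemma fro2_entry m p (M : 'M[R]_(m, p)) i j : M i j ^+ 2 <= fro2 M.
Proof.
rewrite /fro2 /fdot (bigD1 i)//= (bigD1 j)//= expr2 -addrA lerDl.
by rewrite addr_ge0//; do 2?[apply: sumr_ge0 => ? _]; rewrite -expr2 sqr_ge0.
Qed.

Lemma fro2_row m p (M : 'M[R]_(m, p)) : fro2 M = \sum_i fro2 (row i M).
Proof.
apply: eq_bigr => i _; rewrite /fro2 /fdot big_ord1.
by apply: eq_bigr => j _; rewrite !mxE.
Qed.

Lemma fro2_dotp d (x : 'cV[R]_d) : fro2 x = dotp x x.
Proof. by rewrite /fro2 /fdot /dotp; apply: eq_bigr => i _;
  rewrite big_ord1. Qed.

Lemma dotp_ge0 d (x : 'cV[R]_d) : 0 <= dotp x x.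
Proof. by rewrite -fro2_dotp fro2_ge0. Qed.

Lemma enorm_sqr d (x : 'cV[R]_d) : enorm x ^+ 2 = fro2 x.
Proof. by rewrite /enorm sqr_sqrtr ?fro2_dotp// dotp_ge0. Qed.

Lemma fdotNr m p (M N : 'M[R]_(m, p)) : fdot M (- N) = - fdot M N.
Proof. by rewrite -scaleN1r fdotZr mulN1r. Qed.

Lemma fdot_le_half m p (M N : 'M[R]_(m, p)) :
  2 * fdot M N <= fro2 M + fro2 N /\ - (2 * fdot M N) <= fro2 M + fro2 N.
Proof.
have h1 := fro2_ge0 (M + N); have h2 := fro2_ge0 (M + - N).
rewrite fro2D in h1; rewrite fro2D fro2N fdotNr in h2; split; lra.
Qed.

Lemma fro2_eq0 m p (M : 'M[R]_(m, p)) : fro2 M <= 0 -> M = 0.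
Proof.
move=> M0; apply/matrixP => i j; rewrite mxE; apply/eqP;
  rewrite -sqrf_eq0 eq_le sqr_ge0 andbT.
exact: le_trans (fro2_entry M i j) M0.
Qed.

Lemma fro2_row_le m p (M : 'M[R]_(m, p)) i : fro2 (row i M) <= fro2 M.
Proof. by rewrite [leRHS]fro2_row (bigD1 i)//= lerDl sumr_ge0// => j _;
  exact: fro2_ge0. Qed.

End frobenius.

Section powers.
Context {R : realType} {n : nat}.
Implicit Types M : 'M[R]_n.

Lemma row_stochasticX M k : row_stochastic M -> row_stochastic (M ^+ k).
Proof.
move=> [M0 M1]; elim: k => [|k [IH0 IH1]].
  rewrite expr0; split => [i j|]; last exact: mul1mx.
  by rewrite mxE; case: eqP.
rewrite exprS; split => [i j|]; last by rewrite -mulmxA IH1.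
by rewrite mxE sumr_ge0// => l _; rewrite mulr_ge0.
Qed.

(** With a positive diagonal, an entry of column r that is positive in one power stays positive in
    all later ones, and a path from r to i makes entry (i, r) positive at some exponent. *)
Lemma stochastic_powers_pos M r :
  row_stochastic M -> (forall i, 0 < M i i) ->
  (forall i, connect (edge M) r i) -> exists k, forall i, 0 < (M ^+ k) i r.
Proof.
move=> Mst Mii conn; have M0 k i j := (row_stochasticX k Mst).1 i j.
have mono k l i : 0 < (M ^+ k) i r -> 0 < (M ^+ (l + k)) i r.
  move=> H; elim: l => // l; rewrite addSn exprS mxE (bigD1 i)//= => IH.
  rewrite ltr_wpDr ?mulr_gt0// sumr_ge0// => j _.
  by rewrite mulr_ge0 ?Mst.1.
have /choice[f fP] i : exists k, 0 < (M ^+ k) i r.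
  have /connectP[p + ->] := conn i.
  elim/last_ind: p => [_|p j IH].
    by exists 0%N; rewrite expr0 mxE eqxx ltr01.
  rewrite rcons_path last_rcons => /andP[/IH[k Hk] Hj].
  exists k.+1; rewrite exprS mxE (bigD1 (last r p))//= ltr_wpDr//.
    by rewrite sumr_ge0// => l _; rewrite mulr_ge0 ?Mst.1.
  by rewrite mulr_gt0.
(* The sum of the individual exponents dominates each of them, so it serves all rows at once. *)
exists (\sum_i f i)%N => i; rewrite (bigD1 i)//= addnC; exact/mono/fP.
Qed.

(** Doeblin's argument: every row gives weight at least dl to the same value z_r, so all averages
    are pulled towards z_r and the enclosing interval loses the fraction dl of its length. *)
Lemma stochastic_oscillation M r (z : 'cV[R]_n) dl lo hi :
  row_stochastic M -> (forall i, dl <= M i r) ->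
  (forall i, lo <= z i 0 <= hi) ->
  exists lo' hi', hi' - lo' = (1 - dl) * (hi - lo) /\
    forall i, lo' <= (M *m z) i 0 <= hi'.
Proof.
move=> [M0 M1] Mr zb.
exists (lo + dl * (z r 0 - lo)), (hi - dl * (hi - z r 0)); split; first by ring.
move=> i.
have S1 : \sum_j M i j = 1.
  have := congr1 (fun X : 'cV[R]_n => X i 0) M1; rewrite !mxE => <-.
  by apply: eq_bigr => j _; rewrite mxE mulr1.
have -> : (M *m z) i 0 = lo + \sum_j M i j * (z j 0 - lo).
  rewrite mxE; under [in RHS]eq_bigr do rewrite mulrBr.
  by rewrite sumrB -mulr_suml S1; ring.
have E : lo + \sum_j M i j * (z j 0 - lo) = hi - \sum_j M i j * (hi - z j 0).
  under eq_bigr do rewrite mulrBr; under [in RHS]eq_bigr do rewrite mulrBr.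
  by rewrite !sumrB -!mulr_suml S1; ring.
have [/andP[zr1 zr2] nn] := (zb r, fun j => zb j).
apply/andP; split; last rewrite E lerB//;
  rewrite ?lerD2l (bigD1 r)//= -[leLHS]addr0 lerD//.
- by rewrite ler_wpM2r// subr_ge0.
- by apply: sumr_ge0 => j _; rewrite mulr_ge0// subr_ge0; case/andP: (nn j).
- by rewrite ler_wpM2r// subr_ge0.
- by apply: sumr_ge0 => j _; rewrite mulr_ge0// subr_ge0; case/andP: (nn j).
Qed.

(** [const_mx 1 *m pi] is an idempotent that absorbs [M] on either side, so all mixed terms of the
    power collapse to it. *)
Lemma stochastic_deflated_powers M (pi : 'rV[R]_n) k :
  row_stochastic M -> pi *m M = pi -> pi *m const_mx 1 = 1%:M ->
  (M - const_mx 1 *m pi) ^+ k.+1 = M ^+ k.+1 - const_mx 1 *m pi.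
Proof.
move=> [_ M1] piM pi1; elim: k => [|k IH]; first by rewrite !expr1.
rewrite exprS IH (exprS M k.+1) -!mulmxE mulmxBr !mulmxBl.
have -> : M *m (const_mx 1 *m pi) = const_mx 1 *m pi by rewrite mulmxA M1.
have -> : const_mx 1 *m pi *m (const_mx 1 *m pi) = const_mx 1 *m pi :> 'M[R]_n.
  by rewrite mulmxA -(mulmxA _ pi) pi1 mulmx1.
have -> : const_mx 1 *m pi *m M ^+ k.+1 = const_mx 1 *m pi :> 'M[R]_n.
  rewrite -mulmxA; congr (_ *m _).
  elim: {IH} k => [|k IH]; first by rewrite expr1.
  by rewrite exprS -mulmxE mulmxA piM.
by rewrite subrr subr0.
Qed.

(** The entries of a column of the power lie in an interval of length (1 - dl)^l, and pi_j, being
    the pi-average of column j, lies in it as well; so the entries of the deflated power are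
    small. *)
Lemma stochastic_convergence M r (pi : 'rV[R]_n) (e : R) :
  row_stochastic M -> (forall i, 0 < M i i) ->
  (forall i, connect (edge M) r i) ->
  (forall i, 0 <= pi 0 i) -> pi *m M = pi -> pi *m const_mx 1 = 1%:M ->
  0 < e -> exists N, fro2 ((M - const_mx 1 *m pi) ^+ N.+1) <= e.
Proof.
move=> Mst Mii conn pi0 piM pi1 e0.
have [k kP] := stochastic_powers_pos Mst Mii conn.
(* Passing from k to [k.+1] keeps the column positive and makes the block length nonzero. *)
have Kst := row_stochasticX k.+1 Mst.
have kP' i : 0 < (M ^+ k.+1) i r.
  rewrite exprS mxE (bigD1 i)//= ltr_wpDr ?mulr_gt0// sumr_ge0// => j _.
  by rewrite mulr_ge0 ?Mst.1// ltW.
have [dl [dl0 dl1 dlP]] : exists dl, [/\ 0 < dl, dl <= 1 & forall i, dl <= (M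
  ^+ k.+1) i r].
  exists (\big[Num.min/1]_i (M ^+ k.+1) i r); split.
  - by elim/big_ind : _ => // x y x0 y0; rewrite lt_min x0.
  - by elim/big_ind : _ => // [x y x0 y0|i _]; rewrite ?ge_min ?x0//;
      have [] := Kst;
    move=> H0 H1; rewrite (_ : 1 = \sum_j (M ^+ k.+1) i j);
    [rewrite (bigD1 r)//= lerDl sumr_ge0|have := congr1 (fun X : 'cV[R]_n =>
      X i 0) H1;
      rewrite !mxE => <-; apply: eq_bigr => j _; rewrite mxE mulr1].
  - by move=> i; rewrite (bigD1 i)//= ge_min lexx.
have osc l (j : 'I_n) : exists lo hi, hi - lo = (1 - dl) ^+ l /\
    forall i, lo <= ((M ^+ k.+1) ^+ l) i j <= hi.
  elim: l => [|l [lo [hi [E IH]]]].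
    by exists 0, 1; rewrite subr0 expr0; split=> // i; rewrite mxE; case: eqP;
      rewrite ?lexx ler01.
  have H i : lo <= (col j ((M ^+ k.+1) ^+ l)) i 0 <= hi by rewrite mxE.
  have [lo' [hi' [E' H']]] := stochastic_oscillation Kst dlP H.
  exists lo', hi'; split; first by rewrite E' E exprS.
  move=> i; suff -> : ((M ^+ k.+1) ^+ l.+1) i j = (M ^+ k.+1 *m col j ((M ^+
    k.+1) ^+ l)) i 0 by [].
  by rewrite exprS !mxE; apply: eq_bigr => s _; rewrite mxE.
have bnd l i j : ((M ^+ k.+1) ^+ l.+1 - const_mx 1 *m pi) i j ^+ 2 <= ((1 -
  dl) ^+ l.+1) ^+ 2.
  have [lo [hi [<- H]]] := osc l.+1 j.
  have piE : pi 0 j = \sum_s pi 0 s * ((M ^+ k.+1) ^+ l.+1) s j.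
    have : pi *m ((M ^+ k.+1) ^+ l.+1) = pi.
      rewrite -exprM; elim: (_ * _)%N => [|q IH]; first by rewrite expr0 mulmx1.
      by rewrite exprS -mulmxE mulmxA piM.
    by move/(congr1 (fun X : 'rV[R]_n => X 0 j)); rewrite mxE => <-.
  have pis : \sum_s pi 0 s = 1.
    have := congr1 (fun X : 'M[R]_1 => X 0 0) pi1; rewrite !mxE /= => E1.
    by rewrite -[RHS]E1; apply: eq_bigr => s _; rewrite mxE mulr1.
  have /andP[p1 p2] : lo <= pi 0 j <= hi.
    have cE (c : R) : c = \sum_s pi 0 s * c by rewrite -mulr_suml pis mul1r.
    rewrite piE [in X in X && _](cE lo) [in X in _ && X](cE hi); apply/andP;
      split;
      apply: ler_sum => s _; rewrite ler_wpM2l//; by case/andP: (H s).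
  have -> : ((M ^+ k.+1) ^+ l.+1 - const_mx 1 *m pi) i j = ((M ^+ k.+1) ^+
    l.+1) i j - pi 0 j.
    by rewrite !mxE big_ord1 !mxE mul1r.
  have /andP[q1 q2] := H i.
  by rewrite -subr_ge0 subr_sqr mulr_ge0//; move: p1 p2 q1 q2; lra.
have [l lP] : exists l : nat, (n * n)%:R * ((1 - dl) ^+ l.+1) ^+ 2 <= e.
  have : ((n * n)%:R * ((1 - dl) ^+ l) ^+ 2) @[l --> \oo] --> (n * n)%:R * (0
    * 0 : R).
    apply: cvgMr; apply: cvgM; apply: cvg_expr; rewrite ger0_norm; lra.
  rewrite !mulr0 => /cvgrPdist_le/(_ _ e0)[l _ /(_ l.+1 (leqnSn l))] /=.
  by move=> H; exists l; rewrite (le_trans _ H)// sub0r normrN ler_norm.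
exists (k.+1 * l.+1).-1%N.
have E : (k.+1 * l.+1).-1.+1 = (k.+1 * l.+1)%N by rewrite mulSn addSn.
rewrite (stochastic_deflated_powers _ Mst piM pi1) E exprM.
apply: le_trans lP; rewrite /fro2 /fdot.
apply: (@le_trans _ _ (\sum_(i < n) \sum_(j < n) ((1 - dl) ^+ l.+1) ^+ 2)).
  by do 2! [apply: ler_sum => ? _]; rewrite -expr2.
by rewrite !sumr_const !card_ord -mulrnA [leRHS]mulr_natl.
Qed.

(* The weights grow from 1 to 2 along [i < N], which turns a contraction of the
   [N]-th power into a one-step contraction. *)
Definition adapted M N p (X : 'M[R]_(n, p)) : R :=
  \sum_(i < N) (1 + i%:R / N%:R) * fro2 (M ^+ i *m X).

Lemma adapted_fro2 M N p (X : 'M[R]_(n, p)) : fro2 X <= adapted M N.+1 X.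
Proof.
rewrite /adapted big_ord_recl expr0 mul0r addr0 mul1r mul1mx lerDl sumr_ge0//
  => i _.
by rewrite mulr_ge0 ?fro2_ge0// addr_ge0.
Qed.

Lemma adapted_ge0 M N p (X : 'M[R]_(n, p)) : 0 <= adapted M N X.
Proof.
by apply: sumr_ge0 => i _; rewrite mulr_ge0 ?fro2_ge0// addr_ge0.
Qed.

Lemma adapted_le M N : exists2 C : R, 0 < C & forall p (X : 'M[R]_(n, p)),
  adapted M N X <= C * fro2 X.
Proof.
exists (1 + \sum_(i < N) (1 + i%:R / N%:R) * fro2 (M ^+ i)).
  rewrite ltr_wpDr//; apply: sumr_ge0 => i _.
  by rewrite mulr_ge0 ?fro2_ge0// addr_ge0.
move=> p X; rewrite mulrDl mul1r ler_wpDl ?fro2_ge0// mulr_suml ler_sum// =>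
  i _.
by rewrite -mulrA ler_wpM2l ?fro2_mulmx// addr_ge0.
Qed.

Lemma adaptedD_le M N p (X Y : 'M[R]_(n, p)) e : 0 < e ->
  adapted M N (X + Y) <= (1 + e) * adapted M N X + (1 + e^-1) * adapted M N Y.
Proof.
move=> e0; rewrite /adapted !mulr_sumr -big_split ler_sum// => i _ /=.
rewrite mulmxDr mulrCA (mulrCA (1 + e^-1)) -mulrDr ler_wpM2l ?addr_ge0//.
exact: fro2D_le.
Qed.

(** Multiplying by [M] shifts the sum by one place. With K = N + 1, the term of [M ^+ i.+1] gets
    weight 1 + i/K instead of 1 + (i+1)/K, a relative loss of at least 1/(2 K) because weights are
    at most 2. The new last term is paid by the first: its weight 2 - 1/K times the 1/2 of the
    hypothesis is exactly 1 - 1/(2 K). *)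
Lemma adapted_contraction M N p (X : 'M[R]_(n, p)) :
  fro2 (M ^+ N.+1) <= 2^-1 ->
  adapted M N.+1 (M *m X) <= (1 - (N.+1%:R * 2)^-1) * adapted M N.+1 X.
Proof.
move=> MN; set K : R := N.+1%:R.
have K0 : 0 < K by rewrite ltr0n.
rewrite /adapted.
have E : forall i : 'I_N.+1, M ^+ i *m (M *m X) = M ^+ i.+1 *m X.
  by move=> i; rewrite mulmxA mulmxE -exprSr.
under eq_bigr do rewrite E.
rewrite big_ord_recr big_ord_recl /= expr0 mul1mx mul0r addr0 mul1r addrC
  mulrDr.
apply: lerD.
  have : fro2 (M ^+ N.+1 *m X) <= 2^-1 * fro2 X.
    by apply: (le_trans (fro2_mulmx _ _)); rewrite ler_wpM2r// fro2_ge0.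
  have -> : N%:R / K = 1 - K^-1 by rewrite /K -natr1; field; rewrite natr1.
  move=> H; apply: (@le_trans _ _ ((1 + (1 - K^-1)) * (2^-1 * fro2 X))).
    by rewrite ler_wpM2l//; have : K^-1 <= 1;
      [rewrite invf_le1// ler1n|move: (K^-1) => y; lra].
  by rewrite le_eqVlt; apply/orP; left; apply/eqP; field; rewrite gt_eqF.
rewrite mulr_sumr ler_sum// => i _; rewrite mulrA ler_wpM2r ?fro2_ge0//=.
rewrite /bump /= add1n -/K -(@natr1 R i) invfM.
have : i%:R + 1 <= K by rewrite natr1 ler_nat; exact: ltnW (ltn_ord i).
have : 0 <= i%:R :> R by [].
move: (i%:R : R) => x x0 xK.
have Ki : K * K^-1 = 1 by rewrite mulfV// gt_eqF.
have Ki0 : 0 < K^-1 by rewrite invr_gt0.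
have : 0 <= K^-1 * (1 - (x + 1) * K^-1).
  by rewrite mulr_ge0 ?(ltW Ki0)// subr_ge0 ler_pdivrMr ?mul1r.
have -> : (1 - K^-1 / 2) * (1 + (x + 1) / K) = 1 + x / K + K^-1 / 2 * (1 - (x
  + 1) * K^-1).
  by field; rewrite gt_eqF.
by move=> H; rewrite lerDl mulrAC divr_ge0.
Qed.

End powers.

(** * Positive semidefinite matrices as sums of rank-one squares *)

Section psd.
Context {R : realType}.

Lemma dotpE d (x y : 'cV[R]_d) : dotp x y = (x^T *m y) 0 0.
Proof. by rewrite mxE; apply: eq_bigr => i _; rewrite mxE. Qed.

Lemma dotp_fdot d (x y : 'cV[R]_d) : dotp x y = fdot x y.
Proof. by rewrite /fdot /dotp; apply: eq_bigr => i _; rewrite big_ord1. Qed.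

Lemma dotpC d (x y : 'cV[R]_d) : dotp x y = dotp y x.
Proof. by rewrite !dotp_fdot fdotC. Qed.

Lemma dotp_mulmx m d (M : 'M[R]_(m, d)) x y : dotp x (M *m y) = dotp (M^T *m
  x) y.
Proof. by rewrite !dotpE trmx_mul trmxK mulmxA. Qed.

Lemma dotp_delta d i (y : 'cV[R]_d) : dotp (delta_mx i 0) y = y i 0.
Proof.
rewrite /dotp (bigD1 i)//= mxE !eqxx mul1r big1 ?addr0// => j /negPf ji.
by rewrite mxE ji mul0r.
Qed.

Lemma mulmx_delta d (S : 'M[R]_d) i j :
  (S *m delta_mx i 0 : 'cV[R]_d) j 0 = S j i.
Proof.
rewrite mxE (bigD1 i)//= mxE !eqxx mulr1 big1 ?addr0// => l /negPf li.
by rewrite mxE li mulr0.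
Qed.

Lemma dotp_sqr d (x t : 'cV[R]_d) : dotp t (x *m x^T *m t) = dotp x t ^+ 2.
Proof.
rewrite -mulmxA dotp_mulmx /dotp big_ord1 expr2 mxE.
by congr (_ * _); apply: eq_bigr => i _; rewrite mxE.
Qed.

Definition psd d (S : 'M[R]_d) := forall t : 'cV[R]_d, 0 <= dotp t (S *m t).

Lemma quadratic_shift d (S : 'M[R]_d) (t : 'cV[R]_d) i c : S^T = S ->
  dotp (t + c *: delta_mx i 0) (S *m (t + c *: delta_mx i 0)) =
  dotp t (S *m t) + 2 * c * (S *m t) i 0 + c ^+ 2 * S i i.
Proof.
move=> St; rewrite mulmxDr -scalemxAr !dotp_fdot !(fdotDl, fdotDr, fdotZl,
  fdotZr).
have -> : fdot t (S *m delta_mx i 0) = (S *m t) i 0.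
  by rewrite -dotp_fdot dotp_mulmx St dotpC dotp_delta.
rewrite -!dotp_fdot !dotp_delta.
by rewrite mulmx_delta; ring.
Qed.

Lemma psd_diag_ge0 d (S : 'M[R]_d) i : psd S -> 0 <= S i i.
Proof.
by move=> /(_ (delta_mx i 0)); rewrite dotp_delta mulmx_delta.
Qed.

(** If [S i i = 0], the form at [delta_mx j 0 + c *: delta_mx i 0] is affine in c with slope
    [2 * S i j]; if the slope were nonzero, the chosen c would give the value -1. *)
Lemma psd_zero_row d (S : 'M[R]_d) i j :
  S^T = S -> psd S -> S i i = 0 -> S i j = 0.
Proof.
move=> St Sp Sii; apply/eqP/negP => /negP Sij.
have := Sp (delta_mx j 0 + (- (S j j + 1) / (2 * S i j)) *: delta_mx i 0).
rewrite quadratic_shift// dotp_delta Sii mulr0 addr0 !mulmx_delta.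
have -> : S j j + 2 * (- (S j j + 1) / (2 * S i j)) * S i j = - 1 by field.
by rewrite ler0N1.
Qed.

(** Cholesky elimination: each step subtracts a square that clears one more row and column, and the
    induction counts the leading rows that may still be nonzero. A zero pivot already has a zero
    row. *)
Lemma psd_sum_squares d (S : 'M[R]_d) : S^T = S -> psd S ->
  exists s : seq 'cV[R]_d, S = \sum_(m <- s) m *m m^T.
Proof.
suff : forall k (S : 'M[R]_d), S^T = S -> psd S ->
    (forall i j : 'I_d, (k <= i)%N -> S i j = 0) ->
    exists s : seq 'cV[R]_d, S = \sum_(m <- s) m *m m^T.
  move=> H St Sp; apply: (H d) => // i j.
  by rewrite leqNgt ltn_ord.
elim=> [{}S _ _ S0|k IH {}S St Sp S0].
  by exists [::]; rewrite big_nil; apply/matrixP => i j; rewrite mxE S0.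
have [kd|dk] := ltnP k d; last first.
  by apply: IH => // i j ki; apply: S0; have := leq_trans dk ki;
    rewrite leqNgt ltn_ord.
pose i := Ordinal kd.
have [Sii|Sii] := eqVneq (S i i) 0.
  apply: IH => // l j; rewrite leq_eqVlt => /predU1P[kl|]; last exact: S0.
  by rewrite (_ : l = i); [exact: psd_zero_row|exact: val_inj].
have Sii0 : 0 < S i i by rewrite lt_def Sii psd_diag_ge0.
have Ssym a b : S a b = S b a by rewrite -[in LHS]St mxE.
pose m := (Num.sqrt (S i i))^-1 *: col i S.
have mmE a b : (m *m m^T) a b = S a i * S b i / S i i.
  rewrite mxE big_ord1 !mxE -[X in _ / X](sqr_sqrtr (ltW Sii0)); field.
  by rewrite gt_eqF// sqrtr_gt0.
have [||l j|s sE] := IH (S - m *m m^T).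
- by rewrite linearB /= St trmx_mul trmxK.
(* This shift in direction i minimizes the form of [S], and the minimum is the form of the Schur
   complement at t. *)
- move=> t; have := Sp (t + (- ((S *m t) i 0 / S i i)) *: delta_mx i 0).
  rewrite quadratic_shift//.
  have -> : dotp t ((S - m *m m^T) *m t) = dotp t (S *m t) - dotp m t ^+ 2.
    by rewrite mulmxBl dotp_fdot -scaleN1r fdotDr fdotZr mulN1r -!dotp_fdot
      dotp_sqr.
  suff -> : dotp m t = (S *m t) i 0 / Num.sqrt (S i i).
    rewrite expr_div_n sqr_sqrtr ?(ltW Sii0)//.
    set q := dotp t _; set r := (S *m t) i 0; suff -> : q - r ^+ 2 / S i i =
       q + 2 * (- (r / S i i)) * r + (- (r / S i i)) ^+ 2 * S i i by [].
    by field.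
  rewrite dotp_fdot fdotZl -dotp_fdot mulrC; congr (_ / _).
  by rewrite /dotp mxE; apply: eq_bigr => b _; rewrite mxE Ssym.
- rewrite leq_eqVlt => /predU1P[kl|kl]; rewrite 2!mxE mmE;
    last by rewrite !(S0 l)// !mul0r subrr.
  by rewrite (_ : l = i);
    [rewrite (Ssym j) mulrAC mulfV// mul1r subrr|exact: val_inj].
- by exists (m :: s); rewrite big_cons -sE addrC subrK.
Qed.

End psd.

(** * Recursions and normalized sums of real sequences *)

Section sequences.
Context {R : realType}.

(** One half of the contraction c_k pays for the decrease of beta and the other half for the forcing
    term, because K is at least 2 |C|. The rest of K covers the finitely many indices at which the
    recursion is not assumed. *)
Lemma slow_recursion (s c beta : R ^nat) C : (forall k, 0 < beta k) ->
  (\forall k \near \oo, [/\ 0 <= c k <= 1,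
     beta k - beta k.+1 <= c k / 2 * beta k &
     s k.+1 <= (1 - c k) * s k + C * c k * beta k]) ->
  exists2 K, 0 <= K & forall k, s k <= K * beta k.
Proof.
move=> b0 [k0 _ H]; pose K := \sum_(j < k0.+1) `|s j| / beta j + 2 * `|C|.
have q0 j : 0 <= `|s j| / beta j by rewrite divr_ge0// ltW.
have S0 : 0 <= \sum_(j < k0.+1) `|s j| / beta j by apply: sumr_ge0 => j _.
have K0 : 0 <= K by rewrite addr_ge0// mulr_ge0.
have Kle j : (j <= k0)%N -> s j <= K * beta j.
  rewrite -ltnS => jk; rewrite -ler_pdivrMr//.
  apply: (@le_trans _ _ (`|s j| / beta j)).
    by rewrite ler_pM2r ?invr_gt0// ler_norm.
  rewrite /K (bigD1 (Ordinal jk))//= -addrA lerDl addr_ge0 ?mulr_ge0//.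
  exact: sumr_ge0.
exists K => // k; elim: k => [|k IH]; first exact: Kle.
have [kk|kk] := leqP k.+1 k0; first exact: Kle.
have [/andP[c0 c1] db rec] := H k kk.
apply: (le_trans rec).
have : (1 - c k) * s k <= (1 - c k) * (K * beta k) by rewrite ler_wpM2l//
  subr_ge0.
have KC : 2 * `|C| <= K by rewrite /K lerDr.
have : C * c k * beta k <= K / 2 * c k * beta k.
  rewrite ler_wpM2r ?(ltW (b0 k))// ler_wpM2r//.
  by have := ler_norm C; lra.
have : K * (beta k - beta k.+1) <= K * (c k / 2 * beta k) by rewrite ler_wpM2l.
by lra.
Qed.

(** 1 / sqrt (k+1) is at most 2 (sqrt (k+1) - sqrt k), which telescopes. *)
Lemma sum_inv_sqrt_le k : \sum_(t < k) (Num.sqrt t.+1%:R)^-1 <= 2 * Num.sqrt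
  k%:R :> R.
Proof.
elim: k => [|k IH]; first by rewrite big_ord0 mulr_ge0.
rewrite big_ord_recr /=.
suff : (Num.sqrt k.+1%:R)^-1 <= 2 * (Num.sqrt k.+1%:R - Num.sqrt k%:R) :> R by
  lra.
have y0 : 0 < Num.sqrt k.+1%:R :> R by rewrite sqrtr_gt0 ltr0n.
have x0 : 0 <= Num.sqrt k%:R :> R by rewrite sqrtr_ge0.
have : Num.sqrt k.+1%:R ^+ 2 - Num.sqrt k%:R ^+ 2 = 1 :> R.
  by rewrite !sqr_sqrtr// -natr1 addrC addKr.
move: x0 y0; set x := Num.sqrt _; set y := Num.sqrt _ => x0 y0 E.
have xy : x <= y by rewrite ler_wsqrtr// ler_nat.
rewrite -[y^-1]mul1r ler_pdivrMr//.
have := sqr_ge0 (y - x); move: E; clearbody x y.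
have -> : 2 * (y - x) * y = (y - x) ^+ 2 + (y ^+ 2 - x ^+ 2) by ring.
by move=> ->; lra.
Qed.

(** Terms that are o(1 / sqrt k) have sums that are o(sqrt k), since the sum of the 1 / sqrt (t+1)
    is at most 2 sqrt k; the normalization kills any finite initial sum. *)
Lemma mean_sqrt_cvg0 (s : R ^nat) : (forall k, 0 <= s k) ->
  (forall e : R, 0 < e -> \forall k \near \oo, s k <= e / Num.sqrt k.+1%:R) ->
  (Num.sqrt k%:R)^-1 * \sum_(t < k) s t @[k --> \oo] --> (0 : R).
Proof.
move=> s0 H; apply/cvgrPdist_le => e e0.
have e4 : 0 < e / 4 by rewrite divr_gt0.
have [k0 _ Hk0] := H _ e4.
pose K := \sum_(t < k0) s t.
have bnd k : \sum_(t < k) s t <= K + e / 2 * Num.sqrt k%:R.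
  have : \sum_(t < k) s t <= K + e / 4 * \sum_(t < k) (Num.sqrt t.+1%:R)^-1.
    elim: k => [|k IH]; first by rewrite !big_ord0 mulr0 addr0 sumr_ge0.
    rewrite !big_ord_recr /= mulrDr.
    have [kk|kk] := leqP k0 k.
      by rewrite addrA lerD// ; exact: Hk0.
    have sK : \sum_(i < k) s i + s k <= K.
      rewrite /K -!(big_mkord xpredT s) -big_nat_recr//.
      by rewrite (@big_cat_nat _ _ _ k.+1 0 k0)//= lerDl sumr_ge0.
    rewrite (le_trans sK)// lerDl -mulrDr mulr_ge0 ?(ltW e4)// addr_ge0
      ?invr_ge0//.
    by rewrite sumr_ge0// => i _; rewrite invr_ge0.
  by have := sum_inv_sqrt_le k; move: e4 => /ltW e4 /(ler_wpM2l e4); lra.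
pose M := 2 * (K + 1) / e.
have K0 : 0 <= K by rewrite sumr_ge0.
near=> k.
have kM : M ^+ 2 < k%:R by near: k; exact: nbhs_infty_gtr.
have M0 : 0 < M by rewrite /M divr_gt0// mulr_gt0// ltr_wpDl.
have sk : M <= Num.sqrt k%:R by rewrite -(ger0_norm (ltW M0)) -sqrtr_sqr
  ler_wsqrtr// ltW.
have sk0 : 0 < Num.sqrt k%:R :> R by exact: lt_le_trans sk.
rewrite sub0r normrN ger0_norm; last by rewrite mulr_ge0 ?invr_ge0// sumr_ge0.
rewrite mulrC ler_pdivrMr//; apply: (le_trans (bnd k)).
have : K + 1 <= e / 2 * Num.sqrt k%:R.
  rewrite (_ : K + 1 = e / 2 * M); first by rewrite ler_wpM2l// divr_ge0// ltW.
  by rewrite /M; field; rewrite gt_eqF.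
by lra.
Unshelve. all: by end_near. Qed.

End sequences.

(** * Asymptotics of the step sizes *)

Section step_sizes.
Context {R : realType}.
Variables (a b alpha : R).
Hypotheses (a_gt0 : 0 < a) (b_gt0 : 0 < b) (alpha_bounds : 2^-1 < alpha < 1).

Let x k : R := k%:R + b.
Definition stepsize k : R := a / (k%:R + b) `^ alpha.

Let x0 k : 0 < x k. Proof. by rewrite /x ltr_wpDl. Qed.

Lemma stepsize_gt0 k : 0 < stepsize k.
Proof. by rewrite divr_gt0// powR_gt0//; exact: x0. Qed.

(** The ratio of consecutive steps is r^alpha with r = (k + b) / (k + 1 + b) <= 1, and r^alpha >= r
    because alpha <= 1; so the decrease is at most the step times 1 - r. *)
Lemma stepsize_decr_le k : stepsize k - stepsize k.+1 <= stepsize k / (k%:R +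
  b).
Proof.
have [a0 a1] := andP alpha_bounds.
have xx : x k.+1 = x k + 1 by rewrite /x -natr1 addrAC.
have r1 : x k / x k.+1 <= 1 by rewrite ler_pdivrMr// mul1r xx lerDl.
have r0 : 0 < x k / x k.+1 by rewrite divr_gt0.
have H : x k / x k.+1 <= (x k / x k.+1) `^ alpha.
  by rewrite -[leLHS]powRr1 ?(ltW r0)// ger_powR ?r0// ltW.
have E : stepsize k.+1 = stepsize k * (x k / x k.+1) `^ alpha.
  have E2 : x k `^ alpha = (x k / x k.+1) `^ alpha * x k.+1 `^ alpha.
    by rewrite -powRM ?(ltW (x0 _)) ?(ltW r0)// divfK// gt_eqF.
  rewrite /stepsize -/(x k) -/(x k.+1) E2.
  by field; rewrite !gt_eqF// powR_gt0.
rewrite E -{1}[stepsize k]mulr1 -mulrBr ler_wpM2l ?(ltW (stepsize_gt0 _))//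
  -/(x k).
apply: (@le_trans _ _ (1 - x k / x k.+1)); first by rewrite lerD2l lerN2.
rewrite xx; have -> : 1 - x k / (x k + 1) = (x k + 1)^-1.
  by field; rewrite gt_eqF// ltr_wpDr// ltW.
by rewrite lef_pV2 ?posrE ?lerDl// ltr_wpDr// ltW.
Qed.

Lemma stepsize_nonincr k : stepsize k.+1 <= stepsize k.
Proof.
have [a0 a1] := andP alpha_bounds.
rewrite /stepsize ler_wpM2l ?(ltW a_gt0)// lef_pV2 ?posrE ?powR_gt0// -/(x _)//.
rewrite ge0_ler_powR ?nnegrE ?(ltW (x0 _))//; last by rewrite lerD2r ler_nat.
by apply: ltW; apply: lt_trans a0; rewrite invr_gt0.
Qed.

Lemma powR_near_infty (r M : R) : 0 < r -> \forall k \near \oo, M <= (k%:R +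
  b) `^ r.
Proof.
move=> r0; near=> k.
have [M0|M0] := leP M 0; first by rewrite (le_trans M0)// powR_ge0.
have kM : M `^ r^-1 < k%:R by near: k; exact: nbhs_infty_gtr.
have -> : M = (M `^ r^-1) `^ r by rewrite -powRrM mulVf ?gt_eqF// powRr1// ltW.
rewrite ge0_ler_powR ?nnegrE ?powR_ge0 ?(ltW (x0 _))// ?(ltW r0)//.
by rewrite (le_trans (ltW kM))// lerDl ltW.
Unshelve. all: by end_near. Qed.

Lemma stepsize_cvg0 (e : R) : 0 < e -> \forall k \near \oo, stepsize k <= e.
Proof.
move=> e0; have [a0 a1] := andP alpha_bounds.
have al0 : 0 < alpha by apply: lt_trans a0; rewrite invr_gt0.
near=> k.
have H : a / e <= (k%:R + b) `^ alpha by near: k; exact: powR_near_infty.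
by rewrite /stepsize ler_pdivrMr ?powR_gt0 ?x0// mulrC -ler_pdivrMr.
Unshelve. all: by end_near. Qed.

(** Strictness of alpha < 1 enters here: the quotient of the step by 1 / (k + b) is a (k + b)^(1 -
    alpha), which tends to infinity. *)
Lemma stepsize_not_summable (e : R) : 0 < e ->
  \forall k \near \oo, (k%:R + b)^-1 <= e * stepsize k.
Proof.
move=> e0; have [a0 a1] := andP alpha_bounds.
near=> k.
have H : (e * a)^-1 <= (k%:R + b) `^ (1 - alpha).
  by near: k; apply: powR_near_infty; rewrite subr_gt0.
move: H; rewrite powRB; last by rewrite (gt_eqF (x0 k)) implybT.
rewrite -/(x k) powRr1 ?(ltW (x0 _))//.
rewrite invfM => H; rewrite -[leLHS]mul1r ler_pdivrMr// /stepsize -/(x k).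
have p0 : 0 < x k `^ alpha by rewrite powR_gt0.
have : e * a * (e^-1 / a) <= e * a * (x k / x k `^ alpha).
  by rewrite ler_wpM2l// mulr_ge0// ltW.
rewrite (_ : e * a * (e^-1 / a) = 1); last by field; rewrite !gt_eqF.
by move=> h; rewrite (le_trans h)// !mulrA [leRHS]mulrAC.
Unshelve. all: by end_near. Qed.

(** Strictness of alpha > 1/2 enters here: sqrt (k + b) times the step is a (k + b)^(1/2 - alpha),
    which tends to 0. *)
Lemma stepsize_lt_inv_sqrt (e : R) : 0 < e ->
  \forall k \near \oo, stepsize k <= e / Num.sqrt k.+1%:R.
Proof.
move=> e0; have [a0 a1] := andP alpha_bounds.
near=> k.
(* Chosen because k + 1 <= (1 + 1/b) (k + b). *)
pose c := Num.sqrt (1 + b^-1).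
have c0 : 0 < c by rewrite sqrtr_gt0 ltr_wpDr// invr_ge0 ltW.
have H : a * c / e <= (k%:R + b) `^ (alpha - 2^-1).
  by near: k; apply: powR_near_infty; rewrite subr_gt0.
move: H; rewrite powRB; last by rewrite (gt_eqF (x0 k)) implybT.
rewrite -/(x k) powR12_sqrt ?(ltW (x0 _))// => H.
have p0 : 0 < x k `^ alpha by rewrite powR_gt0.
have s0 : 0 < Num.sqrt (x k) by rewrite sqrtr_gt0.
have k0 : 0 < Num.sqrt k.+1%:R :> R by rewrite sqrtr_gt0 ltr0n.
have ks : Num.sqrt k.+1%:R <= c * Num.sqrt (x k).
  rewrite /c -sqrtrM ?addr_ge0 ?invr_ge0 ?(ltW b_gt0)// ler_wsqrtr//.
  rewrite mulrDl mul1r -natr1.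
  have : 1 <= b^-1 * x k by rewrite mulrC ler_pdivlMr// mul1r /x lerDr.
  by have := b_gt0; rewrite {2}/x; lra.
rewrite /stepsize ler_pdivrMr// mulrAC ler_pdivlMr//.
apply: (@le_trans _ _ (a * (c * Num.sqrt (x k))));
  first by rewrite ler_wpM2l// ltW.
move: H; rewrite ler_pdivrMr// mulrAC ler_pdivlMr// => H.
by rewrite mulrA (mulrC e).
Unshelve. all: by end_near. Qed.

(** The relative decrease of the step is at most 1 / (k + b), which is small compared with the step
    itself. *)
Lemma stepsize_decr_sqr (e : R) : 0 < e ->
  \forall k \near \oo, stepsize k - stepsize k.+1 <= e * stepsize k ^+ 2.
Proof.
move=> e0; near=> k.
apply: (le_trans (stepsize_decr_le k)).
have h : (k%:R + b)^-1 <= e * stepsize k.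
  by near: k; exact: stepsize_not_summable.
rewrite expr2 mulrCA; apply: ler_wpM2l => //; apply: ltW; exact: stepsize_gt0.
Unshelve. all: by end_near. Qed.

Lemma stepsize_gt_inv (e : R) : 0 < e -> \forall k \near \oo, k%:R^-1 <= e *
  stepsize k.
Proof.
move=> e0; have b1 : 0 < 1 + b by rewrite addr_gt0.
have e1 : 0 < e / (1 + b) by exact: divr_gt0.
near=> k.
have k1 : (1 : R) <= k%:R by rewrite ler1n; near: k; exact: nbhs_infty_ge.
have k0 : (0 : R) < k%:R by exact: lt_le_trans k1.
have h : (k%:R + b)^-1 <= e / (1 + b) * stepsize k.
  by near: k; exact: stepsize_not_summable.
apply: (@le_trans _ _ ((1 + b) * (k%:R + b)^-1)).
  rewrite ler_pdivlMr ?addr_gt0// mulrDr mulVf ?gt_eqF// lerD2l ler_piMl ?(ltW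
    b_gt0)//.
  by rewrite invf_le1.
apply: (le_trans (ler_wpM2l (ltW b1) h)).
have -> : (1 + b) * (e / (1 + b) * stepsize k) = e * stepsize k by field;
  rewrite gt_eqF.
by [].
Unshelve. all: by end_near. Qed.

End step_sizes.

(** * Characteristic functions and convergence in distribution *)

Section expectation_kit.
Context {R : realType} {dT : measure_display} {T : measurableType dT}
  (P : probability T R).
Implicit Types f g : T -> R.

Definition L1 f := P.-integrable [set: T] (EFin \o f).
Definition Ex f : R := (\int[P]_w f w)%R.

Lemma L1_meas f : L1 f -> measurable_fun [set: T] f.
Proof. by move=> /measurable_int/measurable_EFinP. Qed.

Lemma L1_cst c : L1 (fun=> c).
Proof. exact: finite_measure_integrable_cst. Qed.

Lemma L1D f g : L1 f -> L1 g -> L1 (fun w => f w + g w).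
Proof. by move=> f1 g1; apply: (integrableD measurableT f1 g1). Qed.

Lemma L1Z c f : L1 f -> L1 (fun w => c * f w).
Proof. by move=> f1; apply: (integrableZl measurableT _ f1). Qed.

Lemma L1N f : L1 f -> L1 (fun w => - f w).
Proof. by move=> f1; apply: (integrableN f1). Qed.

Lemma L1B f g : L1 f -> L1 g -> L1 (fun w => f w - g w).
Proof. by move=> f1 g1; apply: (integrableB measurableT f1 g1). Qed.

Lemma L1_sum (I : Type) (s : seq I) (F : I -> T -> R) :
  (forall i, L1 (F i)) -> L1 (fun w => \sum_(i <- s) F i w).
Proof.
move=> F1; elim: s => [|i s IH].
  by under eq_fun do rewrite big_nil; exact: L1_cst.
by under eq_fun do rewrite big_cons; exact: L1D.
Qed.

Lemma L1_le f g : measurable_fun [set: T] f -> L1 g ->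
  (forall w, `|f w| <= g w) -> L1 f.
Proof.
move=> mf g1 fg; apply: (le_integrable measurableT _ _ g1).
  exact/measurable_EFinP.
by move=> w _; rewrite /= lee_fin (le_trans (fg w))// ler_norm.
Qed.

Lemma L1_norm f : L1 f -> L1 (fun w => `|f w|).
Proof. by move=> f1; apply: (integrable_norm f1). Qed.

Lemma L1_bounded f c : measurable_fun [set: T] f ->
  (forall w, `|f w| <= c) -> L1 f.
Proof. by move=> mf /(L1_le mf (L1_cst c)). Qed.

Lemma Ex_cst c : Ex (fun=> c) = c.
Proof.
rewrite /Ex Rintegral_cst// -[RHS]mulr1; congr (_ * _).
exact: (congr1 fine (probability_setT P)).
Qed.

Lemma ExD f g : L1 f -> L1 g -> Ex (fun w => f w + g w) = Ex f + Ex g.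
Proof. by move=> f1 g1; rewrite /Ex RintegralD. Qed.

Lemma ExB f g : L1 f -> L1 g -> Ex (fun w => f w - g w) = Ex f - Ex g.
Proof. by move=> f1 g1; rewrite /Ex RintegralB. Qed.

Lemma ExZ c f : L1 f -> Ex (fun w => c * f w) = c * Ex f.
Proof. by move=> f1; rewrite /Ex RintegralZl. Qed.

Lemma Ex_sum (I : Type) (s : seq I) (F : I -> T -> R) :
  (forall i, L1 (F i)) ->
  Ex (fun w => \sum_(i <- s) F i w) = \sum_(i <- s) Ex (F i).
Proof.
move=> F1; elim: s => [|i s IH].
  by under [in LHS]eq_fun do rewrite big_nil; rewrite big_nil Ex_cst.
under [in LHS]eq_fun do rewrite big_cons.
by rewrite big_cons ExD ?IH//; exact: L1_sum.
Qed.

Lemma Ex_le f g : L1 f -> L1 g -> (forall w, f w <= g w) -> Ex f <= Ex g.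
Proof. by move=> f1 g1 fg; apply: le_Rintegral. Qed.

Lemma Ex_ge0 f : (forall w, 0 <= f w) -> 0 <= Ex f.
Proof. by move=> f0; apply: Rintegral_ge0. Qed.

Lemma Ex_norm_le f : L1 f -> `|Ex f| <= Ex (fun w => `|f w|).
Proof. by move=> f1; apply: le_normr_Rintegral. Qed.

Lemma Ex_bound f g : L1 f -> L1 g -> (forall w, `|f w| <= g w) -> `|Ex f| <=
  Ex g.
Proof.
move=> f1 g1 fg; apply: (le_trans (Ex_norm_le f1)); apply: Ex_le => //.
exact: L1_norm.
Qed.

Lemma integral_Ex f : L1 f -> (\int[P]_w (f w)%:E)%E = (Ex f)%:E.
Proof. by move=> f1; rewrite /Ex /Rintegral fineK// integrable_fin_num. Qed.

(* Jensen for the square, by the AM-GM inequality [2 |f| <= e f^2 + 1/e]. *)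
Lemma Ex_norm_sqr f : measurable_fun [set: T] f -> L1 (fun w => f w ^+ 2) ->
  L1 f /\ Ex (fun w => `|f w|) ^+ 2 <= Ex (fun w => f w ^+ 2).
Proof.
move=> mf f2; have f1 : L1 f.
  apply: (L1_le mf (L1D (L1_cst 1) f2)) => w.
  by have := sqr_ge0 (`|f w| - 1);
    rewrite sqrrB expr1n real_normK ?num_real//; have := normr_ge0 (f w); lra.
split=> //; set m := Ex (fun w => `|f w|).
have /= := Ex_ge0 (fun w => sqr_ge0 (`|f w| - m)).
have -> : (fun w => (`|f w| - m) ^+ 2) = (fun w =>
  f w ^+ 2 + (- (2 * m) * `|f w| + m ^+ 2)).
  by apply/funext => w; rewrite sqrrB real_normK ?num_real//; ring.
have L := L1Z (- (2 * m)) (L1_norm f1).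
rewrite ExD//; last by apply: L1D => //; exact: L1_cst.
rewrite ExD//; last exact: L1_cst.
by rewrite ExZ ?Ex_cst -/m; [lra|exact: L1_norm].
Qed.

End expectation_kit.

(** * Taylor bounds for sine and cosine *)

Section trigonometric_taylor.
Context {R : realType}.
Implicit Types x b c : R.

Lemma norm_sin_le x : `|sin x| <= `|x|.
Proof.
wlog x0 : x / 0 < x => [hw|].
  have [x0|/hw//|->] := ltgtP x 0; last by rewrite sin0.
  by rewrite -normrN -sinN -(normrN x) hw// oppr_gt0.
have := @MVT R sin cos 0 x x0 (fun y _ => is_derive_sin y).
case=> [|y _]; first by apply: continuous_subspaceT; exact: continuous_sin.
rewrite sin0 !subr0 => ->; rewrite normrM ler_piMl// cos_max//.
Qed.

Lemma norm_cos_sub1_le x : `|cos x - 1| <= x ^+ 2 / 2.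
Proof.
have -> : x = x / 2 + x / 2 by rewrite -splitr.
move: (x / 2) => y.
have -> : cos (y + y) - 1 = - (2 * sin y ^+ 2).
  rewrite cosD; have := cos2Dsin2 y; lra.
have : sin y ^+ 2 <= y ^+ 2.
  rewrite -(real_normK (num_real (sin y))) -[leRHS](real_normK (num_real y)).
  by rewrite lerXn2r ?nnegrE// norm_sin_le.
have s0 := sqr_ge0 (sin y); rewrite normrN ger0_norm; last by lra.
by lra.
Qed.

(** The factor min (1, |x|) gives a cubic bound near 0 and a quadratic one at infinity. In this form
    a finite second moment suffices for the limit theorem. *)
Lemma norm_sin_sub_le x : `|sin x - x| <= 2 * (x ^+ 2 * Num.min 1 `|x|).
Proof.
wlog x0 : x / 0 < x => [hw|].
  have [x0|/hw//|->] := ltgtP x 0;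
    last by rewrite sin0 subrr normr0 expr0n !mul0r mulr0.
  have := hw (- x); rewrite oppr_gt0 => /(_ x0).
  by rewrite sinN -opprD normrN sqrrN normrN.
rewrite (gtr0_norm x0); have [x1|x1] := leP 1 x.
  rewrite mulr1; apply: (le_trans (ler_normB _ _)).
  have := norm_sin_le x; rewrite (gtr0_norm x0) => h.
  have : x <= x ^+ 2 by rewrite expr2 ler_peMl// ltW.
  by lra.
have D (y : R) : y \in `]0, x[ -> is_derive y 1 (fun z =>
  sin z - z) (cos y - 1).
  by move=> _; apply: is_deriveB.
have := @MVT R _ _ 0 x x0 D.
case=> [|y /itvP yx].
  apply: continuous_subspaceT => z; apply: cvgB;
    [exact: continuous_sin|exact: cvg_id].
rewrite sin0 !subr0 => ->; rewrite normrM (gtr0_norm x0).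
have : `|cos y - 1| <= x ^+ 2 / 2.
  apply: (le_trans (norm_cos_sub1_le _)); rewrite ler_wpM2r ?invr_ge0//.
  by rewrite lerXn2r ?nnegrE ?yx ?(ltW x0).
move=> /(ler_wpM2r (ltW x0));
  have : 0 <= x ^+ 2 * x by rewrite mulr_ge0 ?sqr_ge0 ?ltW.
by lra.
Qed.

Lemma norm_cos_taylor2_le x :
  `|cos x - 1 + x ^+ 2 / 2| <= x ^+ 2 * Num.min 1 `|x|.
Proof.
have [x1|x1] := leP 1 `|x|.
  rewrite mulr1; apply: (le_trans (ler_normD _ _)).
  by have := norm_cos_sub1_le x;
    rewrite (@ger0_norm _ (x ^+ 2 / 2)) ?divr_ge0 ?sqr_ge0//; lra.
move: x1; have -> : x = x / 2 + x / 2 by rewrite -splitr.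
move: (x / 2) => y x1; set z := y + y in x1 *.
(* With z = 2 y the expression is twice the difference of squares y^2 - sin^2 y. *)
have -> : cos z - 1 + z ^+ 2 / 2 = 2 * ((y - sin y) * (y + sin y)).
  rewrite /z cosD; have := cos2Dsin2 y; lra.
have h1 := norm_sin_sub_le y; rewrite -normrN opprB in h1.
have zy : `|z| = 2 * `|y| by rewrite /z -mulr2n normrMn mulr_natl.
have h2 : `|y + sin y| <= 2 * `|y|.
  by apply: (le_trans (ler_normD _ _)); have := norm_sin_le y; lra.
rewrite !normrM ger0_norm//.
have h3 : `|y - sin y| <= 2 * y ^+ 2.
  apply: (le_trans h1); have : Num.min 1 `|y| <= 1 by rewrite ge_min lexx.
  move=> /(ler_wpM2l (sqr_ge0 y)); lra.
have := ler_pM (normr_ge0 _) (normr_ge0 _) h3 h2; rewrite zy /z; lra.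
Qed.

Lemma cos_taylor2 c x :
  `|cos (c + x) - (cos c - sin c * x - cos c * x ^+ 2 / 2)|
  <= 3 * (x ^+ 2 * Num.min 1 `|x|).
Proof.
have -> : cos (c + x) - (cos c - sin c * x - cos c * x ^+ 2 / 2) =
   cos c * (cos x - 1 + x ^+ 2 / 2) - sin c * (sin x - x).
  by rewrite cosD; ring.
apply: (le_trans (ler_normB _ _)); rewrite !normrM.
have := norm_cos_taylor2_le x; have := norm_sin_sub_le x.
have := ler_pM (normr_ge0 (cos c)) (normr_ge0 (cos x - 1 + x ^+ 2 / 2))
  (cos_max c) (lexx _).
have := ler_pM (normr_ge0 (sin c)) (normr_ge0 (sin x - x)) (sin_max c) (lexx _).
by lra.
Qed.

(** In terms of the midpoint m and the half difference h, the difference of the cosines is -2 sin m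
    sin h. *)
Lemma norm_cos_sub_le (x y : R) : `|cos x - cos y| <= `|x - y|.
Proof.
suff half (m h : R) : `|cos (m + h) - cos (m - h)| <= `|m + h - (m - h)|.
  have := half ((x + y) / 2) ((x - y) / 2).
  have -> : (x + y) / 2 + (x - y) / 2 = x by field.
  by have -> : (x + y) / 2 - (x - y) / 2 = y by field.
rewrite cosB cosD.
have -> : cos m * cos h - sin m * sin h - (cos m * cos h + sin m * sin h) = -
  (2 * (sin m * sin h)) by ring.
have -> : m + h - (m - h) = 2 * h by ring.
rewrite normrN !normrM ger0_norm// ler_wpM2l// -[leRHS]mul1r.
by apply: ler_pM => //; [rewrite ler_norml sin_geN1 sin_le1|exact: norm_sin_le].
Qed.

End trigonometric_taylor.

(** * Characteristic function of the centred normal law *)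

Section normal_characteristic_function.
Context {R : realType}.
Variable sigma : R.
Hypothesis sigma_gt0 : 0 < sigma.
Notation mu := (@lebesgue_measure R).

Let p : R -> R := normal_pdf 0 sigma.
Let w : R := 2 * sigma ^+ 2.
Let K : R := normal_peak sigma.

Let w0 : 0 < w. Proof. by rewrite mulr_gt0 ?exprn_gt0. Qed.
Let K0 : 0 <= K. Proof. exact: normal_peak_ge0. Qed.

Let pE x : p x = K * expR (- (x ^+ 2 / w)).
Proof.
rewrite /p normal_pdfE ?gt_eqF// /normal_fun subr0 /w (mulr_natl (sigma ^+ 2)).
by rewrite mulNr.
Qed.

(** The Radon-Nikodym derivative of [normal_prob] is almost everywhere its density, because both
    have the same integral over every measurable set. *)
Lemma integral_normal_prob (f : R -> R) M : measurable_fun [set: R] f ->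
  (forall x, `|f x| <= M) ->
  (\int[normal_prob 0 sigma]_x (f x)%:E = \int[mu]_x (f x * p x)%:E)%E.
Proof.
move=> mf fM.
have fi : (normal_prob 0 sigma).-integrable [set: R] (EFin \o f).
  exact: (@L1_bounded R _ _ (normal_prob 0 sigma : probability _ R) f M mf fM).
rewrite -(Radon_Nikodym_change_of_variables (normal_prob_dominates 0 sigma))//=.
under [RHS]eq_integral do rewrite EFinM.
apply: ae_eq_integral => //.
- apply: emeasurable_funM; first exact/measurable_EFinP.
  apply: (measurable_int mu).
  by apply: Radon_Nikodym_integrable; exact: normal_prob_dominates.
- apply: emeasurable_funM; first exact/measurable_EFinP.
  by apply/measurable_EFinP; exact: measurable_normal_pdf.
- apply: ae_eqe_mul2l => /=.
  rewrite Radon_NikodymE//=; first exact: normal_prob_dominates.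
  move=> abmu; case: cid => /= h [h1 h2 h3].
  apply: integral_ae_eq => //=.
  + by apply/measurable_EFinP; exact: measurable_normal_pdf.
  + by move=> E E01 mE; rewrite -h3.
Qed.

Let mp : measurable_fun [set: R] p. Proof. exact: measurable_normal_pdf. Qed.

Let pint : mu.-integrable [set: R] (EFin \o p).
Proof. exact: integrable_normal_pdf. Qed.

Let p_ge0 x : 0 <= p x. Proof. exact: normal_pdf_ge0. Qed.

(** Half of the Gaussian exponent absorbs the factor |x|: with u = x^2 / (2 w) one has |x| <= (1 + 2
    w) e^u, and what remains is a multiple of the normal density of deviation
    [Num.sqrt 2 * sigma]. *)
Let xp_int : mu.-integrable [set: R] (fun x => (`|x| * p x)%:E).
Proof.
pose s2 := Num.sqrt 2 * sigma.
have s20 : s2 != 0 by rewrite mulf_neq0 ?gt_eqF// sqrtr_gt0.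
have s2E : s2 ^+ 2 = 2 * sigma ^+ 2 by rewrite exprMn sqr_sqrtr.
pose C := (1 + 2 * w) * K / normal_peak s2.
have C0 : 0 <= C by rewrite !mulr_ge0// ?invr_ge0 ?normal_peak_ge0//
  addr_ge0// mulr_ge0// ltW.
have qi : mu.-integrable [set: R] (fun x => C%:E * (normal_pdf 0 s2 x)%:E)%E.
  by apply: integrableZl => //; exact: integrable_normal_pdf.
apply: (le_integrable measurableT _ _ qi).
  by apply/measurable_EFinP/measurable_funM => //; exact: normr_measurable.
move=> x _; rewrite -EFinM !abse_EFin lee_fin.
rewrite ger0_norm ?mulr_ge0// ger0_norm; last first.
  by apply: mulr_ge0 => //; exact: normal_pdf_ge0.
rewrite pE normal_pdfE// /normal_fun subr0.
have -> : C * (normal_peak s2 * expR (- x ^+ 2 / (s2 ^+ 2 *+ 2))) =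
    (1 + 2 * w) * K * expR (- x ^+ 2 / (s2 ^+ 2 *+ 2)).
  by rewrite /C mulrA divfK// gt_eqF// normal_peak_gt0.
set u := x ^+ 2 / (s2 ^+ 2 *+ 2).
have uE : - x ^+ 2 / (s2 ^+ 2 *+ 2) = - u by rewrite mulNr.
have wE : x ^+ 2 / w = u + u.
  by rewrite /u s2E -/w -mulr_natl; field; rewrite gt_eqF.
have xE : x ^+ 2 = 2 * w * u.
  by rewrite /u s2E -/w -mulr_natl; field; rewrite gt_eqF.
have u0 : 0 <= u by rewrite /u divr_ge0 ?sqr_ge0// mulrn_wge0// sqr_ge0.
rewrite uE wE opprD expRD.
have xu : `|x| <= (1 + 2 * w) * expR u.
  have x1 : `|x| <= 1 + x ^+ 2.
    by have := sqr_ge0 (`|x| - 1);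
      rewrite sqrrB expr1n real_normK ?num_real//; have := normr_ge0 x; lra.
  apply: (le_trans x1); rewrite xE.
  have := expR_ge1Dx u => h.
  apply: (@le_trans _ _ ((1 + 2 * w) * (1 + u)));
    last by rewrite ler_wpM2l// addr_ge0// mulr_ge0// ltW.
  by have := w0; nra.
have -> : `|x| * (K * (expR (- u) * expR (- u))) = (`|x| * expR (- u)) * (K *
  expR (- u)) by ring.
have -> : (1 + 2 * w) * K * expR (- u) = (1 + 2 * w) * (K * expR (- u)) by ring.
rewrite ler_wpM2r ?mulr_ge0 ?expR_ge0//.
apply: (le_trans (ler_wpM2r (expR_ge0 (- u)) xu)).
by rewrite -mulrA -expRD subrr expR0 mulr1.
Qed.

Let p_cvg0 : p n%:R @[n --> \oo] --> 0 /\ p (- n%:R) @[n --> \oo] --> 0.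
Proof.
have E x : p (- x) = p x by rewrite !pE sqrrN.
suff H : p n%:R @[n --> \oo] --> 0 by split=> //; under eq_fun do rewrite E.
apply/cvgrPdist_le => e e0; near=> n.
rewrite sub0r normrN ger0_norm// pE expRN -/(_ / _).
have n1 : (1 <= n)%N by near: n; exact: nbhs_infty_ge.
have nn : n%:R <= n%:R ^+ 2 :> R by rewrite expr2 ler_peMl// ler1n.
rewrite ler_pdivrMr ?expR_gt0//.
have h : K * w / e < n%:R by near: n; exact: nbhs_infty_gtr.
have : e * (n%:R ^+ 2 / w) <= e * expR (n%:R ^+ 2 / w).
  by rewrite ler_wpM2l ?(ltW e0)//; have := expR_ge1Dx (n%:R ^+ 2 / w : R); lra.
apply: le_trans; rewrite mulrA ler_pdivlMr// mulrC.
move: h; rewrite ltr_pdivrMr// => h;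
  rewrite mulrC (le_trans (ltW h))// mulrC ler_wpM2l// ltW.
Unshelve. all: by end_near. Qed.

(** The fundamental theorem of calculus on [-n, n] gives f (n) - f (-n), and dominated convergence
    passes to the whole line. *)
Lemma Rintegral_derivative_eq0 (f h : R -> R) : continuous h ->
  (forall x : R, is_derive x 1 f (h x)) ->
  mu.-integrable [set: R] (EFin \o h) ->
  f n%:R @[n --> \oo] --> 0 -> f (- n%:R) @[n --> \oo] --> 0 ->
  (\int[mu]_x h x)%R = 0.
Proof.
move=> ch df ih f1 f2.
have mh : measurable_fun [set: R] h by apply/measurable_EFinP;
  exact: measurable_int ih.
pose hn n : R -> \bar R := ((EFin \o h) \_ `[- n%:R, n%:R]%classic).
have L : (\int[mu]_x hn n x)%E @[n --> \oo] --> (\int[mu]_x (h x)%:E)%E.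
  apply: (@dominated_cvg _ _ _ mu setT measurableT hn (EFin \o h) (fun x =>
    `|h x|%:E)) => //.
  - move=> n; apply: (iffLR (@measurable_restrictT _ _ (measurableTypeR R) _
      `[- n%:R, n%:R]%classic (EFin \o h) _)) => //.
    by apply: measurable_funTS; exact: measurable_int ih.
  - move=> x _; apply: cvg_near_cst; near=> n.
    rewrite /hn patchE mem_set//= in_itv/= -ler_norml.
    by apply: ltW; near: n; exact: nbhs_infty_gtr.
  - exact: integrable_norm ih.
  - move=> n x _; rewrite /hn patchE; case: ifP => _ /=;
      first by rewrite lee_fin.
    by rewrite normr0 lee_fin.
have E : \forall n \near \oo, (\int[mu]_x hn n x)%E = (f n%:R - f (- n%:R))%:E.
  near=> n.
  have n0 : (0 < n)%N by near: n; exact: nbhs_infty_gt.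
  rewrite /hn -integral_mkcond (@continuous_FTC2 _ h f) ?EFinB//.
  - by rewrite -subr_gt0 opprK -natrD ltr0n addn_gt0 n0.
  - exact: continuous_subspaceT.
  - split.
    + by move=> x _; apply: ex_derive; exact: df.
    + by apply: cvg_at_right_filter; apply: differentiable_continuous;
        apply/derivable1_diffP; apply: ex_derive; exact: df.
    + by apply: cvg_at_left_filter; apply: differentiable_continuous;
        apply/derivable1_diffP; apply: ex_derive; exact: df.
  - by move=> x _; rewrite derive1E; apply: derive_val; exact: df.
have L2 : (\int[mu]_x hn n x)%E @[n --> \oo] --> 0%E.
  have E' : \forall n \near \oo, (f n%:R - f (- n%:R))%:E = (\int[mu]_x hn n
    x)%E.
    by apply: filterS E => n ->.
  apply: (cvg_trans (near_eq_cvg E')).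
  apply: cvg_EFin => //; first exact: nearW.
  rewrite (_ : 0 = 0 - 0 :> R); last by rewrite subrr.
  by apply: cvgB.
by rewrite /Rintegral (cvg_unique _ L L2).
Unshelve. all: by end_near. Qed.

Let F c s : R := (\int[mu]_x (cos (c + s * x) * p x))%R.

Let cos_meas c s : measurable_fun [set: R] (fun x : R => cos (c + s * x)).
Proof.
apply: continuous_measurable_fun => x.
apply: (@continuous_comp _ _ _ (fun x => c + s * x) cos);
  last exact: continuous_cos.
by apply: cvgD; [exact: cvg_cst|apply: cvgMr; exact: cvg_id].
Qed.

Let cp_int c s : mu.-integrable [set: R] (fun x => (cos (c + s * x) * p x)%:E).
Proof.
apply: (le_integrable measurableT _ _ pint).
  by apply/measurable_EFinP/measurable_funM => //; exact: cos_meas.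
move=> x _; rewrite !abse_EFin lee_fin normrM ler_piMl//; exact: cos_max.
Qed.

Let sin_cos x : sin x = cos (x - pi / 2) :> R.
Proof. by rewrite cosBpihalf. Qed.

Let sp_int c s : mu.-integrable [set: R] (fun x =>
  (x * sin (c + s * x) * p x)%:E).
Proof.
apply: (le_integrable measurableT _ _ xp_int).
  apply/measurable_EFinP/measurable_funM => //; apply: measurable_funM => //.
  by under eq_fun do rewrite sin_cos addrAC; exact: cos_meas.
move=> x _; rewrite !abse_EFin lee_fin !normrM normr_id ler_wpM2r// ler_piMr//.
exact: sin_max.
Qed.

Let dp (x : R) : is_derive x 1 p (- (2 / w * x) * p x).
Proof.
have -> : p = (fun x => K * expR (- (x ^+ 2 / w))) by apply/funext => y;
  rewrite pE.
apply: is_derive_eq.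
by rewrite /GRing.scale /=; ring.
Qed.

(** Gaussian integration by parts: the integrand is the derivative of sin (c + s x) p (x), which
    vanishes at both ends. *)
Let ibp c s : (\int[mu]_x ((s * cos (c + s * x) - 2 / w * (x * sin (c + s *
  x))) * p x))%R = 0.
Proof.
apply: (@Rintegral_derivative_eq0 (fun x => sin (c + s * x) * p x)
  (fun x => (s * cos (c + s * x) - 2 / w * (x * sin (c + s * x))) * p x)).
- move=> x; apply: cvgM.
    apply: cvgB; apply: cvgMr.
      apply: (@continuous_comp _ _ _ (fun x => c + s * x) cos);
        last exact: continuous_cos.
      by apply: cvgD; [exact: cvg_cst|apply: cvgMr; exact: cvg_id].
    apply: cvgM; first exact: cvg_id.
    apply: (@continuous_comp _ _ _ (fun x => c + s * x) sin);
      last exact: continuous_sin.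
    by apply: cvgD; [exact: cvg_cst|apply: cvgMr; exact: cvg_id].
  by apply: continuous_normal_pdf; rewrite gt_eqF.
- move=> x; have dpx := dp x; clearbody p; apply: is_derive_eq.
  by rewrite /GRing.scale /=; ring.
- have -> : (EFin \o (fun x =>
    (s * cos (c + s * x) - 2 / w * (x * sin (c + s * x))) * p x)) =
     (fun x => s%:E * (cos (c + s * x) * p x)%:E - (2 / w)%:E * (x * sin (c +
       s * x) * p x)%:E)%E.
    by apply/funext => x /=; rewrite -!EFinM -EFinB; congr EFin; ring.
  by apply: integrableB => //; apply: integrableZl.
- have [h _] := p_cvg0;
    apply: (@squeeze_cvgr _ _ _ _ (fun n => - p n%:R) (fun n => p n%:R)) => //.
    apply: nearW => n; rewrite -ler_norml normrM (ger0_norm (p_ge0 _))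
      ler_piMl//; exact: sin_max.
  by rewrite -oppr0; exact: cvgN.
- have [_ h] := p_cvg0;
    apply: (@squeeze_cvgr _ _ _ _ (fun n => - p (- n%:R)) (fun n =>
      p (- n%:R))) => //.
    apply: nearW => n; rewrite -ler_norml normrM (ger0_norm (p_ge0 _))
      ler_piMl//; exact: sin_max.
  by rewrite -oppr0; exact: cvgN.
Qed.

(** Differentiating under the integral gives the integral of - x sin (c + s x) p (x), which [ibp]
    turns into - sigma^2 s F: a linear differential equation for [F c]. *)
Let dF c (s : R) : is_derive s 1 (F c) (- (sigma ^+ 2 * s) * F c s).
Proof.
pose f (s x : R) := cos (c + s * x) * p x.
have df (y x : R) : is_derive y 1 (f ^~ x) (- (x * sin (c + y * x) * p x)).
  by apply: is_derive_eq; rewrite /GRing.scale /=; ring.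
have [Ia intf] : (`]s - 1, s + 1[%classic s /\ True).
  by split=> //; rewrite /= in_itv/=; apply/andP; split; lra.
have pE2 y x : partial1of2 f y x = - (x * sin (c + y * x) * p x).
  by rewrite partial1of2E; apply: derive_val.
have h1 (y : R) : `]s - 1, s + 1[%classic y -> mu.-integrable setT (EFin \o f
  y).
  by move=> _; exact: cp_int.
have h2 (y x : R) : `]s - 1, s + 1[%classic y -> [set: R] x -> derivable (f ^~
  x) y 1.
  by move=> _ _; apply: ex_derive; exact: df.
have h3 (y x : R) : `]s - 1, s + 1[%classic y -> [set: R] x -> `|partial1of2 f
  y x| <= `|x| * p x.
  move=> _ _; rewrite pE2 normrN !normrM (ger0_norm (p_ge0 _)) ler_wpM2r//
    ler_piMr//.
  exact: sin_max.
have h4 x : 0 <= `|x| * p x by rewrite mulr_ge0.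
have D := derivable_under_integral measurableT Ia h1 h2 h4 xp_int h3.
have := differentiation_under_integral measurableT Ia h1 h2 h4 xp_int h3.
rewrite derive1E => V; apply: (@DeriveDef _ _ _ _ _ _ _ D); rewrite {}V.
under eq_Rintegral do rewrite pE2.
have E : (\int[mu]_x ((s * cos (c + s * x) - 2 / w * (x * sin (c + s * x))) *
  p x))%R =
    s * F c s - 2 / w * (\int[mu]_x (x * sin (c + s * x) * p x))%R.
  rewrite /F -(RintegralZl s measurableT (cp_int c s)) -(RintegralZl (2 / w)
    measurableT (sp_int c s)).
  rewrite -(RintegralB measurableT (integrableZl measurableT s (cp_int c s))
    (integrableZl measurableT (2 / w) (sp_int c s))).
  by apply: eq_Rintegral => x _; ring.
move: E; rewrite ibp => /esym E.
have -> : (\int[mu]_x (- (x * sin (c + s * x) * p x)))%R = - (\int[mu]_x (x *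
  sin (c + s * x) * p x))%R.
  rewrite -mulN1r -RintegralZl//; last exact: sp_int.
  by apply: eq_Rintegral => x _; rewrite mulN1r.
move: E; rewrite /w; set I := Rintegral _ _ _ => E.
have : sigma ^+ 2 * (s * F c s - 2 / (2 * sigma ^+ 2) * I) = 0 by rewrite E
  mulr0.
have -> : sigma ^+ 2 * (s * F c s - 2 / (2 * sigma ^+ 2) * I) = sigma ^+ 2 * s
  * F c s - I.
  by field; rewrite gt_eqF.
by move=> h; lra.
Qed.

Lemma normal_characteristic c s :
  (\int[normal_prob 0 sigma]_x (cos (c + s * x))%:E =
   (expR (- (sigma ^+ 2 * s ^+ 2 / 2)) * cos c)%:E)%E.
Proof.
rewrite (integral_normal_prob (cos_meas c s) (fun x => cos_max _)).
transitivity (F c s)%:E.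
  by rewrite /F /Rintegral fineK//; apply: integrable_fin_num => //;
    exact: cp_int.
congr EFin.
(* Integrating factor: the differential equation makes G constant, and its value at 0 is cos c. *)
pose G (y : R) := expR (sigma ^+ 2 * y ^+ 2 / 2) * F c y.
have dG (y : R) : is_derive y 1 G 0.
  have dFy := dF c y; apply: is_derive_eq; rewrite /GRing.scale /=.
  by field.
have := is_derive_0_is_cst s 0 dG.
rewrite /G expr0n mulr0 mul0r expR0 mul1r.
have -> : F c 0 = cos c.
  rewrite /F; under eq_Rintegral do rewrite mul0r addr0.
  by rewrite RintegralZl// /Rintegral integral_normal_pdf mulr1.
by move=> <-; rewrite mulrA -expRD addNr expR0 mul1r.
Qed.

End normal_characteristic_function.

(** * Measurability and uniform continuity on column vectors *)

Section borel_vectors.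
Context {R : realType} {d : nat}.

(** An open set is a countable union of boxes with rational corners, and the preimage of a box is a
    finite intersection of conditions on coordinates. *)
Lemma measurable_fun_borel_cV dT (T : measurableType dT) (f : T -> 'cV[R]_d) :
  (forall i, measurable_fun [set: T] (fun w => f w i 0)) ->
  measurable_fun [set: T] (f : T -> borel_cV R d).
Proof.
move=> mf; apply: (measurability (open : set (set (borel_cV R d)))) => //.
move=> _ [U oU <-]; rewrite setTI.
pose box (pq : 'cV[rat]_d * 'cV[rat]_d) : set 'cV[R]_d :=
  [set x | forall i, ratr (pq.1 i 0) < x i 0 < ratr (pq.2 i 0)].
have -> : f @^-1` U = \bigcup_pq (f @^-1` box pq `&` [set _ | box pq `<=` U]).
  apply/seteqP; split => [w /= Uw|w [pq _ [/= H]]]; last exact.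
  have /nbhs_ballP[e /= e0 eU] : nbhs (f w) U by exact: open_nbhs_nbhs.
  have /choice[p hp] i : exists q : rat, ratr q \in `]f w i 0 - e, f w i 0[.
    by apply: rat_in_itvoo; rewrite ltrBlDr ltrDl.
  have /choice[q hq] i : exists q : rat, ratr q \in `]f w i 0, f w i 0 + e[.
    by apply: rat_in_itvoo; rewrite ltrDl.
  exists (\col_i p i, \col_i q i) => //; split => [i /=|x /= xb].
    by rewrite !mxE; move: (hp i) (hq i);
      rewrite !in_itv/= => /andP[_ ->] /andP[->].
  apply: eU; split => // i j; rewrite ord1.
  have := xb i; rewrite !mxE; move: (hp i) (hq i); rewrite !in_itv/=.
  move=> /andP[p1 _] /andP[_ q1] /andP[x1 x2].
  rewrite /ball /= ltr_norml; apply/andP; split; lra.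
apply: countable_bigcupT_measurable => // pq.
apply: measurableI; last first.
  have [H|H] := pselect (box pq `<=` U).
    by rewrite (_ : [set _ | _] = setT)//; apply/seteqP; split.
  by rewrite (_ : [set _ | _] = set0)//; apply/seteqP; split.
rewrite (_ : f @^-1` box pq = \bigcap_(i in [set: 'I_d])
    ((fun w => f w i 0) @^-1` `]ratr (pq.1 i 0), ratr (pq.2 i 0)[)); last first.
  apply/seteqP; split => w /= H i; first by move=> _; rewrite /= in_itv /=;
    exact: H.
  by have := H i I; rewrite /= in_itv /=.
apply: fin_bigcap_measurable => // i _; rewrite -[X in measurable X]setTI.
exact: mf.
Qed.

Lemma continuous_measurable_cV (h : 'cV[R]_d -> R) : continuous h ->
  measurable_fun [set: borel_cV R d] (h : borel_cV R d -> R).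
Proof.
move=> ch; apply: (measurability _ (RGenOpens.measurableE R)).
move=> _ [_ [a [b ->]] <-]; rewrite setTI; apply: sub_sigma_algebra.
exact/open_comp.
Qed.

Lemma measurable_coord (i : 'I_d) :
  measurable_fun [set: borel_cV R d] (fun x : borel_cV R d =>
    (x : 'cV[R]_d) i 0).
Proof. by apply: continuous_measurable_cV; exact: coord_continuous. Qed.

Lemma trmx_continuous : continuous (@trmx R 1 d).
Proof.
move=> x s /nbhs_ballP[e e0 es]; apply/nbhs_ballP; exists e => // y [_ xy].
by apply: es; split=> // i j; rewrite !mxE; exact: xy.
Qed.

(** Only x is confined to the box; x' may lie outside. Compactness is used in its filter form: a
    threshold eta that works near each point of the box can be chosen uniformly. *)
Lemma box_unif_continuous (h : 'cV[R]_d -> R) (K e : R) : continuous h -> 0 <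
  e ->
  exists2 eta : R, 0 < eta & forall x x' : 'cV[R]_d, (forall i, `|x i 0| <= K)
    ->
    (forall i, `|x i 0 - x' i 0| < eta) -> `|h x - h x'| < e.
Proof.
move=> ch e0.
pose A := [set v : 'rV[R]_d | forall i, `[- K, K]%classic (v ord0 i)].
have Ac : compact A by apply: (@rV_compact R d (fun=> `[- K, K]%classic)) =>
  i; exact: segment_compact.
pose P (eta : R) (v : 'rV[R]_d) := forall x' : 'cV[R]_d,
   (forall i, `|v 0 i - x' i 0| < eta) -> `|h v^T - h x'| < e.
have [|r r0 H] := (compact_near_coveringP A).1 Ac R (0^'+ : set_system R) P _.
  move=> v _.
  have e20 : 0 < e / 2 by rewrite divr_gt0.
  have : {for v, continuous (h \o trmx)}.
    by apply: continuous_comp; [exact: trmx_continuous|exact: ch].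
  move=> /cvgrPdist_lt/(_ _ e20)/nbhs_ballP[r /= r0 rH].
  have r20 : 0 < r / 2 by rewrite divr_gt0.
  exists (ball v (r / 2), [set eta | eta < r / 2]); last first.
    move=> [v' eta] [/= [_ vv'] er] x' xx'.
    have h1 : `|h v^T - h v'^T| < e / 2.
      by apply: (rH v'); split=> // i j; apply: (le_ball _ (vv' i j)); lra.
    have h2 : `|h v^T - h x'| < e / 2.
      have := rH x'^T; rewrite /= trmxK; apply; split => // i j.
      rewrite mxE ord1 /ball /=; have := vv' 0 j; rewrite /ball /= => h3.
      have := ler_normD (v 0 j - v' 0 j) (v' 0 j - x' j 0); rewrite addrA subrK.
      by have := xx' j; move: h3; lra.
    have := ler_normB (h v^T - h v'^T) (h v^T - h x'); rewrite -normrN.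
    have -> : - (h v^T - h v'^T - (h v^T - h x')) = h v'^T - h x' by ring.
    lra.
  split; first exact: nbhsx_ballx.
  by apply: nbhs_right_lt.
have r20 : 0 < r / 2 by rewrite divr_gt0.
exists (r / 2) => // x x' xK xx'.
have := H (r / 2).
rewrite /ball_ /= sub0r normrN gtr0_norm// => /(_ _ _ x^T).
rewrite /P trmxK; apply => //.
- by rewrite ltr_pdivrMr//; lra.
- by move=> i /=; rewrite mxE in_itv/= -ler_norml.
- by move=> i; rewrite mxE.
Qed.

End borel_vectors.

(** * Trigonometric polynomials and Bernstein approximation *)

Section trigonometric_polynomials.
Context {R : realType} {d : nat}.
Implicit Types f g : 'cV[R]_d -> R.

(** A list entry holds an amplitude, a phase and a frequency vector. The phases make constants and
    sines special cases. *)
Definition trigpoly f := exists s : seq (R * R * 'cV[R]_d),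
  forall x, f x = \sum_(e <- s) e.1.1 * cos (e.1.2 + dotp e.2 x).

Lemma dotpDl (x y z : 'cV[R]_d) : dotp (x + y) z = dotp x z + dotp y z.
Proof. by rewrite !dotp_fdot fdotDl. Qed.

Lemma dotpZl c (x z : 'cV[R]_d) : dotp (c *: x) z = c * dotp x z.
Proof. by rewrite !dotp_fdot fdotZl. Qed.

Lemma dotpNl (x z : 'cV[R]_d) : dotp (- x) z = - dotp x z.
Proof. by rewrite -scaleN1r dotpZl mulN1r. Qed.

Lemma trigpoly_cos a c t : trigpoly (fun x => a * cos (c + dotp t x)).
Proof. by exists [:: (a, c, t)] => x; rewrite big_seq1. Qed.

Lemma trigpoly_cst a : trigpoly (fun=> a).
Proof.
have [s sP] := trigpoly_cos a 0 0; exists s => x; rewrite -sP.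
by have := dotpZl 0 0 x; rewrite scale0r mul0r => ->; rewrite addr0 cos0 mulr1.
Qed.

Lemma trigpolyD f g : trigpoly f -> trigpoly g -> trigpoly (fun x => f x + g x).
Proof.
by move=> [s sP] [t tP]; exists (s ++ t) => x; rewrite big_cat /= sP tP.
Qed.

(** Product-to-sum formula: a product of cosines is half the sum of the cosines of the sum and of
    the difference of the arguments. *)
Lemma trigpolyM f g : trigpoly f -> trigpoly g -> trigpoly (fun x => f x * g x).
Proof.
have cosM a c t e : trigpoly (fun x =>
  a * cos (c + dotp t x) * (e.1.1 * cos (e.1.2 + dotp e.2 x))).
  have [s sP] := trigpolyD (trigpoly_cos (a * e.1.1 / 2) (c + e.1.2) (t + e.2))
                   (trigpoly_cos (a * e.1.1 / 2) (c - e.1.2) (t - e.2)).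
  exists s => x; rewrite -sP !dotpDl dotpNl.
  have -> : c + e.1.2 + (dotp t x + dotp e.2 x) = (c + dotp t x) + (e.1.2 +
    dotp e.2 x) by ring.
  have -> : c - e.1.2 + (dotp t x - dotp e.2 x) = (c + dotp t x) - (e.1.2 +
    dotp e.2 x) by ring.
  by rewrite (cosB (c + dotp t x)) (cosD (c + dotp t x)); field.
move=> [s sP] [t tP].
have E : (fun x => f x * g x) = (fun x => \sum_(e <- s) \sum_(e' <- t)
    e.1.1 * cos (e.1.2 + dotp e.2 x) * (e'.1.1 * cos (e'.1.2 + dotp e'.2 x))).
  apply/funext => x; rewrite sP tP mulr_suml; apply: eq_bigr => e _.
  by rewrite mulr_sumr.
rewrite E; elim: s {sP E} => [|e s IH].
  by under eq_fun do rewrite big_nil; exact: trigpoly_cst.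
under eq_fun do rewrite big_cons; apply: trigpolyD => //.
elim: t {tP IH} => [|e' t IH].
  by under eq_fun do rewrite big_nil; exact: trigpoly_cst.
by under eq_fun do rewrite big_cons; apply: trigpolyD.
Qed.

End trigonometric_polynomials.

(* The expectation of H(J), where J counts, coordinate by coordinate, the
   successes in independent Bernoulli trials: the entry i of the list L is a
   trial of success probability y i for the coordinate i. *)
Section bernoulli_trials.
Context {R : realType} {d : nat}.
Variable y : 'I_d -> R.
Hypothesis y01 : forall i, 0 <= y i <= 1.
Implicit Types (L : seq 'I_d) (H : ('I_d -> nat) -> R).

Definition incr (i : 'I_d) (J : 'I_d -> nat) j : nat := (J j + (j == i))%N.

Fixpoint trials L H : R :=
  if L is i :: L' then y i * trials L' (H \o incr i) + (1 - y i) * trials L' H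
  else H (fun=> 0%N).

Lemma trials_le L H1 H2 : (forall J, H1 J <= H2 J) -> trials L H1 <= trials L
  H2.
Proof.
elim: L H1 H2 => [|i L IH] H1 H2 H12 //=.
have /andP[y0 y1] := y01 i.
by rewrite lerD// ler_wpM2l ?subr_ge0// IH// => J; exact: H12.
Qed.

Lemma trialsD L H1 H2 :
  trials L (fun J => H1 J + H2 J) = trials L H1 + trials L H2.
Proof. by elim: L H1 H2 => [|i L IH] H1 H2 //=; rewrite /comp !IH; ring. Qed.

Lemma trialsZ L c H : trials L (fun J => c * H J) = c * trials L H.
Proof. by elim: L H => [|i L IH] H //=; rewrite /comp !IH; ring. Qed.

Lemma trials_cst L c : trials L (fun=> c) = c.
Proof. by elim: L => [|i L IH] //=; rewrite /comp IH; ring. Qed.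

Lemma trials_sum L (F : 'I_d -> ('I_d -> nat) -> R) :
  trials L (fun J => \sum_i F i J) = \sum_i trials L (F i).
Proof.
elim: (index_enum _) => [|i s IH].
  by under eq_fun do rewrite big_nil; rewrite trials_cst big_nil.
by under eq_fun do rewrite big_cons; rewrite trialsD IH big_cons.
Qed.

Lemma trials_norm L H : `|trials L H| <= trials L (fun J => `|H J|).
Proof.
rewrite ler_norml -[X in X <= _]mulN1r -trialsZ !trials_le// => J.
- by rewrite ler_norm.
- by rewrite mulN1r lerNl -normrN ler_norm.
Qed.

(** Squared bias plus binomial variance. The centre c is arbitrary because a success on coordinate i
    shifts it by one in the induction. *)
Lemma trials_second_moment L i c :
  trials L (fun J => ((J i)%:R - c) ^+ 2) =
  ((count_mem i L)%:R * y i - c) ^+ 2 + (count_mem i L)%:R * (y i * (1 - y i)).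
Proof.
elim: L c => [|j L IH] c /=; first by rewrite !mul0r addr0.
rewrite IH; have [->|ji] := eqVneq j i.
  have -> : ((fun J : 'I_d -> nat => ((J i)%:R - c) ^+ 2) \o incr i) =
      (fun J => ((J i)%:R - (c - 1)) ^+ 2).
    by apply/funext => J; rewrite /= /incr eqxx natrD /=; ring.
  by rewrite IH natrD /=; ring.
have -> : ((fun J : 'I_d -> nat => ((J i)%:R - c) ^+ 2) \o incr j) =
    (fun J => ((J i)%:R - c) ^+ 2).
  by apply/funext => J; rewrite /= /incr eq_sym (negPf ji) addn0.
by rewrite IH add0n; ring.
Qed.

End bernoulli_trials.

Section trigonometric_approximation.
Context {R : realType} {d : nat}.

(** On [-1, 1] the cosine is at least 1/2, so sine gains at least eta / 2 between r and r + eta.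
    Sine increases up to pi / 2, so a point s beyond r + eta would have a sine too far from that of
    r. Thus s itself need not be assumed small. *)
Lemma sin_sub_ge (r s eta : R) : `|r| <= 2^-1 -> - (pi / 2) <= s <= pi / 2 ->
  0 < eta <= 2^-1 -> `|sin s - sin r| < eta / 2 -> `|s - r| < eta.
Proof.
have p2 := @pihalf_ge1 R.
suff H (r' s' : R) : `|r'| <= 2^-1 -> - (pi / 2) <= s' <= pi / 2 ->
    0 < eta <= 2^-1 -> sin s' - sin r' < eta / 2 -> s' - r' < eta.
  move=> rb sb eb; rewrite !ltr_norml => /andP[h1 h2]; apply/andP; split;
    last exact: H.
  have /andP[s1 s2] := sb.
  have : - s - - r < eta.
    by apply: H; rewrite ?normrN ?sinN//; [apply/andP; split|]; lra.
  by lra.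
move=> rb /andP[s1 s2] /andP[e0 e1] h; rewrite ltNge; apply/negP => sr.
move: rb; rewrite ler_norml => /andP[r1 r2].
have rr : r' < r' + eta by rewrite ltrDl.
have := @MVT R sin cos r' (r' + eta) rr (fun y _ => is_derive_sin y).
case=> [|y /itvP yx]; first by apply: continuous_subspaceT;
  exact: continuous_sin.
have -> : r' + eta - r' = eta by ring.
move=> E.
have y2 : y ^+ 2 <= 1.
  rewrite -[leRHS](expr1n _ 2) -(real_normK (num_real y)) lerXn2r ?nnegrE//
    ler_norml.
  have : r' <= y by rewrite yx.
  have : y <= r' + eta by rewrite yx.
  lra.
have cy : 2^-1 <= cos y.
  by have := norm_cos_sub1_le y; rewrite ler_norml => /andP[h1 _]; lra.
have : sin (r' + eta) <= sin s'.
  have : r' + eta <= s' by lra.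
  rewrite le_eqVlt => /predU1P[->//|]; rewrite -ltr_sin ?in_itv/= ?s1 ?s2//;
    first exact: ltW.
  by apply/andP; split; lra.
have : 2^-1 * eta <= cos y * eta by rewrite ler_wpM2r// ltW.
rewrite -E; lra.
Qed.

Lemma trials_trigpoly (y : 'cV[R]_d -> 'I_d -> R) L (H : ('I_d -> nat) -> R) :
  (forall i, trigpoly (fun x => y x i)) -> trigpoly (fun x => trials (y x) L H).
Proof.
move=> yt; elim: L H => [|i L IH] H /=; first exact: trigpoly_cst.
apply: trigpolyD; apply: trigpolyM => //.
have -> : (fun x => 1 - y x i) = (fun x => 1 + (-1) * y x i).
  by apply/funext => x; rewrite mulN1r.
by apply: trigpolyD; [exact: trigpoly_cst|apply: trigpolyM => //;
  exact: trigpoly_cst].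
Qed.

(** The variables y_i = (1 + sin (om x_i)) / 2 lie in [0, 1] and are trigonometric polynomials. In
    them take a Bernstein polynomial: the expectation of h at a point estimated from m Bernoulli
    trials per coordinate. As an average of values of h it is bounded by B everywhere, and on the
    box a Chebyshev estimate brings it close to h. *)
Lemma trigonometric_approximation (h : 'cV[R]_d -> R) (B K e : R) :
  continuous h -> (forall x, `|h x| <= B) -> 0 < K -> 0 < e ->
  exists q : 'cV[R]_d -> R, [/\ trigpoly q, forall x, `|q x| <= B &
    forall x : 'cV[R]_d, (forall i, `|x i 0| <= K) -> `|q x - h x| <= e].
Proof.
move=> ch hB K0 e0.
have B0 : 0 <= B by rewrite (le_trans _ (hB 0)).
(* On the box |om x_i| <= 1/2, the range in which [sin_sub_ge] inverts sine. *)
pose om := (2 * K)^-1.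
have om0 : 0 < om by rewrite invr_gt0 mulr_gt0.
have e20 : 0 < e / 2 by rewrite divr_gt0.
have [eta0 eta00 etaP] := box_unif_continuous K ch e20.
pose eta := Num.min 2^-1 (om * eta0).
have eta_gt0 : 0 < eta by rewrite lt_min mulr_gt0// invr_gt0 ltr0n.
pose y (x : 'cV[R]_d) (i : 'I_d) := (1 + sin (om * x i 0)) / 2.
have y01 x i : 0 <= y x i <= 1.
  by have := sin_max (om * x i 0); rewrite ler_norml /y => /andP[? ?];
    apply/andP; split; lra.
have yt i : trigpoly (fun x => y x i).
  have -> : (fun x => y x i) = (fun x =>
    2^-1 + 2^-1 * cos (- (pi / 2) + dotp (om *: delta_mx i 0) x)).
    by apply/funext => x;
      rewrite dotpZl dotp_delta (addrC (- _)) cosBpihalf /y; field.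
  by apply: trigpolyD; [exact: trigpoly_cst|exact: trigpoly_cos].
have [m mP] : exists m : nat, 0 < m%:R :> R /\ 2 * B / (eta / 4) ^+ 2 * d%:R /
  m%:R <= e / 2.
  pose Z := 2 * B / (eta / 4) ^+ 2 * d%:R.
  exists (Num.truncn (Z / (e / 2))).+1; rewrite ltr0n; split=> //.
  rewrite -/Z ler_pdivrMr ?ltr0n// [leRHS]mulrC -ler_pdivrMr//; apply: ltW.
  by apply: truncnS_gt.
pose L := flatten [seq nseq m i | i <- enum 'I_d].
have cL i : count_mem i L = m.
  suff E s : count_mem i (flatten [seq nseq m i | i <- s]) = (m * count_mem i
    s)%N.
    by rewrite /L E count_uniq_mem ?enum_uniq// mem_enum muln1.
  by elim: s => [|j s IH] /=; rewrite ?muln0// count_cat IH count_nseq /=; lia.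
(* Solves y_i = J_i / m for x_i. The minimum with 1 keeps [asin] in its domain, since the
   comparisons of [trials] range over all counts, also those above m. *)
pose pt (J : 'I_d -> nat) : 'cV[R]_d := \col_i (asin (Num.min 1 (2 * (J i)%:R
  / m%:R - 1)) / om).
pose H J := h (pt J).
exists (fun x => trials (y x) L H); split.
- exact: trials_trigpoly.
- move=> x; apply: (le_trans (trials_norm (y01 x) _ _)).
  rewrite -[leRHS](trials_cst (y x) L); apply: trials_le => // J; exact: hB.
- move=> x xK.
  have -> : trials (y x) L H - h x = trials (y x) L (fun J => H J + - h x).
    by rewrite trialsD trials_cst.
  apply: (le_trans (trials_norm (y01 x) _ _)).
  (* C times the squared deviations reaches the trivial error 2 B as soon as one count is off by m
     eta / 4. *)
  pose C := 2 * B / (eta / 4) ^+ 2 / m%:R ^+ 2.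
  have [m0 mle] := mP.
  have C0 : 0 <= C by rewrite !divr_ge0 ?sqr_ge0// mulr_ge0.
  apply: (@le_trans _ _ (trials (y x) L (fun J =>
    e / 2 + C * \sum_i ((J i)%:R - m%:R * y x i) ^+ 2))).
    apply: trials_le => // J.
    have [near|/existsNP[i far]] := pselect (forall i, `|(J i)%:R - m%:R * y x
      i| < m%:R * (eta / 4)).
      apply: (@le_trans _ _ (e / 2));
        last by rewrite lerDl mulr_ge0// sumr_ge0// => i _; exact: sqr_ge0.
      apply: ltW; rewrite distrC; apply: etaP => // i; rewrite mxE.
      have [m0' _] := mP; set c := Num.min 1 _.
      have c1 : -1 <= c <= 1.
        have q0 : 0 <= 2 * (J i)%:R / m%:R :> R by rewrite divr_ge0// mulr_ge0.
        rewrite /c; move: (2 * _ / _) q0 => q q0.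
        by case: (leP 1 (q - 1)) => cc; apply/andP; split; lra.
      have sc : `|c - sin (om * x i 0)| < eta / 2.
        have := near i; rewrite -(mulr_natl _ 2) /y.
        have -> : (J i)%:R - m%:R * ((1 + sin (om * x i 0)) / 2) =
          m%:R / 2 * (2 * (J i)%:R / m%:R - 1 - sin (om * x i 0)).
          by field; rewrite gt_eqF.
        rewrite normrM ger0_norm ?divr_ge0// => h1.
        have h2 : `|2 * (J i)%:R / m%:R - 1 - sin (om * x i 0)| < eta / 2.
          have m2 : 0 < m%:R / 2 :> R by rewrite divr_gt0.
          rewrite -(ltr_pM2l m2) (lt_le_trans h1)// le_eqVlt; apply/orP; left;
            apply/eqP.
          by field.
        have s1 := sin_le1 (om * x i 0); move: h2; rewrite /c.
        move: (2 * _ / _ - 1) => q h2.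
        case: (leP 1 q) h2 => // cc; rewrite !ltr_norml => /andP[h3 h4];
          apply/andP; split; lra.
      have := @sin_sub_ge (om * x i 0) (asin c) eta;
        rewrite asinK ?in_itv//= => HH.
      have /HH : `|om * x i 0| <= 2^-1.
        rewrite normrM gtr0_norm// /om invfM; have := xK i.
        have : 0 < K^-1 by rewrite invr_gt0.
        move=> K1 /(ler_wpM2l (ltW K1)); rewrite mulVf ?gt_eqF// => h1.
        by rewrite -mulrA; lra.
      move=> /(_ _ _ sc); rewrite asin_geNpi2// asin_lepi2// eta_gt0 ge_min
        lexx => /(_ isT isT).
      move=> h1; have -> : x i 0 - asin c / om = - ((asin c - om * x i 0) / om).
        by field; rewrite gt_eqF.
      rewrite normrN normf_div (gtr0_norm om0) ltr_pdivrMr//.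
      by rewrite (lt_le_trans h1)// mulrC /eta ge_min lexx orbT.
    have sq : (m%:R * (eta / 4)) ^+ 2 <= ((J i)%:R - m%:R * y x i) ^+ 2.
      rewrite -[leRHS](real_normK (num_real _)) lerXn2r ?nnegrE//;
        last by rewrite leNgt; exact/negP.
      by rewrite mulr_ge0 ?divr_ge0 ?(ltW m0) ?(ltW eta_gt0).
    have sumle : ((J i)%:R - m%:R * y x i) ^+ 2 <= \sum_i ((J i)%:R - m%:R * y
      x i) ^+ 2.
      by rewrite (bigD1 i)//= lerDl sumr_ge0// => j _; exact: sqr_ge0.
    apply: (@le_trans _ _ (C * \sum_i ((J i)%:R - m%:R * y x i) ^+ 2));
      last by rewrite lerDr ltW.
    apply: (@le_trans _ _ (C * (m%:R * (eta / 4)) ^+ 2)).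
      have -> : C * (m%:R * (eta / 4)) ^+ 2 = 2 * B by rewrite /C; field;
        rewrite !gt_eqF.
      by apply: (le_trans (ler_normB _ _)); have := hB x; have := hB (pt J);
        rewrite /H; lra.
    by rewrite ler_wpM2l// (le_trans sq).
  rewrite trialsD trials_cst trialsZ trials_sum.
  suff : C * (\sum_i trials (y x) L (fun J =>
    ((J i)%:R - m%:R * y x i) ^+ 2)) <= e / 2 by lra.
  apply: (le_trans _ mle).
  apply: (@le_trans _ _ (C * \sum_(i < d) m%:R)).
    rewrite ler_wpM2l// ler_sum// => i _.
    rewrite trials_second_moment cL subrr expr0n add0r ler_piMr//.
    by have /andP[y0 y1] := y01 x i; rewrite mulr_ile1 ?subr_ge0//; lra.
  rewrite sumr_const card_ord -mulr_natl /C le_eqVlt; apply/orP; left;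
    apply/eqP.
  by field; rewrite !gt_eqF.
Qed.

End trigonometric_approximation.

Lemma cvg_sum_seq (R : realType) (I : Type) (s : seq I) (F : I -> R ^nat) (l :
  I -> R) :
  (forall i, F i k @[k --> \oo] --> l i) ->
  \sum_(i <- s) F i k @[k --> \oo] --> \sum_(i <- s) l i.
Proof.
move=> Fl; elim: s => [|i s IH].
  by under eq_fun do rewrite big_nil; rewrite big_nil; exact: cvg_cst.
by under eq_fun do rewrite big_cons; rewrite big_cons; exact: cvgD.
Qed.

(** * Continuity theorem from cosines and tightness *)

Section levy.
Context {R : realType} {d : nat}.

Definition measurable_cV dT (T : measurableType dT) m p (X : T -> 'M[R]_(m,
  p)) :=
  forall i j, measurable_fun [set: T] (fun w => X w i j).

Lemma measurable_dotp dT (T : measurableType dT) (X : T -> 'cV[R]_d) t :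
  measurable_cV X -> measurable_fun [set: T] (fun w => dotp t (X w)).
Proof.
move=> mX; apply: (@measurable_sum _ _ _ _ _ _ (fun i w =>
  t i 0 * X w i 0)) => i.
by apply: measurable_funM.
Qed.

Lemma measurable_cos dT (T : measurableType dT) (f : T -> R) :
  measurable_fun [set: T] f -> measurable_fun [set: T] (fun w => cos (f w)).
Proof.
move=> mf; apply: measurableT_comp => //.
by apply: continuous_measurable_fun; exact: continuous_cos.
Qed.

Lemma L1_cos dT (T : measurableType dT) (P : probability T R) (f : T -> R) :
  measurable_fun [set: T] f -> L1 P (fun w => cos (f w)).
Proof.
move=> mf; apply: (@L1_bounded _ _ _ _ _ 1); first exact: measurable_cos.
by move=> w; exact: cos_max.
Qed.

(** The phase replaces the complex exponential: c = 0 gives the real part of the characteristic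
    function and c = - pi / 2 its imaginary part. *)
Definition charf dT (T : measurableType dT) (P : probability T R)
    (X : T -> 'cV[R]_d) c t : R := Ex P (fun w => cos (c + dotp t (X w))).

Lemma L1_charf dT (T : measurableType dT) (P : probability T R) (X : T ->
  'cV[R]_d) c t :
  measurable_cV X -> L1 P (fun w => cos (c + dotp t (X w))).
Proof.
move=> mX; apply: L1_cos; apply: measurable_funD => //; exact: measurable_dotp.
Qed.

(** A continuous substitute for the indicator of |r| > K: it vanishes up to K and equals 1 from K +
    1 on. *)
Definition tail (K r : R) : R := Num.min 1 (Num.max 0 (`|r| - K)).

Lemma tail_ge0 K r : 0 <= tail K r.
Proof. by rewrite /tail le_min ler01 le_max lexx. Qed.

Lemma tail_le1 K r : tail K r <= 1.
Proof. by rewrite /tail ge_min lexx. Qed.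

Lemma tail_le K r : 0 < K -> tail K r <= `|r| / K.
Proof.
move=> K0; rewrite /tail; have [rK|rK] := leP (`|r| - K) 0.
  by rewrite min_r ?ler01// divr_ge0// ltW.
by rewrite ge_min ler_pdivlMr// mul1r -subr_ge0 ltW.
Qed.

Lemma L1_tail dT (T : measurableType dT) (P : probability T R) K (f : T -> R) :
  measurable_fun [set: T] f -> L1 P (fun w => tail K (f w)).
Proof.
move=> mf; apply: (@L1_bounded _ _ _ _ _ 1).
  apply: measurable_minr => //; apply: measurable_maxr => //.
  by apply: measurable_funB => //; exact: measurableT_comp.
by move=> w; rewrite ger0_norm ?tail_ge0 ?tail_le1.
Qed.

Definition tails dT (T : measurableType dT) (P : probability T R) K (X : T ->
  'cV[R]_d) :=
  \sum_i Ex P (fun w => tail K (X w i 0)).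

(** The list s depends on h, B, K and e but not on the law of [X], so one approximation serves a
    whole sequence and its limit. Where some coordinate exceeds K + 1, a tail equals 1 and pays for
    the trivial error 2 B. *)
Lemma approx_by_charf (h : 'cV[R]_d -> R) (B K e : R) :
  continuous h -> (forall x, `|h x| <= B) -> 0 < K -> 0 < e ->
  exists s : seq (R * R * 'cV[R]_d),
  forall dT (T : measurableType dT) (P : probability T R) (X : T -> 'cV[R]_d),
   measurable_cV X ->
   `|Ex P (fun w => h (X w)) - \sum_(e <- s) e.1.1 * charf P X e.1.2 e.2| <=
     e + 2 * B * tails P K X.
Proof.
move=> ch hB K0 e0.
have K10 : 0 < K + 1 by rewrite addr_gt0.
have B0 : 0 <= B by rewrite (le_trans _ (hB 0)).
have [q [[s sP] qB qh]] := trigonometric_approximation ch hB K10 e0.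
exists s => dT T P X mX.
have L1c (a : R * R * 'cV[R]_d) : L1 P (fun w =>
  a.1.1 * cos (a.1.2 + dotp a.2 (X w))).
  by apply: L1Z; exact: L1_charf.
have E : \sum_(e <- s) e.1.1 * charf P X e.1.2 e.2 = Ex P (fun w => q (X w)).
  under [in RHS]eq_fun do rewrite sP.
  rewrite Ex_sum//; apply: eq_bigr => a _; rewrite ExZ//; exact: L1_charf.
have Lq : L1 P (fun w => q (X w)).
  by under eq_fun do rewrite sP; exact: L1_sum.
have Lh : L1 P (fun w => h (X w)).
  apply: (@L1_bounded _ _ _ _ _ B) => //.
  apply: (measurableT_comp (continuous_measurable_cV ch)).
  by apply: measurable_fun_borel_cV => i; exact: mX.
rewrite E -ExB//.
have Lt : L1 P (fun w => 2 * B * \sum_i tail K (X w i 0)).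
  by apply: L1Z; apply: L1_sum => i; apply: L1_tail; exact: mX.
have -> : e + 2 * B * tails P K X = Ex P (fun w =>
  e + 2 * B * \sum_i tail K (X w i 0)).
  rewrite ExD ?Ex_cst//; last exact: L1_cst.
  rewrite ExZ; last by apply: L1_sum => i; apply: L1_tail; exact: mX.
  by rewrite Ex_sum// => i; apply: L1_tail; exact: mX.
apply: Ex_bound; [exact: L1B|by apply: L1D => //; exact: L1_cst|move=> w].
have [near|/existsNP[i far]] := pselect (forall i, `|X w i 0| <= K + 1).
  rewrite distrC (le_trans (qh _ near))// lerDl !mulr_ge0//.
  by rewrite sumr_ge0// => i _; exact: tail_ge0.
have ti : tail K (X w i 0) = 1.
  by rewrite /tail min_l// le_max; move/negP: far; rewrite -ltNge => far;
    apply/orP; right; lra.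
apply: (@le_trans _ _ (2 * B)).
  by apply: (le_trans (ler_normB _ _)); have := hB (X w); have := qB (X w); lra.
rewrite (bigD1 i)//= ti; have : 0 <= \sum_(j < d | j != i) tail K (X w j 0).
  by apply: sumr_ge0 => j _; exact: tail_ge0.
by move=> S0; have := mulr_ge0 B0 S0; lra.
Qed.

Lemma tails_cvg0 dT (T : measurableType dT) (P : probability T R) (X : T ->
  'cV[R]_d) (e : R) :
  measurable_cV X -> 0 < e -> exists2 K0 : R, 0 < K0 & forall K, K0 <= K ->
    tails P K X <= e.
Proof.
move=> mX e0.
have tle K K' r : K <= K' -> tail K' r <= tail K r.
  move=> KK; rewrite /tail; have := normr_ge0 r; move: (`|r|) => z z0.
  rewrite le_min ge_min lexx/= ge_min; apply/orP; right.
  by rewrite ge_max !le_max lexx/=; apply/orP; right; lra.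
have C i : Ex P (fun w => tail n%:R (X w i 0)) @[n --> \oo] --> (0 : R).
  have : (\int[P]_w (tail n%:R (X w i 0))%:E)%E @[n --> \oo] --> (\int[P]_w
    (cst 0%E w))%E.
    apply: (@dominated_cvg _ _ _ P setT measurableT _ _ (cst 1%E)) => //.
    - by move=> n; exact: measurable_int (L1_tail P n%:R (mX i 0)).
    - move=> w _; apply: cvg_near_cst; near=> n.
      rewrite /tail max_l ?min_r// subr_le0; apply: ltW; near: n;
        exact: nbhs_infty_gtr.
    - by apply: finite_measure_integrable_cst.
    - by move=> n w _; rewrite /= lee_fin ger0_norm ?tail_ge0 ?tail_le1.
  rewrite integral0 => /fine_cvg; apply: cvg_trans; apply: near_eq_cvg.
  by apply: nearW => n; rewrite /= integral_Ex//; exact: L1_tail.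
have : (\sum_i Ex P (fun w =>
  tail n%:R (X w i 0))) @[n --> \oo] --> (\sum_(i < d) 0 : R).
  exact: cvg_sum_seq.
rewrite big1// => /cvgrPdist_le/(_ _ e0)[N _ NP].
exists N.+1%:R => [|K NK]; first by rewrite ltr0n.
have := NP N.+1 (leqnSn N); rewrite /= sub0r normrN; apply: le_trans.
apply: le_trans (ler_norm _); apply: ler_sum => i _.
apply: Ex_le; [exact: L1_tail|exact: L1_tail|by move=> w; exact: tle].
Unshelve. all: by end_near. Qed.

(** Up to tails, small uniformly in k by tightness, the expectation of h is a fixed finite
    combination of values of [charf], and these converge. *)
Theorem levy_continuity dT (T : measurableType dT) (P : probability T R)
    (X : nat -> T -> 'cV[R]_d) dT' (T' : measurableType dT')
    (P' : probability T' R) (X' : T' -> 'cV[R]_d) (h : 'cV[R]_d -> R) (B : R) :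
  (forall k, measurable_cV (X k)) -> measurable_cV X' ->
  (forall e : R, 0 < e -> exists K0 : R, forall K k, K0 <= K -> tails P K (X
    k) <= e) ->
  (forall c t, charf P (X k) c t @[k --> \oo] --> charf P' X' c t) ->
  continuous h -> (forall x, `|h x| <= B) ->
  Ex P (fun w => h (X k w)) @[k --> \oo] --> Ex P' (fun w => h (X' w)).
Proof.
move=> mX mX' tight ccv ch hB; apply/cvgrPdist_le => e e0.
have B0 : 0 <= B by rewrite (le_trans _ (hB 0)).
(* Two tail terms of at most e / 4 and three errors of e / 8 add up to less than e; B + 1 avoids a
   division by 0. *)
have e1 : 0 < e / (8 * (B + 1)) by rewrite divr_gt0// mulr_gt0// ltr_wpDl.
have [K1 K1P] := tight _ e1.
have [K2 K20 K2P] := tails_cvg0 P' mX' e1.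
pose K := Num.max K1 K2.
have K0 : 0 < K by rewrite lt_max K20 orbT.
have e8 : 0 < e / 8 by rewrite divr_gt0.
have [s sP] := approx_by_charf ch hB K0 e8.
have : (\sum_(e <- s) e.1.1 * charf P (X k) e.1.2 e.2) @[k --> \oo] -->
   \sum_(e <- s) e.1.1 * charf P' X' e.1.2 e.2.
  apply: cvg_sum_seq => a; apply: cvgMr; exact: ccv.
have Be : 2 * B * (e / (8 * (B + 1))) <= e / 4.
  have -> : e / 4 = 2 * (B + 1) * (e / (8 * (B + 1))) by field;
    rewrite gt_eqF// ltr_wpDl.
  by rewrite ler_wpM2r ?(ltW e1)//; lra.
move=> /cvgrPdist_le/(_ _ e8); apply: filterS => k hk.
have h1 := sP _ _ P _ (mX k); have h2 := sP _ _ P' _ mX'.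
have B20 : 0 <= 2 * B by rewrite mulr_ge0.
have K1K : K1 <= K by rewrite le_max lexx.
have K2K : K2 <= K by rewrite le_max lexx orbT.
have h3 := ler_wpM2l B20 (K1P K k K1K).
have h4 := ler_wpM2l B20 (K2P K K2K).
rewrite distrC; move: h1 h2 hk h3 h4 Be; rewrite !ler_norml.
move: (Ex _ _) (Ex _ _) (\sum_(_ <- _) _) (\sum_(_ <- _) _) (tails _ _ _)
  (tails _ _ _) => x1 x2 x3 x4 x5 x6.
move: (e / (8 * (B + 1))) => z.
move=> /andP[? ?] /andP[? ?] /andP[? ?] ? ? ?; apply/andP; split; lra.
Qed.

(** A constant sequence is tight, so the continuity theorem applies to it. *)
Corollary charf_determines dT (T : measurableType dT) (P : probability T R)
    (X : T -> 'cV[R]_d) dT' (T' : measurableType dT')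
    (P' : probability T' R) (X' : T' -> 'cV[R]_d) (h : 'cV[R]_d -> R) (B : R) :
  measurable_cV X -> measurable_cV X' ->
  (forall c t, charf P X c t = charf P' X' c t) ->
  continuous h -> (forall x, `|h x| <= B) ->
  Ex P (fun w => h (X w)) = Ex P' (fun w => h (X' w)).
Proof.
move=> mX mX' E ch hB.
have := @levy_continuity _ _ P (fun=> X) _ _ P' X' h B (fun=> mX) mX' _ _ ch hB.
move=> H; suff : Ex P (fun w => h (X w)) @[k --> \oo] --> Ex P' (fun w =>
  h (X' w)).
  by move=> /cvg_lim <-//; apply/esym; exact: lim_cst.
apply: H => [e e0|c t]; last by rewrite E; exact: cvg_cst.
have [K _ KP] := tails_cvg0 P mX e0.
by exists K => K' _; exact: KP.
Qed.

End levy.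

Section uniqueness_real.
Context {R : realType}.

(** Continuous ramps, equal to 1 from a on and to 0 below a - 1/n, converge to the indicator of [a,
    +oo[, and these half-lines form a generating pi-system. *)
Lemma charf_unique (mu1 mu2 : probability (measurableTypeR R) R) :
  (forall c s, Ex mu1 (fun r : R => cos (c + s * r)) = Ex mu2 (fun r : R =>
    cos (c + s * r))) ->
  forall C : set R, measurable C -> mu1 C = mu2 C.
Proof.
move=> E.
pose X (r : measurableTypeR R) : 'cV[R]_1 := const_mx (r : R).
have mX : measurable_cV X.
  by move=> i j; rewrite /X; under eq_fun do rewrite mxE; exact: measurable_id.
have EX c t : charf mu1 X c t = charf mu2 X c t.
  have e : (fun w => cos (c + dotp t (X w))) = (fun r : R =>
    cos (c + t 0 0 * r)).
    by apply/funext => r; rewrite /dotp big_ord1 mxE.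
  by rewrite /charf e E.
have Eh (h : R -> R) : continuous h -> (forall x, `|h x| <= 1) -> Ex mu1 h =
  Ex mu2 h.
  move=> ch hB.
  have := @charf_determines R 1 _ _ mu1 X _ _ mu2 X (fun x =>
    h (x 0 0)) 1 mX mX EX _ _.
  have e : (fun w => h (X w 0 0)) = h by apply/funext => r; rewrite mxE.
  rewrite e; apply => // x.
  by apply: (@continuous_comp _ _ _ (fun x : 'M[R]_1 => x 0 0) h);
    [exact: coord_continuous|exact: ch].
pose hn (a : R) (n : nat) (x : R) := Num.max 0 (Num.min 1 (1 - n%:R * (a - x))).
have chn a n : continuous (hn a n).
  have -> : hn a n = (fun=> 0 : R^o) \max ((fun=> 1 : R^o) \min (fun x =>
    1 - n%:R * (a - x))) by [].
  move=> x; apply: continuous_max; first exact: cvg_cst.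
  apply: continuous_min; first exact: cvg_cst.
  apply: cvgB; first exact: cvg_cst.
  by apply: cvgMr; apply: cvgB; [exact: cvg_cst|exact: cvg_id].
have hn1 a n x : `|hn a n x| <= 1.
  by rewrite ger0_norm /hn ?le_max ?lexx// ge_max ler01/= ge_min lexx.
have lim (mu : probability (measurableTypeR R) R) a :
    (Ex mu (hn a n))%:E @[n --> \oo] --> mu `[a, +oo[%classic.
  have mh n : measurable_fun [set: R] (hn a n) by exact:
    continuous_measurable_fun.
  have : (\int[mu]_x (hn a n x)%:E)%E @[n --> \oo] --> (\int[mu]_x (\1_`[a,
    +oo[%classic x)%:E)%E.
    apply: (@dominated_cvg _ _ _ mu setT measurableT _ _ (cst 1%E)) => //.
    - by move=> n; have /measurable_EFinP := mh n.
    - move=> x _; apply: cvg_near_cst; near=> n.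
      rewrite indicE /hn; have [ax|xa] := leP a x.
        rewrite mem_set ?min_l ?max_r//= ?in_itv/= ?ax//.
        have : n%:R * (a - x) <= 0 by rewrite mulr_ge0_le0// subr_le0.
        lra.
      rewrite memNset/= ?in_itv/=; last by rewrite andbT; apply/negP;
        rewrite -ltNge.
      rewrite max_l// ge_min; apply/orP; right; rewrite subr_le0.
      rewrite -ler_pdivrMr ?subr_gt0// mul1r; apply: ltW; near: n;
        exact: nbhs_infty_gtr.
    - exact: finite_measure_integrable_cst.
    - by move=> n x _; rewrite /= lee_fin.
  rewrite integral_indic// setIT; apply: cvg_trans; apply: near_eq_cvg;
    apply: nearW => n.
  exact/integral_Ex/(@L1_bounded R _ _ mu (hn a n) 1 (mh n) (hn1 a n)).
move=> C mC; apply: (@measure_unique _ R (measurableTypeR R) (@RGenCInfty.G R)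
  (fun n => `[- n%:R, +oo[%classic) _ _ _ _ mu1 mu2 _ _ C mC).
- exact: RGenCInfty.measurableE.
- move=> _ _ [x ->] [y ->]; exists (Num.max x y); apply/seteqP; split=> z /=.
    by rewrite !in_itv/= !andbT ge_max => -[-> ->].
  by rewrite !in_itv/= !andbT ge_max => /andP[].
- by move=> n; exists (- n%:R).
- apply/seteqP; split=> // x _; exists (Num.truncn `|x|).+1 => //=.
  rewrite in_itv/= andbT lerNl (le_trans (ler_norm _))// normrN ltW//.
  exact: truncnS_gt.
- move=> _ [a ->]; have l2 := lim mu2 a.
  have e : (fun n => (Ex mu2 (hn a n))%:E) = (fun n => (Ex mu1 (hn a n))%:E).
    by apply/funext => n; congr EFin; apply/esym/Eh.
  by move: l2; rewrite e; exact: cvg_unique (lim mu1 a).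
- by move=> k; rewrite (le_lt_trans (probability_le1 _ _)) ?ltry.
Unshelve. all: by end_near. Qed.

End uniqueness_real.

(** * Construction of multivariate normal laws *)

Section gaussian.
Context {R : realType}.

Lemma Ex_distribution d1 d2 (T : measurableType d1) (T' : measurableType d2)
    (P : probability T R) (X : {mfun T >-> T'}) (f : T' -> R) :
  measurable_fun [set: T'] f -> L1 P (f \o X) ->
  Ex (distribution P X) f = Ex P (f \o X).
Proof.
move=> mf fX; rewrite /Ex /Rintegral integral_distribution//.
exact/measurable_EFinP.
Qed.

Lemma Ex_dirac d1 (T : measurableType d1) (a : T) (f : T -> R) :
  measurable_fun [set: T] f -> Ex (\d_a : probability T R) f = f a.
Proof.
move=> mf; rewrite /Ex /Rintegral integral_dirac//; last exact/measurable_EFinP.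
by rewrite diracT mul1e.
Qed.

Lemma Ex_product d1 d2 (T1 : measurableType d1) (T2 : measurableType d2)
    (P1 : probability T1 R) (P2 : probability T2 R) (f : T1 * T2 -> R) B :
  measurable_fun [set: T1 * T2] f -> (forall z, `|f z| <= B) ->
  Ex (P1 \x P2)%E f = Ex P1 (fun x => Ex P2 (fun y => f (x, y))).
Proof.
move=> mf fB.
have i12 : (P1 \x P2)%E.-integrable [set: T1 * T2] (EFin \o f).
  exact: (@L1_bounded R _ _ ((P1 \x P2)%E : probability _ R) f B mf fB).
rewrite /Ex /Rintegral -(integral12_prod_meas1 i12); congr fine.
apply: eq_integral => x _; rewrite /fubini_F /= /comp.
rewrite -/(Rintegral _ _ _) -/(Ex _ _) integral_Ex//.
apply: (@L1_bounded _ _ _ _ _ B) => //.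
by apply: measurableT_comp => //; exact: measurable_pair1.
Qed.

(** Each vector m of the list adds an independent standard normal multiple of m: the new measure is
    the law of x + z m under the product of nu with N(0, 1). The empty list is the point mass at 0,
    so singular covariances are covered. *)
Lemma gaussian_exists d (s : seq 'cV[R]_d) :
  exists nu : probability (borel_cV R d) R, forall c t,
    Ex nu (fun x : borel_cV R d => cos (c + dotp t (x : 'cV[R]_d))) =
    expR (- (\sum_(m <- s) dotp m t ^+ 2 / 2)) * cos c.
Proof.
have mid : @measurable_cV R _ (borel_cV R d) d 1 (fun x : borel_cV R d =>
  (x : 'cV[R]_d)).
  by move=> i j; rewrite (ord1 j); exact: measurable_coord.
elim: s => [|m s [nu nuE]].
  exists (\d_(0 : borel_cV R d)) => c t; rewrite Ex_dirac; last first.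
    by apply: measurable_cos; apply: measurable_funD => //;
      exact: measurable_dotp.
  rewrite big_nil oppr0 expR0 mul1r; congr cos.
  by rewrite /dotp big1 ?addr0// => i _; rewrite mxE mulr0.
pose N : probability (measurableTypeR R) R := normal_prob 0 1.
pose phi (z : borel_cV R d * measurableTypeR R) : borel_cV R d :=
  (z.1 : 'cV[R]_d) + (z.2 : R) *: m.
have mphi : measurable_fun setT phi.
  apply: measurable_fun_borel_cV => i; rewrite /phi;
    under eq_fun do rewrite !mxE.
  apply: measurable_funD; last by apply: measurable_funM.
  exact: (measurableT_comp (measurable_coord i)).
pose phiM : {mfun (borel_cV R d * measurableTypeR R)%type >-> borel_cV R d} :=
  HB.pack phi (isMeasurableFun.Build _ _ _ _ phi mphi).
exists (distribution (nu \x N)%E phiM) => c t.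
have mct : measurable_fun [set: borel_cV R d] (fun x : borel_cV R d =>
  cos (c + dotp t (x : 'cV[R]_d))).
  by apply: measurable_cos; apply: measurable_funD => //;
    exact: measurable_dotp.
rewrite Ex_distribution//; last first.
  apply: (@L1_bounded _ _ _ _ _ 1) => [|z]; last exact: cos_max.
  by apply: measurableT_comp.
rewrite (@Ex_product _ _ _ _ _ _ _ 1); last 2 first.
- by apply: measurableT_comp.
- by move=> z; exact: cos_max.
have E (x : borel_cV R d) : Ex N (fun y => ((fun x : borel_cV R d =>
  cos (c + dotp t (x : 'cV[R]_d))) \o phiM) (x, y))
    = expR (- (dotp m t ^+ 2 / 2)) * cos (c + dotp t (x : 'cV[R]_d)).
  have -> : (fun y => ((fun x : borel_cV R d =>
    cos (c + dotp t (x : 'cV[R]_d))) \o phiM) (x, y)) =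
     (fun y : R => cos (c + dotp t (x : 'cV[R]_d) + dotp m t * y)).
    apply/funext => y; rewrite /= /phi /= dotp_fdot fdotDr fdotZr -!dotp_fdot.
    by rewrite addrA (mulrC y) (dotpC t m).
  have := @normal_characteristic R 1 ltr01 (c + dotp t (x : 'cV[R]_d)) (dotp m
    t).
  by rewrite /Ex /Rintegral => ->; rewrite expr1n mul1r.
under eq_fun do rewrite E.
rewrite ExZ; last by apply: L1_cos; apply: measurable_funD => //;
  exact: measurable_dotp.
by rewrite nuE big_cons opprD expRD mulrA.
Qed.

Lemma normal_law_charf (s2 : R) (mu : probability (measurableTypeR R) R) : 0
  <= s2 ->
  (forall c s, Ex mu (fun r : R =>
    cos (c + s * r)) = expR (- (s2 * s ^+ 2 / 2)) * cos c) ->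
  forall C : set R, measurable C -> mu C = normal_law 0 s2 C.
Proof.
move=> s20 muE C mC; rewrite /normal_law; case: eqP => [s2E|/eqP s2N].
  apply: (@charf_unique R mu (\d_(0 : measurableTypeR R))) => // c s.
  rewrite muE s2E !mul0r oppr0 expR0 mul1r Ex_dirac ?mulr0 ?addr0//.
  by apply: measurable_cos; apply: measurable_funD => //;
    exact: measurable_funM.
have s0 : 0 < Num.sqrt s2 by rewrite sqrtr_gt0 lt_def s2N.
apply: (@charf_unique R mu (normal_prob 0 (Num.sqrt s2))) => // c s.
by rewrite muE /Ex /Rintegral (normal_characteristic s0)/= sqr_sqrtr.
Qed.

(** A decomposition of [Sigma] into rank-one squares feeds the iterated construction. The law of
    each linear functional is then recognized from its cosines, at the frequencies s t. *)
Lemma mvnormal_exists d (Sigma : 'M[R]_d) : Sigma^T = Sigma -> psd Sigma ->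
  exists2 nu : probability (borel_cV R d) R, is_mvnormal 0 Sigma nu &
  forall c t, Ex nu (fun x : borel_cV R d => cos (c + dotp t (x : 'cV[R]_d))) =
    expR (- (dotp t (Sigma *m t) / 2)) * cos c.
Proof.
move=> Ssym Spsd; have [s sE] := psd_sum_squares Ssym Spsd.
have [nu nuE] := gaussian_exists s.
have quad t : \sum_(m <- s) dotp m t ^+ 2 / 2 = dotp t (Sigma *m t) / 2.
  rewrite -mulr_suml; congr (_ / _); rewrite sE mulmx_suml dotp_fdot.
  elim: s {sE nuE} => [|m s IH].
    rewrite !big_nil /fdot big1// => i _; rewrite big1// => j _.
    by rewrite mxE mulr0.
  by rewrite !big_cons fdotDr -IH -dotp_fdot dotp_sqr.
have nuE' c t : Ex nu (fun x : borel_cV R d =>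
  cos (c + dotp t (x : 'cV[R]_d))) =
    expR (- (dotp t (Sigma *m t) / 2)) * cos c by rewrite nuE quad.
exists nu => //; split=> // t C mC.
have mid : @measurable_cV R _ (borel_cV R d) d 1 (fun x : borel_cV R d =>
  (x : 'cV[R]_d)).
  by move=> i j; rewrite (ord1 j); exact: measurable_coord.
pose phi (x : borel_cV R d) : measurableTypeR R := dotp t (x : 'cV[R]_d).
have mphi : measurable_fun setT phi by exact: measurable_dotp.
pose phiM : {mfun borel_cV R d >-> measurableTypeR R} :=
  HB.pack phi (isMeasurableFun.Build _ _ _ _ phi mphi).
have -> : dotp t (0 : 'cV[R]_d) = 0.
  by rewrite /dotp big1// => i _; rewrite mxE mulr0.
rewrite -(@normal_law_charf _ (distribution nu phiM))// => c s'.
rewrite Ex_distribution; last 2 first.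
- by apply: measurable_cos; apply: measurable_funD => //;
    exact: measurable_funM.
- by apply: L1_cos; apply: measurable_funD => //;
    apply: measurable_funM => //; exact: mphi.
have -> : ((fun r : R => cos (c + s' * r)) \o phiM) =
    (fun x : borel_cV R d => cos (c + dotp (s' *: t) (x : 'cV[R]_d))).
  by apply/funext => x; rewrite /= /phi dotpZl.
rewrite nuE' -scalemxAr !dotp_fdot fdotZl fdotZr.
by rewrite mulrA (mulrC (s' * s')) -expr2.
Qed.

End gaussian.

(** * Independence and the central limit theorem *)

Section freezing.
Context {R : realType} {dT dE : measure_display} {T : measurableType dT}
  {E : measurableType dE} (P : probability T R).
Variables (Z0 : T -> E) (Zs : nat -> T -> E).
Hypothesis mZ0 : measurable_fun [set: T] Z0.
Hypothesis mZs : forall k, measurable_fun [set: T] (Zs k).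
Hypothesis iid : iid_copies P Z0 Zs.

Definition past_system t : set (set T) :=
  [set S | exists2 C : nat -> set E, (forall k, measurable (C k)) &
     S = \bigcap_(k in [set k | (k < t)%N]) Zs k @^-1` C k].

(** The space [T] with the sigma-algebra generated by the samples of index below t. Being adapted
    becomes measurability with source [past t]. *)
Definition past t := g_sigma_algebraType (past_system t).

Lemma past_measurable t (S : set T) :
  measurable (S : set (past t)) -> measurable S.
Proof.
apply: smallest_sub; first exact: sigma_algebra_measurable.
move=> _ [C mC ->]; apply: bigcap_measurableType => k _.
by rewrite -[X in measurable X]setTI; exact: mZs.
Qed.

Lemma measurable_past_id t : measurable_fun [set: T] (id : T -> past t).
Proof. by move=> _ S mS; rewrite setTI preimage_id;
  exact: (past_measurable mS). Qed.

Lemma measurable_past d' (E' : measurableType d') t (f : T -> E') :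
  measurable_fun [set: past t] (f : past t -> E') -> measurable_fun [set: T] f.
Proof.
move=> mf _ S mS; have := mf measurableT S mS; rewrite !setTI.
exact: (@past_measurable t).
Qed.

Lemma measurable_past_le t t' (S : set T) : (t <= t')%N ->
  measurable (S : set (past t)) -> measurable (S : set (past t')).
Proof.
move=> tt'; apply: smallest_sub; first exact: sigma_algebra_measurable.
move=> _ [C mC ->]; apply: sub_sigma_algebra.
exists (fun k => if (k < t)%N then C k else setT) => [k|]; first by case: ifP.
apply/seteqP; split => w h k /= kt.
  by case: ifP => // kt'; exact: h.
by have := h k (leq_trans kt tt'); rewrite /= kt.
Qed.

Lemma measurable_past_widen d' (E' : measurableType d') t t' (f : T -> E') :
  (t <= t')%N -> measurable_fun [set: past t] (f : past t -> E') ->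
  measurable_fun [set: past t'] (f : past t' -> E').
Proof.
by move=> tt' mf _ S mS; apply: (measurable_past_le tt'); exact: mf.
Qed.

Lemma measurable_past_sample k t : (k < t)%N ->
  measurable_fun [set: past t] (Zs k : past t -> E).
Proof.
move=> kt _ S mS; rewrite setTI; apply: sub_sigma_algebra.
exists (fun j => if j == k then S else setT) => [j|]; first by case: ifP.
apply/seteqP; split => w /= h; last by have := h k kt; rewrite /= eqxx.
by move=> j /= _; case: eqP => // ->.
Qed.

Let K t : {fset nat} := [fset k in iota 0 t]%fset.

Let K_in t k : (k \in K t) = (k < t)%N.
Proof. by rewrite !inE mem_iota add0n. Qed.

Let KS t : K t.+1 = (t |` K t)%fset.
Proof. by apply/fsetP => k; rewrite in_fset1U !K_in ltnS leq_eqVlt. Qed.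

(** Both sides are finite measures in S. They agree on the cylinders, where mutual independence
    applies, and the cylinders form a pi-system generating the past. *)
Lemma past_independent t (S : set T) (B : set E) :
  measurable (S : set (past t)) -> measurable B ->
  (P (S `&` Zs t @^-1` B) = P S * P (Z0 @^-1` B))%E.
Proof.
move=> mS mB; have [same ind] := iid; rewrite -(same t B mB).
have mZB : measurable (Zs t @^-1` B) by rewrite -[X in measurable X]setTI;
  exact: mZs.
pose idM : {mfun T >-> past t} := HB.pack (id : T -> past t)
  (isMeasurableFun.Build _ _ _ _ (id : T -> past t) (@measurable_past_id t)).
have pf : (0 <= fine (P (Zs t @^-1` B)))%R by exact: fine_ge0.
pose m1 : measure (past t) R := pushforward (mrestr P mZB) idM.
pose m2 : measure (past t) R := mscale (NngNum pf) (pushforward P idM).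
have mid : measurable_fun [set: T] idM := @measurable_past_id t.
have : m1 mid S = m2 mid S.
  apply: (@measure_unique _ R (past t) (past_system t) (fun=> setT)) => //.
  - move=> _ _ [C mC ->] [C' mC' ->]; exists (fun k => C k `&` C' k) => [k|].
      exact: measurableI.
    by rewrite -bigcapI; apply: eq_bigcapr => k _; rewrite preimage_setI.
  - move=> _; exists (fun=> setT) => //; apply/seteqP; split=> //.
  - by rewrite bigcup_const.
  - move=> _ [C mC ->];
      rewrite /m1 /m2 /= /pushforward /mrestr /mscale /= /pushforward
        !preimage_id.
    have e1 : \bigcap_(k in [set k | (k < t)%N]) Zs k @^-1` C k =
        \bigcap_(k in [set` K t]) Zs k @^-1` C k.
      by apply/seteqP; split => w h k /= kt; apply: h; move: kt;
        rewrite /= K_in.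
    pose C' k := if k == t then B else C k.
    have e2 : \bigcap_(k in [set k | (k < t)%N]) Zs k @^-1` C k `&` Zs t @^-1`
      B =
        \bigcap_(k in [set` K t.+1]) Zs k @^-1` C' k.
      apply/seteqP; split => [w /= [h1 h2] k /=|w /= h].
        rewrite K_in ltnS leq_eqVlt /C'; case: eqP => [->//|_ /= kt]; exact: h1.
      split=> [k /= kt|].
        by have := h k; rewrite /= K_in ltnS leq_eqVlt kt orbT /C' (ltn_eqF
          kt); apply.
      by have := h t; rewrite /= K_in ltnSn /C' eqxx; apply.
    rewrite e2 e1 !ind//; last by move=> k; rewrite /C'; case: eqP.
    rewrite KS big_fsetU1 ?K_in ?ltnn//= /C' eqxx fineK ?fin_num_measure//.
    congr (_ * _)%E; apply: eq_fbigr => k; rewrite K_in => kt _.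
    by rewrite (ltn_eqF kt).
  - move=> _; rewrite /m1 /= /pushforward /mrestr /=.
    apply: (le_lt_trans (probability_le1 P (measurableI _ _ measurableT mZB))).
    exact: ltry.
rewrite /m1 /m2 /= /pushforward /mrestr /mscale /= /pushforward !preimage_id
  => ->.
by rewrite fineK ?fin_num_measure// muleC.
Qed.

(** By independence, the identity into [past t] and sample t have jointly a product law, and
    Tonelli's theorem integrates the sample out with the past held fixed. Nonnegativity replaces
    integrability. *)
Lemma freezing t (F : T -> E -> R) :
  measurable_fun [set: past t * E] (fun z : past t * E => F z.1 z.2) ->
  (forall w z, 0 <= F w z) ->
  (\int[P]_w (F w (Zs t w))%:E = \int[P]_w \int[P]_w' (F w (Z0 w'))%:E)%E /\
  measurable_fun [set: T] (fun w => \int[P]_w' (F w (Z0 w'))%:E)%E.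
Proof.
move=> mF F0.
pose idM : {mfun T >-> past t} := HB.pack (id : T -> past t)
  (isMeasurableFun.Build _ _ _ _ (id : T -> past t) (@measurable_past_id t)).
pose ZM : {mfun T >-> E} := HB.pack Z0 (isMeasurableFun.Build _ _ _ _ Z0 mZ0).
pose phi w : past t * E := (w, Zs t w).
have mphi : measurable_fun [set: T] phi.
  by apply: measurable_fun_pair; [exact: measurable_past_id|exact: mZs].
pose phiM : {mfun T >-> (past t * E)%type} :=
  HB.pack phi (isMeasurableFun.Build _ _ _ _ phi mphi).
pose f (z : past t * E) := (F z.1 z.2)%:E.
have mf : measurable_fun setT f by exact/measurable_EFinP.
have f0 z : (0 <= f z)%E by rewrite lee_fin.
have inner w : (\int[distribution P ZM]_z f (w, z) = \int[P]_w' (F w (Z0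
  w'))%:E)%E.
  rewrite ge0_integral_distribution//.
  by apply: measurableT_comp => //; exact: measurable_pair1.
have mI : measurable_fun [set: past t] (fun w => \int[P]_w' (F w (Z0 w'))%:E)%E.
  have -> : (fun w => \int[P]_w' (F w (Z0 w'))%:E)%E = fubini_F (distribution
    P ZM) f.
    by apply/funext => w; rewrite -inner.
  exact: measurable_fun_fubini_tonelli_F.
split; last exact: measurable_past mI.
transitivity (\int[distribution P phiM]_z f z)%E.
  by rewrite ge0_integral_distribution.
transitivity (\int[(distribution P idM \x distribution P ZM)%E]_z f z)%E.
  apply: eq_measure_integral => A mA _; apply/esym.
  apply: product_measure_unique => // S B mS mB.
  exact: (past_independent mS mB).
rewrite fubini_tonelli1// ge0_integral_distribution//=.
- by apply: eq_integral => w _; rewrite /fubini_F /= inner.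
- by rewrite /fubini_F; under eq_fun do rewrite inner.
- by move=> w; apply: integral_ge0.
Qed.

Lemma freezing_le t (F : T -> E -> R) (H : T -> R) :
  measurable_fun [set: past t * E] (fun z : past t * E => F z.1 z.2) ->
  (forall w z, 0 <= F w z) -> L1 P H ->
  (forall w, (\int[P]_w' (F w (Z0 w'))%:E <= (H w)%:E)%E) ->
  L1 P (fun w => F w (Zs t w)) /\ Ex P (fun w => F w (Zs t w)) <= Ex P H.
Proof.
move=> mF F0 LH FH; have [E1 mI] := freezing mF F0.
have mFt : measurable_fun [set: T] (fun w => F w (Zs t w)).
  have mphi : measurable_fun [set: T] (fun w => (w, Zs t w) : past t * E).
    by apply: measurable_fun_pair; [exact: measurable_past_id|exact: mZs].
  exact: (measurableT_comp mF mphi).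
have le : (\int[P]_w (F w (Zs t w))%:E <= (Ex P H)%:E)%E.
  rewrite -integral_Ex// E1; apply: ge0_le_integral => //.
  - by move=> w _; apply: integral_ge0 => z _; rewrite lee_fin.
  - exact: measurable_int LH.
have L : L1 P (fun w => F w (Zs t w)).
  apply/integrableP; split; first exact/measurable_EFinP.
  under eq_integral do rewrite /= ger0_norm//.
  by rewrite (le_lt_trans le)// ltry.
by split=> //; rewrite -lee_fin -integral_Ex.
Qed.

End freezing.

(** * Central limit theorem in terms of cosines *)

Section clt.
Context {R : realType}.

(** With u = x / k, compare (e^(-u))^k and (1 - u)^k: k-th powers of numbers in [0, 1] differ by at
    most k times the difference of the numbers, and e^(-u) - (1 - u) <= u^2. *)
Lemma cvg_one_sub_expR (x c : R) : 0 <= x ->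
  (1 - x * (k%:R)^-1) ^+ k * c @[k --> \oo] --> expR (- x) * c.
Proof.
move=> x0; apply: cvgMl; apply/cvgrPdist_le => e e0.
have sub (k : nat) (p q : R) : 0 <= q <= p -> p <= 1 -> p ^+ k - q ^+ k <=
  k%:R * (p - q).
  move=> /andP[q0 qp] p1; elim: k => [|k IH];
    first by rewrite !expr0 subrr mul0r.
  have pk : p ^+ k <= 1 by rewrite exprn_ile1// (le_trans q0).
  have : p ^+ k * (p - q) <= p - q by rewrite ler_piMl// subr_ge0.
  have : q * (p ^+ k - q ^+ k) <= p ^+ k - q ^+ k.
    rewrite ler_piMl ?(le_trans qp)// subr_ge0 lerXn2r ?nnegrE//;
      exact: le_trans qp.
  by rewrite !exprS -natr1; lra.
near=> k.
have k0 : 0 < k%:R :> R by rewrite ltr0n; near: k; exact: nbhs_infty_gt.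
pose u := x * k%:R^-1.
have ku : k%:R * u = x by rewrite /u mulrCA mulfV ?mulr1// gt_eqF.
have u0 : 0 <= u by rewrite mulr_ge0// invr_ge0 ltW.
have u1 : u <= 1 by rewrite ler_pdivrMr// mul1r; apply: ltW; near: k;
  exact: nbhs_infty_gtr.
have eu1 : 1 - u <= expR (- u) by have := expR_ge1Dx (- u).
have eu2 : expR (- u) - (1 - u) <= u ^+ 2.
  have : expR (- u) <= (1 + u)^-1.
    by rewrite expRN lef_pV2 ?posrE ?expR_gt0 ?ltr_wpDr// expR_ge1Dx.
  have : (1 + u)^-1 <= 1 - u + u ^+ 2.
    have u10 : 0 < 1 + u by rewrite ltr_wpDr.
    rewrite -[leLHS]mul1r ler_pdivrMr//.
    have -> : (1 - u + u ^+ 2) * (1 + u) = 1 + u ^+ 3 by ring.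
    by rewrite lerDl exprn_ge0.
  by lra.
have -> : expR (- x) = expR (- u) ^+ k.
  by rewrite -expRM_natl mulrN ku.
have q0 : 0 <= 1 - u by rewrite subr_ge0.
rewrite ger0_norm; last by rewrite subr_ge0 lerXn2r ?nnegrE ?expR_ge0.
apply: (@le_trans _ _ (k%:R * u ^+ 2)).
  apply: (le_trans (sub _ _ _ _ _)).
  - by rewrite q0.
  - by rewrite -expR0 ler_expR oppr_le0.
  - by rewrite ler_wpM2l// ltW.
rewrite expr2 mulrA ku /u mulrA ler_pdivrMr//.
have : x * x / e <= k%:R by apply: ltW; near: k; exact: nbhs_infty_gtr.
by rewrite ler_pdivrMr// (mulrC k%:R).
Unshelve. all: by end_near. Qed.

Context {dT dE : measure_display} {T : measurableType dT}
  {E : measurableType dE} (P : probability T R).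
Variables (Z0 : T -> E) (Zs : nat -> T -> E).
Hypothesis mZ0 : measurable_fun [set: T] Z0.
Hypothesis mZs : forall k, measurable_fun [set: T] (Zs k).
Hypothesis iid : iid_copies P Z0 Zs.
Variable psi : E -> R.
Hypothesis mpsi : measurable_fun [set: E] psi.
Hypothesis psi2 : L1 P (fun w => psi (Z0 w) ^+ 2).
Hypothesis psi0 : Ex P (fun w => psi (Z0 w)) = 0.

Let s2 : R := Ex P (fun w => psi (Z0 w) ^+ 2).
Let mY : measurable_fun [set: T] (fun w => psi (Z0 w)).
Proof. exact: measurableT_comp. Qed.
Let L1Y : L1 P (fun w =>
  psi (Z0 w)). Proof. exact: (Ex_norm_sqr mY psi2).1. Qed.

(** The Taylor error of one summand at frequency tau; at tau = 1 / sqrt k it is o(1/k). *)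
Let eta tau : R :=
  3 * Ex P (fun w => (tau * psi (Z0 w)) ^+ 2 * Num.min 1 `|tau * psi (Z0 w)|).

Let L1eta tau :
  L1 P (fun w => (tau * psi (Z0 w)) ^+ 2 * Num.min 1 `|tau * psi (Z0 w)|).
Proof.
apply: (L1_le _ (L1Z (tau ^+ 2) psi2)) => [|w].
  apply: measurable_funM; first by apply: measurable_funX;
    apply: measurable_funM.
  apply: measurable_minr => //; apply: measurableT_comp => //.
  exact: measurable_funM.
have m0 : 0 <= Num.min 1 `|tau * psi (Z0 w)| by rewrite le_min ler01 normr_ge0.
by rewrite (ger0_norm (mulr_ge0 (sqr_ge0 _) m0)) -exprMn ler_piMr ?sqr_ge0//
  ge_min lexx.
Qed.

Let one_step a tau :
  `|Ex P (fun w => cos (a + tau * psi (Z0 w))) - (1 - s2 * tau ^+ 2 / 2) * cos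
    a| <= eta tau.
Proof.
have L1c : L1 P (fun w => cos (a + tau * psi (Z0 w))).
  by apply: L1_cos; apply: measurable_funD => //; exact: measurable_funM.
have L1a := L1Z (- (sin a * tau)) L1Y.
have L1b := L1Z (- (cos a * tau ^+ 2 / 2)) psi2.
have L1ab := L1D (L1_cst P (cos a)) (L1D L1a L1b).
have -> : (1 - s2 * tau ^+ 2 / 2) * cos a = Ex P (fun w => cos a +
    (- (sin a * tau) * psi (Z0 w) + - (cos a * tau ^+ 2 / 2) * psi (Z0 w) ^+
      2)).
  rewrite ExD ?Ex_cst ?ExD ?ExZ//; [|exact: L1_cst|exact: L1D].
  by rewrite psi0 -/s2; ring.
rewrite -ExB// /eta -ExZ//; apply: Ex_bound => //.
- exact: L1B.
- exact: L1Z.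
move=> w; apply: le_trans (cos_taylor2 a (tau * psi (Z0 w))).
by rewrite le_eqVlt; apply/orP; left; apply/eqP; congr (`| _ |); ring.
Qed.

Let S k w : R := \sum_(j < k) psi (Zs j w).

Let mS k : measurable_fun [set: past Zs k] (S k : past Zs k -> R).
Proof.
apply: (@measurable_sum _ _ _ _ _ _ (fun (j : 'I_k) (w : past Zs k) =>
  psi (Zs j w))) => j.
apply: (measurableT_comp mpsi).
exact: measurable_past_sample.
Qed.

Let L1cS c tau k : L1 P (fun w => cos (c + tau * S k w)).
Proof.
apply: L1_cos; apply: measurable_funD => //; apply: measurable_funM => //.
exact: (measurable_past mZs (@mS k)).
Qed.

Let step c tau k :
  `|Ex P (fun w => cos (c + tau * S k.+1 w)) -
    (1 - s2 * tau ^+ 2 / 2) * Ex P (fun w => cos (c + tau * S k w))| <= eta tau.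
Proof.
pose r := 1 - s2 * tau ^+ 2 / 2.
have mcos : measurable_fun [set: past Zs k * E]
    (fun z : past Zs k * E => cos (c + tau * S k z.1 + tau * psi z.2)).
  apply: measurable_cos; apply: measurable_funD; last first.
    by apply: measurable_funM => //; exact: (measurableT_comp mpsi).
  apply: measurable_funD => //; apply: measurable_funM => //.
  exact: (measurableT_comp (@mS k)).
have L1c (a : R) : L1 P (fun w => cos (a + tau * psi (Z0 w))).
  by apply: L1_cos; apply: measurable_funD => //; exact: measurable_funM.
have SE w : cos (c + tau * S k w + tau * psi (Zs k w)) = cos (c + tau * S k.+1
  w).
  by rewrite /S big_ord_recr/=; congr cos; ring.
(* Freezing needs a nonnegative integrand and yields a single inequality; applied to 1 + s cos (...)
   with s = 1 and s = -1 it gives both. *)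
have key (s : R) : `|s| = 1 ->
    s * Ex P (fun w => cos (c + tau * S k.+1 w)) <=
    s * (r * Ex P (fun w => cos (c + tau * S k w))) + eta tau.
  move=> s1; have sle (x B : R) : `|x| <= B -> s * x <= B.
    by move=> h; rewrite (le_trans (ler_norm _))// normrM s1 mul1r.
  have L1H : L1 P (fun w => (1 + eta tau) + s * r * cos (c + tau * S k w)).
    by apply: L1D; [exact: L1_cst|exact: L1Z].
  have [] := @freezing_le _ _ _ _ _ P Z0 Zs mZ0 mZs iid k
    (fun w z => 1 + s * cos (c + tau * S k w + tau * psi z)) _ _ _ L1H.
  - by apply: measurable_funD => //; apply: measurable_funM => //.
  - move=> w z; have := sle (- cos (c + tau * S k w + tau * psi z)) 1.
    by rewrite normrN => /(_ (cos_max _)); lra.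
  - move=> w; rewrite integral_Ex; last by apply: L1D;
      [exact: L1_cst|exact: L1Z].
    rewrite lee_fin ExD ?Ex_cst ?ExZ//; [|exact: L1_cst|exact: L1Z].
    have := one_step (c + tau * S k w) tau.
    by move=> /sle; rewrite /r; lra.
  - move=> _; under eq_fun do rewrite SE.
    by rewrite !ExD ?Ex_cst ?ExZ//; try exact: L1_cst; try exact: L1Z; lra.
rewrite -/r ler_norml; apply/andP; split.
  have := key (-1); rewrite normrN1 => /(_ erefl); lra.
by have := key 1; rewrite normr1 => /(_ erefl); lra.
Qed.

(** The k steps multiply up to (1 - s2 / (2 k))^k. Their errors only add, because for large k the
    factor has absolute value at most 1, so the total is at most k [eta (tau k)]. *)
Lemma clt_cos (c : R) :
  Ex P (fun w => cos (c + (Num.sqrt k%:R)^-1 * \sum_(j < k) psi (Zs j w)))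
    @[k --> \oo] --> expR (- (s2 / 2)) * cos c.
Proof.
have s20 : 0 <= s2 by apply: Ex_ge0 => w; exact: sqr_ge0.
pose tau k : R := (Num.sqrt k%:R)^-1.
have tau2 k : tau k ^+ 2 = k%:R^-1 by rewrite exprVn sqr_sqrtr.
have min0 (x : R) : 0 <= Num.min 1 `|x| by rewrite le_min ler01 normr_ge0.
have bound : \forall k \near \oo, `|Ex P (fun w => cos (c + tau k * S k w)) -
    (1 - s2 / 2 * (k%:R)^-1) ^+ k * cos c| <= k%:R * eta (tau k).
  near=> m.
  have m0 : 0 < m%:R :> R by rewrite ltr0n; near: m; exact: nbhs_infty_gt.
  have r1 : `|1 - s2 / 2 * m%:R^-1| <= 1.
    have : s2 / 2 < m%:R by near: m; exact: nbhs_infty_gtr.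
    rewrite -[X in _ < X]mul1r -ltr_pdivrMr// => h.
    have : 0 <= s2 / 2 * m%:R^-1 by rewrite mulr_ge0 ?divr_ge0// invr_ge0 ltW.
    by rewrite ler_norml => h2; apply/andP; split; lra.
  have e0 : 0 <= eta (tau m).
    apply: mulr_ge0 => //; apply: Ex_ge0 => w.
    exact: (mulr_ge0 (sqr_ge0 _) (min0 _)).
  suff : forall j, `|Ex P (fun w => cos (c + tau m * S j w)) -
      (1 - s2 / 2 * m%:R^-1) ^+ j * cos c| <= j%:R * eta (tau m) by apply.
  elim=> [|j IH].
    rewrite expr0 mul1r mul0r (_ : (fun w =>
      _) = (fun=> cos c)) ?Ex_cst ?subrr ?normr0//.
    by apply/funext => w; rewrite /S big_ord0 mulr0 addr0.
  have := step c (tau m) j; rewrite tau2 (mulrAC s2) => h.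
  set r := 1 - _ in r1 IH h *; set x := Ex _ _ in h *; set y := Ex _ _ in IH h.
  have -> : x - r ^+ j.+1 * cos c = (x - r * y) + r * (y - r ^+ j * cos c).
    by rewrite exprS; ring.
  have -> : j.+1%:R * eta (tau m) = eta (tau m) + j%:R * eta (tau m) by
    rewrite -natr1; ring.
  apply: (le_trans (ler_normD _ _)); rewrite normrM lerD//.
  by rewrite (le_trans _ IH)// ler_piMl.
(* As k tau^2 = 1, what remains is psi^2 min (1, |tau psi|), dominated by psi^2 and tending to 0
   pointwise. *)
have eta0 : k%:R * eta (tau k) @[k --> \oo] --> (0 : R).
  have L : (\int[P]_w (psi (Z0 w) ^+ 2 * Num.min 1 `|tau k * psi (Z0
    w)|)%:E)%E @[k --> \oo] --> (\int[P]_w (cst 0%E w))%E.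
    apply: (@dominated_cvg _ _ _ P setT measurableT _ _ (fun w =>
      (psi (Z0 w) ^+ 2)%:E)) => //.
    - move=> k; apply/measurable_EFinP; apply: measurable_funM;
        first exact: measurable_funX.
      apply: measurable_minr => //; apply: measurableT_comp => //.
      exact: measurable_funM.
    - move=> w _; apply: cvg_EFin; first exact: nearW.
      rewrite /comp /=; apply/cvgrPdist_le => e e0; near=> k.
      have k0 : 0 < k%:R :> R by rewrite ltr0n; near: k; exact: nbhs_infty_gt.
      have sk : 0 < Num.sqrt k%:R :> R by rewrite sqrtr_gt0.
      rewrite sub0r normrN (ger0_norm (mulr_ge0 (sqr_ge0 _) (min0 _))).
      apply: (@le_trans _ _ (psi (Z0 w) ^+ 2 * `|tau k * psi (Z0 w)|)).
        by rewrite ler_wpM2l ?sqr_ge0// ge_min lexx orbT.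
      rewrite normrM gtr0_norm ?invr_gt0// mulrCA mulrC ler_pdivrMr//
        -ler_pdivrMl//.
      set q := (X in X <= _); have [q0|q0] := leP q 0;
        first exact: le_trans q0 (ltW sk).
      rewrite -(ger0_norm (ltW q0)) -sqrtr_sqr ler_wsqrtr//; apply: ltW.
      by near: k; exact: nbhs_infty_gtr.
    - move=> k w _; rewrite /= lee_fin (ger0_norm (mulr_ge0 (sqr_ge0 _) (min0
        _))).
      by rewrite ler_piMr ?sqr_ge0// ge_min lexx.
  have : 3 * Ex P (fun w =>
    psi (Z0 w) ^+ 2 * Num.min 1 `|tau k * psi (Z0 w)|) @[k --> \oo] --> 3 * (0
      : R).
    apply: cvgMr; move: L; rewrite integral0 => /fine_cvg.
    exact.
  rewrite mulr0; apply: cvg_trans; apply: near_eq_cvg; near=> k.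
  have k0 : 0 < k%:R :> R by rewrite ltr0n; near: k; exact: nbhs_infty_gt.
  rewrite /eta mulrCA; congr (3 * _); rewrite -ExZ//; congr Ex;
    apply/funext => w.
  by rewrite exprMn tau2; field; rewrite gt_eqF.
have s22 : 0 <= s2 / 2 by rewrite divr_ge0.
have main := @cvg_one_sub_expR (s2 / 2) (cos c) s22.
have -> : expR (- (s2 / 2)) * cos c = 0 + expR (- (s2 / 2)) * cos c by rewrite
  add0r.
have -> : (fun k => Ex P (fun w =>
  cos (c + (Num.sqrt k%:R)^-1 * \sum_(j < k) psi (Zs j w)))) =
  (fun k => (Ex P (fun w =>
    cos (c + tau k * S k w)) - (1 - s2 / 2 * (k%:R)^-1) ^+ k * cos c)
     + (1 - s2 / 2 * (k%:R)^-1) ^+ k * cos c).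
  by apply/funext => k; rewrite subrK.
apply: cvgD => //.
apply/cvgrPdist_le => e e0; near=> k.
rewrite sub0r normrN; apply: (@le_trans _ _ (k%:R * eta (tau k)));
  first by near: k; exact: bound.
have : `|0 - k%:R * eta (tau k)| <= e.
  by near: k; move: eta0 => /cvgrPdist_le/(_ _ e0).
by rewrite sub0r normrN => h; apply: le_trans h; exact: ler_norm.
Unshelve. all: by end_near. Qed.

End clt.

Lemma cvg_invS (R : realType) : (k.+1%:R)^-1 @[k --> \oo] --> (0 : R).
Proof. exact: cvg_harmonic. Qed.

(** * The objective and its stochastic gradients *)

Section caratheodory.
Context {R : realType} {d : nat} {dZ : measure_display} {Z : measurableType dZ}.
Variable g : 'cV[R]_d -> Z -> R.
Hypothesis mg : forall x, measurable_fun [set: Z] (g x).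

(** Rounding [X] down to the grid of mesh 1 / (m+1) leaves countably many values, on each of which
    measurability in the second variable suffices; continuity in the first passes to the limit. *)
Lemma caratheodory_measurable dE (E : measurableType dE) (X : E -> 'cV[R]_d)
  (Y : E -> Z) :
  (forall z, continuous (g ^~ z)) ->
  measurable_cV X -> measurable_fun [set: E] Y ->
  measurable_fun [set: E] (fun w => g (X w) (Y w)).
Proof.
move=> cg mX mY.
pose pt (m : nat) (q : 'cV[int]_d) : 'cV[R]_d := \col_j ((q j 0)%:~R / m.+1%:R).
pose fl m w : 'cV[int]_d := \col_j Num.floor (m.+1%:R * X w j 0).
apply: (measurable_fun_cvg (h := fun m w => g (pt m (fl m w)) (Y w))).
  move=> m _ C mC; rewrite setTI.
  have -> : (fun w => g (pt m (fl m w)) (Y w)) @^-1` C =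
    \bigcup_q ([set w | fl m w = q] `&` (fun w => g (pt m q) (Y w)) @^-1` C).
    apply/seteqP; split => [w /= Cw|w [q _ [/= <-]]//].
    by exists (fl m w).
  apply: countable_bigcupT_measurable => // q; apply: measurableI; last first.
    rewrite -[X in measurable X]setTI.
    exact: (measurableT_comp (mg (pt m q)) mY).
  have -> : [set w | fl m w = q] = \bigcap_(j in [set: 'I_d])
     ((fun w => m.+1%:R * X w j 0) @^-1` `[(q j 0)%:~R, (q j 0 + 1)%:~R[).
    apply/seteqP; split => [w /= <- j _|w /= h].
      by rewrite /fl mxE /= in_itv /= floor_itv.
    apply/matrixP => j o; rewrite ord1 mxE; have := h j I;
      rewrite /= in_itv /= => hj.
    exact: floor_def.
  apply: fin_bigcap_measurable => // j _; rewrite -[X in measurable X]setTI.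
  have mXj : measurable_fun [set: E] (fun w =>
    m.+1%:R * X w j 0) by exact: measurable_funM.
  exact: mXj.
move=> w _.
apply: (@cvg_comp _ _ _ (fun m => pt m (fl m w)) (g ^~ (Y w)) _ (nbhs (X w)));
  last exact: cg.
apply/cvg_ballP => e e0; near=> m; split=> // j o; rewrite ord1 /ball /= !mxE.
have m0 : 0 < m.+1%:R :> R by rewrite ltr0n.
have me : m.+1%:R^-1 < e.
  have : `|0 - m.+1%:R^-1| < e by near: m;
    move: (@cvg_invS R) => /cvgrPdist_lt/(_ _ e0).
  by rewrite sub0r normrN gtr0_norm ?invr_gt0.
apply: le_lt_trans me.
have /andP[f1 f2] := floor_itv (m.+1%:R * X w j 0).
set q := (Num.floor _)%:~R in f1 *.
have -> : X w j 0 - q / m.+1%:R = (m.+1%:R * X w j 0 - q) / m.+1%:R.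
  by field; rewrite gt_eqF.
rewrite normf_div (gtr0_norm m0) -[leRHS]mul1r ler_pM2r ?invr_gt0//.
rewrite ger0_norm ?subr_ge0// lerBlDl; apply: ltW.
by move: f2; rewrite intrD.
Unshelve. all: by end_near. Qed.

(** A partial derivative is the limit of difference quotients along the steps 1 / (k+1), each
    measurable by the preceding result. *)
Lemma grad_measurable dE (E : measurableType dE) (X : E -> 'cV[R]_d) (Y : E ->
  Z) :
  (forall z x, differentiable (g ^~ z) x) ->
  measurable_cV X -> measurable_fun [set: E] Y ->
  measurable_cV (fun w => grad (g ^~ (Y w)) (X w)).
Proof.
move=> dg mX mY i o; rewrite (ord1 o).
pose u (k : nat) : R := k.+1%:R^-1.
apply: (measurable_fun_cvg (h := fun k w => (u k)^-1 *
   (g (u k *: delta_mx i 0 + X w) (Y w) - g (X w) (Y w)))).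
  have cg z : continuous (g ^~ z) by move=> x; apply: differentiable_continuous.
  move=> k; apply: measurable_funM => //; apply: measurable_funB;
    apply: caratheodory_measurable => //.
  move=> j o'; under eq_fun do rewrite mxE.
  apply: measurable_funD => //; exact: mX.
move=> w _; rewrite mxE.
have : derivable (g ^~ (Y w)) (X w) (delta_mx i 0) by exact: diff_derivable.
move=> /cvg_ex[l lP];
  have E1 : 'D_(delta_mx i 0) (g^~ (Y w)) (X w) = l by exact: cvg_lim lP.
rewrite E1; move: lP => /cvgr_dnbhsP; apply; split=> [k|]; last exact: cvg_invS.
by rewrite /u invr_eq0.
Qed.

End caratheodory.

Section ae_domination.
Context {R : realType} {dT : measure_display} {T : measurableType dT}
  (P : probability T R).

Lemma L1_le_ae (f g : T -> R) : measurable_fun [set: T] f -> L1 P g ->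
  (forall w, 0 <= f w) -> (forall w, 0 <= g w) ->
  {ae P, forall w, f w <= g w} -> L1 P f /\ Ex P f <= Ex P g.
Proof.
move=> mf g1 f0 g0 fg.
have le : (\int[P]_w (f w)%:E <= (Ex P g)%:E)%E.
  rewrite -integral_Ex//; apply: ae_ge0_le_integral => //.
  - by move=> w _; rewrite lee_fin.
  - exact/measurable_EFinP.
  - by move=> w _; rewrite lee_fin.
  - exact: measurable_int g1.
  - by apply: filterS fg => w h _; rewrite lee_fin.
have f1 : L1 P f.
  apply/integrableP; split; first exact/measurable_EFinP.
  under eq_integral do rewrite /= ger0_norm//.
  by rewrite (le_lt_trans le)// ltry.
by split=> //; rewrite -lee_fin -integral_Ex.
Qed.

Lemma sqr_le_powR (x p : R) : 0 <= x -> 2 < p -> x ^+ 2 <= 1 + x `^ p.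
Proof.
move=> x0 p2; have [x1|x1] := leP x 1.
  by rewrite (@le_trans _ _ 1)// ?lerDl ?powR_ge0// exprn_ile1.
rewrite -powR_mulrn// (@le_trans _ _ (x `^ p))// ?lerDr// ler_powR ?ltW//.
Qed.

(** The real power does not control the size of negative values, hence the positive part. A
    Lipschitz modulus, positive almost surely, loses nothing by it. *)
Lemma L1_powR_sqr (f : T -> R) (p : R) : 2 < p -> measurable_fun [set: T] f ->
  (\int[P]_w (f w `^ p)%:E < +oo)%E ->
  L1 P (fun w => Num.max 0 (f w) ^+ 2).
Proof.
move=> p2 mf fp.
have mfp : measurable_fun [set: T] (fun w => f w `^ p).
  exact: (measurableT_comp (measurable_powR p)).
have Lp : L1 P (fun w => f w `^ p).
  apply/integrableP; split; first exact/measurable_EFinP.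
  by under eq_integral do rewrite /= ger0_norm ?powR_ge0//.
apply: (L1_le _ (L1D (L1_cst P 1) Lp)) => [|w].
  by apply: measurable_funX; apply: measurable_maxr.
rewrite ger0_norm ?sqr_ge0//; have [f0|f0] := leP (f w) 0.
  by rewrite expr0n /= addr_ge0// powR_ge0.
by apply: sqr_le_powR => //; exact: ltW.
Qed.

End ae_domination.

(** * Moments and means of the agents' stochastic gradients *)

Section agents.
Context {R : realType} {dT dZ : measure_display} {T : measurableType dT}
  {Z : measurableType dZ} (P : probability T R) {n d : nat}.
Variables (g : 'I_n -> 'cV[R]_d -> Z -> R) (zeta : 'I_n -> {RV P >-> Z})
  (xstar : 'cV[R]_d) (Lip : 'I_n -> Z -> R).
Hypothesis g_ok : cost_well_defined g zeta.
Hypothesis Hobj : objective_assumption g zeta Lip xstar.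

Lemma ae_distribution (i : 'I_n) (Q : Z -> Prop) :
  {ae distribution P (zeta i), forall z, Q z} -> {ae P, forall w, Q (zeta i w)}.
Proof.
move=> [N [mN N0 sub]]; exists (zeta i @^-1` N); split => //.
  by rewrite -[X in measurable X]setTI; exact: measurable_funP.
by move=> w /= nQ; apply: sub.
Qed.

Lemma measurable_sgrad dE (E : measurableType dE) (i : 'I_n) (X : E ->
  'cV[R]_d) (Y : E -> Z) :
  measurable_cV X -> measurable_fun [set: E] Y ->
  measurable_cV (fun w => sgrad g i (X w) (Y w)).
Proof.
move=> mX mY; have [_ _ /(_ i)[dg _ _ _]] := Hobj.
by apply: grad_measurable => // x; have [] := g_ok i x.
Qed.

Lemma measurable_sgrad_zeta (i : 'I_n) (x : 'cV[R]_d) :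
  measurable_cV (fun w => sgrad g i x (zeta i w)).
Proof.
apply: measurable_sgrad; last exact: measurable_funP.
by move=> j o; exact: measurable_cst.
Qed.

Lemma measurable_fro2 dE (E : measurableType dE) m p (X : E -> 'M[R]_(m, p)) :
  measurable_cV X -> measurable_fun [set: E] (fun w => fro2 (X w)).
Proof.
move=> mX; rewrite /fro2 /fdot.
apply: (@measurable_sum _ _ _ _ _ _ (fun i w => \sum_j X w i j * X w i j)) => i.
apply: (@measurable_sum _ _ _ _ _ _ (fun j w => X w i j * X w i j)) => j.
by apply: measurable_funM.
Qed.

Lemma measurable_cV_D dE (E : measurableType dE) m p (X Y : E -> 'M[R]_(m, p)) :
  measurable_cV X -> measurable_cV Y -> measurable_cV (fun w => X w + Y w).
Proof.
by move=> mX mY i j; under eq_fun do rewrite mxE; exact: measurable_funD.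
Qed.

Lemma measurable_cV_N dE (E : measurableType dE) m p (X : E -> 'M[R]_(m, p)) :
  measurable_cV X -> measurable_cV (fun w => - X w).
Proof.
by move=> mX i j; under eq_fun do rewrite mxE -mulN1r; exact: measurable_funM.
Qed.

Lemma measurable_cV_cst dE (E : measurableType dE) m p (A : 'M[R]_(m, p)) :
  measurable_cV (fun _ : E => A).
Proof. by move=> i j; exact: measurable_cst. Qed.

Lemma measurable_cV_Z dE (E : measurableType dE) m p c (X : E -> 'M[R]_(m, p)) :
  measurable_cV X -> measurable_cV (fun w => c *: X w).
Proof.
by move=> mX i j; under eq_fun do rewrite mxE; exact: measurable_funM.
Qed.

Lemma measurable_cV_mul dE (E : measurableType dE) m p q (A : 'M[R]_(m, p)) (X
  : E -> 'M[R]_(p, q)) :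
  measurable_cV X -> measurable_cV (fun w => A *m X w).
Proof.
move=> mX i j; under eq_fun do rewrite mxE.
apply: (@measurable_sum _ _ _ _ _ _ (fun k w => A i k * X w k j)) => k.
by apply: measurable_funM.
Qed.

Definition lip2 (i : 'I_n) : R := Ex P (fun w =>
  Num.max 0 (Lip i (zeta i w)) ^+ 2).

Lemma L1_lip (i : 'I_n) : L1 P (fun w => Num.max 0 (Lip i (zeta i w)) ^+ 2).
Proof.
have [_ _ /(_ i)[_ mL _ [p [U [p2 _ _ Lp]]]]] := Hobj.
apply: (L1_powR_sqr p2); first exact: measurableT_comp.
by move: Lp; rewrite unlock.
Qed.

Lemma lip2_ge0 i : 0 <= lip2 i.
Proof. by apply: Ex_ge0 => w; exact: sqr_ge0. Qed.

Lemma agent_lipschitz (i : 'I_n) (x y : 'cV[R]_d) :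
  L1 P (fun w => fro2 (sgrad g i x (zeta i w) - sgrad g i y (zeta i w))) /\
  Ex P (fun w => fro2 (sgrad g i x (zeta i w) - sgrad g i y (zeta i w)))
    <= lip2 i * fro2 (x - y).
Proof.
have [_ _ /(_ i)[_ _ /ae_distribution Lae _]] := Hobj.
have L1K := L1Z (fro2 (x - y)) (L1_lip i).
have [] := @L1_le_ae _ _ _ P
  (fun w => fro2 (sgrad g i x (zeta i w) - sgrad g i y (zeta i w))) _ _ L1K.
- apply: measurable_fro2; apply: measurable_cV_D; last apply: measurable_cV_N;
    exact: measurable_sgrad_zeta.
- by move=> w; exact: fro2_ge0.
- by move=> w; rewrite mulr_ge0 ?fro2_ge0 ?sqr_ge0.
- apply: filterS Lae => w [L0 /(_ x y) L].
  rewrite -!enorm_sqr mulrC -exprMn max_r ?(ltW L0)// lerXn2r ?nnegrE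
    ?sqrtr_ge0//.
  by rewrite mulr_ge0 ?sqrtr_ge0// ltW.
by move=> H1; rewrite ExZ ?(mulrC (fro2 _))//; exact: L1_lip.
Qed.

(** A moment of order p > 2 of the centred gradient controls its second moment, and the mean is
    added back at the cost of a factor 2. *)
Lemma agent_moment (i : 'I_n) (x : 'cV[R]_d) :
  L1 P (fun w => fro2 (sgrad g i x (zeta i w))).
Proof.
have [_ _ /(_ i)[_ _ _ [p [U [p2 U0 Up _]]]]] := Hobj.
set m := grad (local_cost g zeta i) x.
have mD : measurable_cV (fun w => sgrad g i x (zeta i w) - m).
  by apply: measurable_cV_D;
    [exact: measurable_sgrad_zeta|exact: measurable_cV_cst].
have me : measurable_fun [set: T] (fun w => enorm (sgrad g i x (zeta i w) - m)).
  have -> : (fun w => enorm (sgrad g i x (zeta i w) - m)) =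
      (fun w => Num.sqrt (fro2 (sgrad g i x (zeta i w) - m))).
    by apply/funext => w; rewrite /enorm fro2_dotp.
  have msq : measurable_fun [set: R] (@Num.sqrt R).
    by apply: continuous_measurable_fun; exact: sqrt_continuous.
  exact: (measurableT_comp msq (measurable_fro2 mD)).
have L : L1 P (fun w => Num.max 0 (enorm (sgrad g i x (zeta i w) - m)) ^+ 2).
  apply: (L1_powR_sqr p2 me); move: (Up x); rewrite unlock => h.
  by apply: (le_lt_trans h); exact: ltry.
have LL := L1D (L1Z 2 L) (L1_cst P (2 * fro2 m)).
apply: (L1_le _ LL) => [|w]; first exact/measurable_fro2/measurable_sgrad_zeta.
rewrite ger0_norm ?fro2_ge0// max_r ?sqrtr_ge0// enorm_sqr.
by rewrite -{1}(subrK m (sgrad g i x (zeta i w))); exact: fro2D2.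
Qed.

Lemma L1_sqr_entry m p (X : T -> 'M[R]_(m, p)) i j : measurable_cV X ->
  L1 P (fun w => fro2 (X w)) -> L1 P (fun w => X w i j ^+ 2).
Proof.
move=> mX LX; apply: (L1_le _ LX) => [|w]; first exact: measurable_funX.
by rewrite ger0_norm ?sqr_ge0// fro2_entry.
Qed.

Lemma L1_entry m p (X : T -> 'M[R]_(m, p)) i j : measurable_cV X ->
  L1 P (fun w => fro2 (X w)) -> L1 P (fun w => X w i j).
Proof. by move=> mX LX;
  have [] := Ex_norm_sqr (mX i j) (L1_sqr_entry i j mX LX). Qed.

Lemma local_costE i x : local_cost g zeta i x = Ex P (fun w =>
  g i x (zeta i w)).
Proof. by rewrite /local_cost unlock. Qed.

Lemma line_mean_value (i : 'I_n) (x v : 'cV[R]_d) z (h : R) : h != 0 ->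
  exists2 s : R, `|s| <= `|h| &
  h^-1 * (g i (h *: v + x) z - g i x z) = 'D_v (fun x' =>
    g i x' z) (s *: v + x).
Proof.
have [_ _ /(_ i)[dg _ _ _]] := Hobj => h0.
pose f (s : R) := g i (s *: v + x) z.
have df (s : R) : is_derive s 1 f ('D_v (fun x' => g i x' z) (s *: v + x)).
  have D : derivable (fun x' =>
    g i x' z) (s *: v + x) v by exact: diff_derivable.
  have E : (fun u : R => u^-1 *: (f (u *: 1 + s) - f s)) =
      (fun u : R => u^-1 *: (g i (u *: v + (s *: v + x)) z - g i (s *: v + x)
        z)).
    by apply/funext => u; rewrite /f scalerDl -addrA /GRing.scale /= mulr1.
  apply: DeriveDef.
    by rewrite /derivable /= E.
  by rewrite /derive /= E.
have cf (a b : R) : {within `[a, b], continuous f}.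
  apply: continuous_subspaceT => s; apply: differentiable_continuous.
  by apply/derivable1_diffP; apply: ex_derive; exact: df.
have f0 : f 0 = g i x z by rewrite /f scale0r add0r.
have [hn|hp|/eqP] := ltgtP h 0; last by rewrite (negPf h0).
- have [s /itvP sb E] := MVT hn (fun y _ => df y) (cf _ _).
  exists s; first by rewrite !ltr0_norm ?sb// lerN2 sb.
  move: E; rewrite f0 sub0r => E.
  by rewrite -[X in _ = X](mulKf h0) -/(f h) -opprB E; ring.
- have [s /itvP sb E] := MVT hp (fun y _ => df y) (cf _ _).
  exists s; first by rewrite !gtr0_norm ?sb.
  move: E; rewrite f0 subr0 => E.
  by rewrite -[X in _ = X](mulKf h0) -/(f h) E (mulrC _ h).
Qed.

(** Differentiation under the expectation with an explicit rate: by the mean value theorem and the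
    random Lipschitz modulus, difference quotient and partial derivative differ by at most [lip2 i]
    h^2 in mean square; Jensen's inequality carries this over to the expectations. *)
Lemma agent_mean (i : 'I_n) (x : 'cV[R]_d) j :
  is_derive x (delta_mx j 0) (local_cost g zeta i)
    (Ex P (fun w => sgrad g i x (zeta i w) j 0)).
Proof.
have Lg y : L1 P (fun w => g i y (zeta i w)) by have [] := g_ok i y.
have LD := L1_entry j 0 (measurable_sgrad_zeta i x) (agent_moment i x).
set D := Ex P _; pose e : 'cV[R]_d := delta_mx j 0.
have main : h^-1 *: (local_cost g zeta i (h *: e + x) - local_cost g zeta i x)
  @[h --> 0^'] --> D.
  have [_ _ /(_ i)[_ _ /ae_distribution Lae _]] := Hobj.
  pose K := lip2 i.
  have bnd (h : R) : h != 0 ->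
     `|h^-1 *: (local_cost g zeta i (h *: e + x) - local_cost g zeta i x) - D|
       ^+ 2
     <= K * h ^+ 2.
    move=> h0.
    pose q w := h^-1 * (g i (h *: e + x) (zeta i w) - g i x (zeta i w)) -
      sgrad g i x (zeta i w) j 0.
    have Lq0 : L1 P (fun w =>
      h^-1 * (g i (h *: e + x) (zeta i w) - g i x (zeta i w))).
      by apply: L1Z; exact: L1B.
    have Lq : L1 P q by exact: L1B.
    have -> : h^-1 *: (local_cost g zeta i (h *: e + x) - local_cost g zeta i
      x) - D = Ex P q.
      by rewrite !local_costE /q ExB// ExZ ?ExB//; exact: L1B.
    have LK := L1Z (h ^+ 2) (L1_lip i).
    have mq := L1_meas Lq.
    have [] := @L1_le_ae _ _ _ P (fun w => q w ^+ 2) _ _ LK.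
    - exact: measurable_funX.
    - by move=> w; exact: sqr_ge0.
    - by move=> w; rewrite mulr_ge0 ?sqr_ge0.
    - apply: filterS Lae => w [L0 L].
      have [s sh E] := line_mean_value i x e (zeta i w) h0.
      rewrite /q E.
      have -> : 'D_e (fun x' =>
        g i x' (zeta i w)) (s *: e + x) = sgrad g i (s *: e + x) (zeta i w) j 0.
        by rewrite /sgrad mxE.
      apply: (@le_trans _ _ (fro2 (sgrad g i (s *: e + x) (zeta i w) - sgrad g
        i x (zeta i w)))).
        by apply: le_trans (fro2_entry _ j 0); rewrite !mxE.
      rewrite -enorm_sqr max_r ?(ltW L0)//.
      apply: (@le_trans _ _ ((Lip i (zeta i w) * enorm (s *: e + x - x)) ^+ 2)).
        by rewrite lerXn2r ?nnegrE ?sqrtr_ge0// mulr_ge0 ?sqrtr_ge0// ltW.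
      rewrite addrK exprMn enorm_sqr fro2Z mulrC ler_wpM2r ?sqr_ge0//.
      have -> : fro2 e = 1 by rewrite fro2_dotp dotp_delta mxE !eqxx.
      by rewrite mulr1 -(real_normK (num_real s)) -[leRHS](real_normK
        (num_real h)) lerXn2r ?nnegrE.
    move=> Lq2 le; rewrite ExZ in le; last exact: L1_lip.
    rewrite mulrC; apply: le_trans le.
    have [_ h2] := Ex_norm_sqr mq Lq2; apply: le_trans h2.
    by rewrite lerXn2r ?nnegrE ?Ex_ge0// Ex_norm_le.
  apply/cvgrPdist_le => eps eps0.
  have K0 : 0 <= K by exact: lip2_ge0.
  near=> h.
  have h0 : h != 0 by near: h; exact: nbhs_dnbhs_neq.
  rewrite distrC -(@ler_pXn2r _ 2) ?nnegrE ?(ltW eps0)//.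
  apply: (le_trans (bnd h h0)).
  have hs : `|h| <= eps / (K + 1).
    near: h; apply: dnbhs0_le; rewrite divr_gt0// ltr_wpDl//.
  have K10 : 0 < K + 1 by rewrite ltr_wpDl.
  apply: (@le_trans _ _ (K * (eps / (K + 1)) ^+ 2)).
    rewrite ler_wpM2l// -(real_normK (num_real h)) lerXn2r ?nnegrE//
      divr_ge0// ltW//.
  rewrite expr_div_n mulrCA ler_piMr ?sqr_ge0// ler_pdivrMr ?exprn_gt0// mul1r.
  by have := sqr_ge0 K; nra.
have dv : 'D_e (local_cost g zeta i) x = D by exact: cvg_lim main.
apply: DeriveDef => //.
by apply/cvg_ex; exists D; exact: main.
Unshelve. all: by end_near. Qed.

Lemma grad_local_cost i x j :
  grad (local_cost g zeta i) x j 0 = Ex P (fun w => sgrad g i x (zeta i w) j 0).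
Proof. by rewrite mxE; have D := agent_mean i x j; rewrite derive_val. Qed.

Lemma grad_cost x : grad (cost g zeta) x = \sum_i grad (local_cost g zeta i) x.
Proof.
apply/colP => j; rewrite summxE mxE.
under eq_bigr do rewrite mxE.
have -> : cost g zeta = \sum_(i < n) local_cost g zeta i.
  by apply/funext => y; rewrite /cost fct_sumE.
rewrite derive_sum// => i.
by have D := agent_mean i x j; exact: ex_derive.
Qed.

End agents.

(** * Gradient and Hessian of the cost at the optimum *)

Section cost_at_optimum.
Context {R : realType} {dT dZ : measure_display} {T : measurableType dT}
  {Z : measurableType dZ} (P : probability T R) {n d : nat}.
Variables (g : 'I_n -> 'cV[R]_d -> Z -> R) (zeta : 'I_n -> {RV P >-> Z})
  (xstar : 'cV[R]_d) (Lip : 'I_n -> Z -> R).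
Hypothesis g_ok : cost_well_defined g zeta.
Hypothesis Hobj : objective_assumption g zeta Lip xstar.

Let f := cost g zeta.
Let H := hessian f xstar.

Lemma grad_linearization : exists2 c : R, 0 < c & forall x,
  fro2 (grad f x - H *m (x - xstar)) <= c ^+ 2 * fro2 (x - xstar) ^+ 2.
Proof.
have [_ [c c0 h] _] := Hobj; exists c => // x.
rewrite -!enorm_sqr.
have -> : c ^+ 2 * (enorm (x - xstar) ^+ 2) ^+ 2 = (c * enorm (x - xstar) ^+
  2) ^+ 2.
  by rewrite [RHS]exprMn.
by rewrite lerXn2r ?nnegrE ?sqrtr_ge0// ?mulr_ge0 ?exprn_ge0 ?sqrtr_ge0//
  ?(ltW c0)//; exact: h.
Qed.

(** At x = [xstar] the right side of the linearization bound vanishes. *)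
Lemma grad_at_optimum : grad f xstar = 0.
Proof.
have [c _ h] := grad_linearization; have := h xstar.
rewrite subrr mulmx0 subr0 fro20 expr0n mulr0; exact: fro2_eq0.
Qed.

(** By the linearization, the i-th directional derivative of component j of the gradient is
    [(H *m delta_mx i 0) j 0 = H j i], whereas by definition it is [H i j]. No continuity of second
    derivatives is involved. *)
Lemma hessian_sym : H^T = H.
Proof.
have [c c0 h] := grad_linearization.
apply/matrixP => i j; rewrite mxE [RHS]mxE.
pose e : 'cV[R]_d := delta_mx i 0.
have main : t^-1 *: (grad f (t *: e + xstar) j 0 - grad f xstar j 0) @[t -->
  0^'] --> H j i.
  apply/cvgrPdist_le => eps eps0; near=> t.
  have t0 : t != 0 by near: t; exact: nbhs_dnbhs_neq.
  have hs : `|t| <= eps / c by near: t; apply: dnbhs0_le; rewrite divr_gt0.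
  have -> : grad f xstar j 0 = 0 by rewrite grad_at_optimum mxE.
  rewrite subr0 distrC.
  have E : t^-1 *: grad f (t *: e + xstar) j 0 - H j i =
     t^-1 * (grad f (t *: e + xstar) - H *m (t *: e + xstar - xstar)) j 0.
    have -> : t *: e + xstar - xstar = t *: e by rewrite addrK.
    have He : (H *m e) j 0 = H j i.
      rewrite mxE (bigD1 i)//= [e i 0]mxE !eqxx mulr1 big1 ?addr0// =>
        l /negPf li.
      by rewrite [e l 0]mxE li mulr0.
    rewrite -scalemxAr; set M := grad f _; set N := H *m e in He *.
    have -> : (M - t *: N) j 0 = M j 0 - t * N j 0.
      by rewrite mxE; congr (_ + _); rewrite !mxE.
    by rewrite He mulrBr mulKf.
  rewrite E normrM -(@ler_pXn2r _ 2) ?nnegrE ?mulr_ge0 ?(ltW eps0)// exprMn.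
  rewrite !real_normK ?num_real//.
  have := h (t *: e + xstar); rewrite addrK fro2Z.
  have -> : fro2 e = 1 by rewrite fro2_dotp dotp_delta mxE !eqxx.
  rewrite mulr1 => h1.
  have h2 := le_trans (fro2_entry _ j 0) h1.
  have t20 : 0 < t ^+ 2 by rewrite lt_def sqr_ge0 sqrf_eq0 t0.
  set y := (X in t^-1 ^+ 2 * X ^+ 2);
    have {h1}h2 : y ^+ 2 <= c ^+ 2 * (t ^+ 2) ^+ 2 := h2.
  clearbody y; rewrite exprVn mulrC ler_pdivrMr//; apply: (le_trans h2).
  rewrite [(t ^+ 2) ^+ 2]expr2 mulrA ler_wpM2r ?sqr_ge0//.
  have : c * `|t| <= eps by rewrite mulrC -ler_pdivlMr.
  have -> : c ^+ 2 * t ^+ 2 = (c * `|t|) ^+ 2 by rewrite exprMn real_normK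
    ?num_real.
  by move=> h3; rewrite lerXn2r ?nnegrE ?mulr_ge0 ?(ltW c0) ?(ltW eps0).
apply/esym; exact: cvg_lim main.
Unshelve. all: by end_near. Qed.

(** Adding the strong convexity inequalities for the pairs (x, [xstar]) and ([xstar], x) cancels the
    values of f. *)
Lemma cost_monotone : exists2 mu : R, 0 < mu & forall x,
  mu * fro2 (x - xstar) <= dotp (grad f x) (x - xstar).
Proof.
have [[_ [mu mu0 sc]] _ _] := Hobj; exists mu => // x.
have := sc x xstar; have := sc xstar x; rewrite -/f grad_at_optimum !enorm_sqr.
have -> : dotp (0 : 'cV[R]_d) (x - xstar) = 0.
  by rewrite /dotp big1// => i _; rewrite mxE mul0r.
rewrite -[xstar - x]opprB fro2N.
have -> : dotp (grad f x) (- (x - xstar)) = - dotp (grad f x) (x - xstar).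
  by rewrite dotpC dotpNl dotpC.
lra.
Qed.

(** Monotonicity at [xstar] + s t, divided by s^2, gives the bound for the Hessian up to a
    linearization error of order s; half of mu is given up to this error. *)
Lemma hessian_pos : exists2 mu : R, 0 < mu & forall t, mu * fro2 t <= dotp t
  (H *m t).
Proof.
have [mu mu0 mon] := cost_monotone; have [c c0 lin] := grad_linearization.
exists (mu / 2); first by rewrite divr_gt0.
move=> t; rewrite leNgt; apply/negP => bad.
have t0 : 0 < fro2 t.
  rewrite lt_def fro2_ge0 andbT; apply/eqP => t0; move: bad.
  have -> : t = 0 by apply: fro2_eq0; rewrite t0.
  by rewrite mulmx0 fro20 mulr0 /dotp big1 ?ltxx// => i _; rewrite mxE mul0r.
(* Small enough that s <= 1 and s (4 c^2 |t|^2 / mu) <= mu, the two facts used in [r4]. *)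
pose s := mu / (4 * c ^+ 2 * fro2 t / mu + mu + 1).
have D0 : 0 < 4 * c ^+ 2 * fro2 t / mu + mu + 1.
  by rewrite addr_gt0// addr_gt0// divr_gt0// !mulr_gt0// exprn_gt0.
have s0 : 0 < s by rewrite divr_gt0.
have m := mon (s *: t + xstar); have l := lin (s *: t + xstar).
rewrite addrK in m l.
set r := grad f _ - _ in l;
  have gE : grad f (s *: t + xstar) = r + s *: (H *m t).
  by rewrite /r -scalemxAr subrK.
move: m; rewrite gE fro2Z dotp_fdot fdotDl !(fdotZl, fdotZr) -!dotp_fdot => m.
rewrite fro2Z in l.
have y := @fdot_young _ _ _ r t (2 / (s * mu)).
have y' : 2 * dotp r t <= 2 / (s * mu) * fro2 r + (s * mu) / 2 * fro2 t.
  rewrite dotp_fdot; have := y; rewrite invf_div; apply.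
  by rewrite divr_gt0// mulr_gt0.
have H1 : dotp (H *m t) t = dotp t (H *m t) by rewrite dotpC.
rewrite H1 in m.
have r2 : fro2 r <= c ^+ 2 * s ^+ 4 * fro2 t ^+ 2.
  by rewrite (le_trans l)// exprMn -exprM mulrA.
have r3 : 2 / (s * mu) * fro2 r <= 2 / mu * c ^+ 2 * s ^+ 3 * fro2 t ^+ 2.
  apply: (@le_trans _ _ (2 / (s * mu) * (c ^+ 2 * s ^+ 4 * fro2 t ^+ 2))).
    apply: ler_wpM2l => //; apply: divr_ge0 => //;
      exact: mulr_ge0 (ltW s0) (ltW mu0).
  by rewrite le_eqVlt; apply/orP; left; apply/eqP; field; rewrite !gt_eqF.
have sb : s * (4 * c ^+ 2 * fro2 t / mu) <= mu.
  rewrite /s mulrAC ler_pdivrMr//; apply: ler_wpM2l; first exact: ltW.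
  by rewrite -addrA lerDl addr_ge0// ltW.
have s1 : s <= 1.
  rewrite /s ler_pdivrMr// mul1r.
  have : 0 <= 4 * c ^+ 2 * fro2 t / mu.
    by rewrite divr_ge0 ?(ltW mu0)// mulr_ge0 ?fro2_ge0// mulr_ge0 ?sqr_ge0.
  lra.
clearbody s.
have r4 : 2 / mu * c ^+ 2 * s ^+ 3 * fro2 t ^+ 2 <= s * (mu / 2) * fro2 t.
  have -> : 2 / mu * c ^+ 2 * s ^+ 3 * fro2 t ^+ 2 =
      s / 2 * fro2 t * (s * (s * (4 * c ^+ 2 * fro2 t / mu))).
    by field; rewrite gt_eqF.
  have -> : s * (mu / 2) * fro2 t = s / 2 * fro2 t * mu by field.
  apply: ler_wpM2l; first by rewrite mulr_ge0 ?divr_ge0 ?(ltW s0) ?(ltW t0).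
  apply: le_trans sb; rewrite -[leRHS]mul1r; apply: ler_wpM2r => //.
  apply: mulr_ge0 (ltW s0) _; apply: divr_ge0 (ltW mu0).
  by rewrite mulr_ge0 ?(ltW t0)// mulr_ge0 ?sqr_ge0.
have fin : s * dotp r t + s * (s * dotp t (H *m t)) < mu * (s ^+ 2 * fro2 t).
  have b1 : s * (s * dotp t (H *m t)) < s * (s * (mu / 2 * fro2 t)).
    by rewrite !ltr_pM2l.
  have b2 : s * (2 * dotp r t) <= s * (s * (mu / 2) * fro2 t + s * mu / 2 *
    fro2 t).
    rewrite ler_wpM2l ?(ltW s0)//; apply: (le_trans y'); lra.
  rewrite expr2; lra.
by move: m; rewrite leNgt fin.
Qed.

Lemma hessian_unit : H \in unitmx.
Proof.
have [mu mu0 pos] := hessian_pos.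
rewrite -row_free_unit -kermx_eq0; apply/eqP/row_matrixP => i.
rewrite row0; set u := row i (kermx H).
have uH : u *m H = 0 by rewrite /u -row_mul mulmx_ker row0.
have := pos u^T; have -> : H *m u^T = 0 by rewrite -{1}hessian_sym -trmx_mul
  uH trmx0.
have -> : dotp u^T 0 = 0 by rewrite /dotp big1// => l _;
  rewrite [(0 : 'cV[R]_d) l 0]mxE mulr0.
rewrite pmulr_rle0// fro2_tr; exact: fro2_eq0.
Qed.

End cost_at_optimum.

(** * The stacked gradient oracle *)

Section stacked_oracle.
Context {R : realType} {dT dZ : measure_display} {T : measurableType dT}
  {Z : measurableType dZ} (P : probability T R) {n d : nat}.
Variables (g : 'I_n -> 'cV[R]_d -> Z -> R) (zeta : 'I_n -> {RV P >-> Z})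
  (xstar : 'cV[R]_d) (Lip : 'I_n -> Z -> R).
Hypothesis g_ok : cost_well_defined g zeta.
Hypothesis Hobj : objective_assumption g zeta Lip xstar.

Lemma measurable_joint (xi : 'I_n -> {RV P >-> Z}) :
  measurable_fun [set: T] (joint (fun i => xi i : T -> Z)).
Proof.
apply/measurable_fun_tnthP => i.
have -> : @tnth n Z ^~ i \o joint (fun i => xi i : T -> Z) = xi i.
  by apply/funext => w; rewrite /joint /= tnth_mktuple.
exact: measurable_funP.
Qed.

(** Row i of X is a deviation from [xstar], so the zero matrix stands for all agents at the
    optimum. *)
Definition agent_point (X : 'M[R]_(n, d)) (i : 'I_n) : 'cV[R]_d :=
  xstar + (row i X)^T.

Definition oracle (X : 'M[R]_(n, d)) (z : n.-tuple Z) : 'M[R]_(n, d) :=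
  \matrix_(i, j) sgrad g i (agent_point X i) (tnth z i) j 0.

Definition mean_oracle (X : 'M[R]_(n, d)) : 'M[R]_(n, d) :=
  \matrix_(i, j) grad (local_cost g zeta i) (agent_point X i) j 0.

Lemma measurable_oracle dE (E : measurableType dE) (X : E -> 'M[R]_(n, d))
    (Y : E -> n.-tuple Z) :
  measurable_cV X -> measurable_fun [set: E] Y ->
  measurable_cV (fun w => oracle (X w) (Y w)).
Proof.
move=> mX mY i j; under eq_fun do rewrite mxE.
apply: (measurable_sgrad g_ok Hobj).
  move=> a b; rewrite (_ : (fun w => _) = (fun w => xstar a b + X w i a)).
    by apply: measurable_funD.
  by apply/funext => w; rewrite mxE; congr (_ + _); rewrite !mxE.
by apply: (measurableT_comp (measurable_tnth i) mY).
Qed.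

Lemma fro2_agent_point X Y i :
  fro2 (agent_point X i - agent_point Y i) = fro2 (row i (X - Y)).
Proof.
rewrite -fro2_tr; congr fro2; rewrite /agent_point opprD addrACA subrr add0r.
by apply/rowP => j; rewrite !mxE.
Qed.

Lemma row_oracle X z i : row i (oracle X z) = (sgrad g i (agent_point X i)
  (tnth z i))^T.
Proof. by apply/rowP => j; rewrite mxE mxE [RHS]mxE. Qed.

Let Z0 := joint (fun i => zeta i : T -> Z).

Let Z0E w i : tnth (Z0 w) i = zeta i w.
Proof. by rewrite tnth_mktuple. Qed.

Lemma oracle_moment X : L1 P (fun w => fro2 (oracle X (Z0 w))).
Proof.
have -> : (fun w => fro2 (oracle X (Z0 w))) =
  (fun w => \sum_i fro2 (sgrad g i (agent_point X i) (zeta i w))).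
  apply/funext => w; rewrite fro2_row; apply: eq_bigr => i _.
  by rewrite row_oracle fro2_tr Z0E.
by apply: L1_sum => i; exact: (agent_moment g_ok Hobj).
Qed.

Definition oracle_lip : R := \sum_i lip2 zeta Lip i.

Lemma lip2_le_oracle_lip i : lip2 zeta Lip i <= oracle_lip.
Proof.
rewrite /oracle_lip (bigD1 i)//= lerDl sumr_ge0// => j _; exact: lip2_ge0.
Qed.

Lemma oracle_lip_ge0 : 0 <= oracle_lip.
Proof. by apply: sumr_ge0 => i _; exact: lip2_ge0. Qed.

Lemma oracle_lipschitz X Y :
  L1 P (fun w => fro2 (oracle X (Z0 w) - oracle Y (Z0 w))) /\
  Ex P (fun w => fro2 (oracle X (Z0 w) - oracle Y (Z0 w)))
    <= oracle_lip * fro2 (X - Y).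
Proof.
have E : (fun w => fro2 (oracle X (Z0 w) - oracle Y (Z0 w))) =
  (fun w => \sum_i fro2 (sgrad g i (agent_point X i) (zeta i w)
                         - sgrad g i (agent_point Y i) (zeta i w))).
  apply/funext => w; rewrite fro2_row; apply: eq_bigr => i _.
  by rewrite linearB /= !row_oracle -linearB fro2_tr /= Z0E.
rewrite E; have L i := agent_lipschitz g_ok Hobj i (agent_point X i)
  (agent_point Y i).
split; first by apply: L1_sum => i; have [] := L i.
rewrite Ex_sum; last by move=> i; have [] := L i.
rewrite fro2_row mulr_sumr; apply: ler_sum => i _.
have [_ /le_trans] := L i; apply; rewrite fro2_agent_point.
by rewrite ler_wpM2r ?fro2_ge0 ?lip2_le_oracle_lip.
Qed.

Lemma oracle_mean X i j : Ex P (fun w =>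
  oracle X (Z0 w) i j) = mean_oracle X i j.
Proof.
rewrite mxE (grad_local_cost g_ok Hobj).
by congr Ex; apply/funext => w; rewrite mxE Z0E.
Qed.

(** The transposed gradient of the whole cost at [xstar] + th: the drift felt by the center when all
    agents agree. *)
Definition consensus_grad (th : 'rV[R]_d) : 'rV[R]_d :=
  const_mx 1 *m mean_oracle (const_mx 1 *m th).

Lemma consensus_gradE th : consensus_grad th = (grad (cost g zeta) (xstar +
  th^T))^T.
Proof.
apply/rowP => j; rewrite mxE [RHS]mxE (grad_cost g_ok Hobj) summxE.
apply: eq_bigr => i _; rewrite mxE mul1r mxE; congr (grad _ _ _ _).
congr (_ + _^T); apply/rowP => l; rewrite mxE mxE.
by rewrite big_ord1 mxE mul1r.
Qed.

Lemma consensus_grad0 : consensus_grad 0 = 0.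
Proof. by rewrite consensus_gradE trmx0 addr0 (grad_at_optimum Hobj) trmx0. Qed.

Lemma consensus_grad_monotone : exists2 mu : R, 0 < mu &
  forall th, mu * fro2 th <= fdot (consensus_grad th) th.
Proof.
have [mu mu0 h] := cost_monotone Hobj; exists mu => // th.
have := h (xstar + th^T); rewrite addrAC subrr add0r fro2_tr consensus_gradE.
move=> /le_trans; apply; rewrite dotp_fdot le_eqVlt; apply/orP; left; apply/eqP.
rewrite /fdot big_ord1 exchange_big big_ord1; apply: eq_bigr => i _.
by rewrite ![_^T _ _]mxE.
Qed.

Lemma consensus_grad_linearization : exists2 c : R, 0 < c &
  forall th, fro2 (consensus_grad th - th *m hessian (cost g zeta) xstar)
    <= c * fro2 th ^+ 2.
Proof.
have [c c0 h] := grad_linearization Hobj; exists (c ^+ 2);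
  first exact: exprn_gt0.
move=> th; have := h (xstar + th^T); rewrite addrAC subrr add0r fro2_tr.
rewrite -fro2_tr linearB /= trmx_mul trmxK (hessian_sym Hobj).
by rewrite consensus_gradE.
Qed.

End stacked_oracle.

(** * Moment bounds and asymptotics of the iteration *)

Section coupled_recursion.
Context {R : realType}.

(* The Lyapunov function a + b + kappa al c is bounded; hence c is bounded, then
   b = O(al^2), and finally a = O(al). *)
Lemma coupled_recursion (al a b c : R ^nat) (dl m C : R) :
  0 < dl <= 1 -> 0 < m -> 0 < C ->
  (forall k, 0 < al k) -> (forall k, al k.+1 <= al k) ->
  (forall e, 0 < e -> \forall k \near \oo, al k <= e) ->
  (forall e, 0 < e -> \forall k \near \oo, al k - al k.+1 <= e * al k ^+ 2) ->
  (forall k, 0 <= a k) -> (forall k, 0 <= b k) -> (forall k, 0 <= c k) ->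
  (\forall k \near \oo, [/\
     c k.+1 <= (1 - dl) * c k + C * (1 + a k + b k + al k ^+ 2 * c k),
     b k.+1 <= (1 - dl) * b k + C * al k ^+ 2 * (1 + a k + b k + c k) &
     a k.+1 <= (1 - m * al k) * a k + C * al k * b k
               + C * al k ^+ 2 * (1 + a k + b k + c k)]) ->
  exists2 K, 0 <= K &
    forall k, [/\ c k <= K, b k <= K * al k ^+ 2 & a k <= K * al k].
Proof.
move=> /andP[dl0 dl1] m0 C0 al0 aln alc ald a0 b0 c0 rec.
(* Once al is below e, all cross terms are absorbed by the contraction dl or by the dissipation m
   al; the five bounds collect the smallness conditions for this. *)
have [e e0 [He1 He2 He3 He4 He5]] : exists2 e : R, 0 < e & [/\ e <= 1, 8 * C *
  e <= m, (3 * C + m) * e <= dl, (C + 8 * C ^+ 2 / m + m) * e <= dl & m * e <=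
    1].
  have mk (A B : R) : 0 < A -> 0 < B -> forall e, e <= B / A -> A * e <= B.
    by move=> A0 B0 e; rewrite ler_pdivlMr// mulrC.
  have D1 : 0 < 8 * C by rewrite mulr_gt0.
  have D2 : 0 < 3 * C + m by rewrite addr_gt0// mulr_gt0.
  have D3 : 0 < C + 8 * C ^+ 2 / m + m.
    by rewrite addr_gt0// addr_gt0// divr_gt0// mulr_gt0// exprn_gt0.
  exists (Num.min 1 (Num.min (m / (8 * C)) (Num.min (dl / (3 * C + m))
    (Num.min (dl / (C + 8 * C ^+ 2 / m + m)) (1 / m))))).
    by rewrite !lt_min !ltr01 !divr_gt0.
  split.
  - by rewrite ge_min lexx.
  - by apply: mk => //; rewrite !ge_min lexx !orbT.
  - by apply: mk => //; rewrite !ge_min lexx !orbT.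
  - by apply: mk => //; rewrite !ge_min lexx !orbT.
  - by apply: mk => //; rewrite !ge_min lexx !orbT.
(* Since kp C = m / 4, what a feeds into c costs only a quarter of the dissipation m al a. *)
pose kp := m / (4 * C).
have kp0 : 0 < kp by rewrite divr_gt0// mulr_gt0.
have kpC : kp * C = m / 4 by rewrite /kp; field; rewrite gt_eqF.
have alsm : \forall k \near \oo, al k <= e by exact: alc.
have [K1 K10 HV] : exists2 K, 0 <= K & forall k, a k + b k + kp * al k * c k
  <= K * 1.
  apply: (@slow_recursion _ _ (fun k =>
    m * al k / 2) (fun=> 1) (4 * C / m + 1 / 2)) => //.
  near=> k; have pe : al k <= e by near: k.
  have [r3 r2 r1] : [/\
     c k.+1 <= (1 - dl) * c k + C * (1 + a k + b k + al k ^+ 2 * c k),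
     b k.+1 <= (1 - dl) * b k + C * al k ^+ 2 * (1 + a k + b k + c k) &
     a k.+1 <= (1 - m * al k) * a k + C * al k * b k
               + C * al k ^+ 2 * (1 + a k + b k + c k)] by near: k.
  have p0 := al0 k; have p'p := aln k.
  have A0 := a0 k; have B0 := b0 k; have CC0 := c0 k; have CC1 := c0 k.+1.
  move: (al k) (a k) (b k) (c k) (al k.+1) (a k.+1) (b k.+1) (c k.+1) pe r3 r2
    r1 p0 p'p A0 B0 CC0 CC1 =>
      p A B D p' A' B' D' pe r3 r2 r1 p0 p'p A0 B0 D0 D0'.
  have me w : 0 <= w -> w * p <= w * e by move=> w0; rewrite ler_wpM2l.
  have mp : m * p <= 1 by apply: le_trans He5; rewrite me// ltW.
  split.
  - by rewrite !divr_ge0 ?mulr_ge0 ?(ltW m0) ?(ltW p0)//=; lra.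
  - by rewrite subrr mulr1 !divr_ge0 ?mulr_ge0 ?(ltW m0) ?(ltW p0).
  have s3 : kp * p * D' <= kp * p * (1 - dl) * D + m / 4 * p * (1 + A + B + p
    ^+ 2 * D).
    rewrite -kpC; have := ler_wpM2l (mulr_ge0 (ltW kp0) (ltW p0)) r3; lra.
  have s4 : kp * p' * D' <= kp * p * D' by rewrite ler_wpM2r// ler_wpM2l// ltW.
  have q1 : 8 * C * p <= m by apply: le_trans He2; rewrite me// mulr_ge0 ?ltW.
  have q2 : (3 * C + m) * p <= dl.
    by apply: le_trans He3; rewrite me// ltW// addr_gt0// mulr_gt0.
  have q3 : (C + 8 * C ^+ 2 / m + m) * p <= dl.
    apply: le_trans He4; rewrite me// ltW// addr_gt0// addr_gt0// divr_gt0//.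
    by rewrite mulr_gt0// exprn_gt0.
  have p1 : p <= 1 by exact: le_trans He1.
  have pp : p ^+ 2 <= p by rewrite expr2 ler_piMr// ltW.
  have Cpp : C * p ^+ 2 <= C * p by rewrite ler_wpM2l// ltW.
  have Cp8 : 8 * C * p ^+ 2 <= m * p.
    by rewrite expr2 mulrA ler_wpM2r// ltW.
  have t1 : 0 <= A * (m * p / 2 - 2 * C * p ^+ 2 - m / 4 * p).
    by apply: mulr_ge0 => //; lra.
  have mp0 : 0 < m * p by rewrite mulr_gt0.
  have Cp0 : 0 < C * p by rewrite mulr_gt0.
  have t2 : 0 <= B * (dl - m * p / 2 - C * p - 2 * C * p ^+ 2 - m / 4 * p).
    by apply: mulr_ge0 => //; lra.
  have t3 : 0 <= p * D * (kp * (dl - m * p / 2) - 2 * C * p - m / 4 * p ^+ 2).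
    apply: mulr_ge0; first by rewrite mulr_ge0// ltW.
    have := ler_wpM2l (ltW kp0) q3.
    have -> : kp * ((C + 8 * C ^+ 2 / m + m) * p) = (kp * C + 2 * C + kp * m)
      * p.
      by rewrite /kp; field; rewrite !gt_eqF.
    have := mulr_gt0 kp0 mp0; have : m / 4 * p ^+ 2 <= m / 4 * p.
      by rewrite ler_wpM2l// divr_ge0// ltW.
    rewrite kpC; lra.
  have t4 : (4 * C / m + 1 / 2) * (m * p / 2) * 1 = 2 * C * p + m * p / 4.
    by field; rewrite gt_eqF.
  rewrite t4; lra.
clearbody kp.
have [K2 K20 Hc] : exists2 K, 0 <= K & forall k, c k <= K * 1.
  apply: (@slow_recursion _ _ (fun=> dl) (fun=> 1) (C * (1 + K1 + K1 / kp) /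
    dl)) => //.
  near=> k; have pe : al k <= e by near: k.
  have r3 : c k.+1 <= (1 - dl) * c k + C * (1 + a k + b k + al k ^+ 2 * c k).
    by have [] : [/\
     c k.+1 <= (1 - dl) * c k + C * (1 + a k + b k + al k ^+ 2 * c k),
     b k.+1 <= (1 - dl) * b k + C * al k ^+ 2 * (1 + a k + b k + c k) &
     a k.+1 <= (1 - m * al k) * a k + C * al k * b k
               + C * al k ^+ 2 * (1 + a k + b k + c k)] by near: k.
  split; [by rewrite dl1 ltW | by rewrite subrr mulr1 divr_ge0// ltW|].
  apply: (le_trans r3);
    rewrite lerD2l mulr1 divfK ?gt_eqF// ler_wpM2l ?(ltW C0)//.
  have hV := HV k; rewrite mulr1 in hV.
  have kc : 0 <= kp * al k * c k by rewrite !mulr_ge0 ?(ltW kp0) ?(ltW (al0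
    k)) ?c0.
  have p1 : al k <= 1 by exact: le_trans He1.
  (* Here al^2 c <= al c, and kp al c is a summand of the bounded Lyapunov function. *)
  have : al k ^+ 2 * c k <= K1 / kp.
    rewrite ler_pdivlMr// mulrC; apply: (@le_trans _ _ (kp * al k * c k)).
      by rewrite mulrA ler_wpM2r// ler_wpM2l ?(ltW kp0)// expr2 ler_piMr// ltW.
    by have := a0 k; have := b0 k; lra.
  by lra.
have [K3 K30 Hb] : exists2 K, 0 <= K & forall k, b k <= K * al k ^+ 2.
  apply: (@slow_recursion _ _ (fun=> dl) (fun k =>
    al k ^+ 2) (C * (1 + K1 + K2) / dl)) => [k|].
    by rewrite exprn_gt0.
  near=> k; have pe : al k <= e by near: k.
  have r2 : b k.+1 <= (1 - dl) * b k + C * al k ^+ 2 * (1 + a k + b k + c k).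
    by have [] : [/\
     c k.+1 <= (1 - dl) * c k + C * (1 + a k + b k + al k ^+ 2 * c k),
     b k.+1 <= (1 - dl) * b k + C * al k ^+ 2 * (1 + a k + b k + c k) &
     a k.+1 <= (1 - m * al k) * a k + C * al k * b k
               + C * al k ^+ 2 * (1 + a k + b k + c k)] by near: k.
  have pd : al k - al k.+1 <= dl / 4 * al k ^+ 2.
    by near: k; apply: ald; rewrite divr_gt0.
  have p1 : al k <= 1 by exact: le_trans He1.
  have p0 := al0 k.
  split; first by rewrite dl1 ltW.
    have -> : al k ^+ 2 - al k.+1 ^+ 2 = (al k + al k.+1) * (al k - al k.+1)
      by ring.
    have le2 : al k + al k.+1 <= 2 by have := aln k; lra.
    apply: (@le_trans _ _ (2 * (dl / 4 * al k ^+ 2))); last lra.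
    apply: ler_pM => //; last by rewrite subr_ge0.
    by rewrite addr_ge0// ltW.
  apply: (le_trans r2); rewrite lerD2l.
  rewrite -[X in _ <= X * _]mulrA mulVf ?gt_eqF// mulr1 mulrAC ler_wpM2r
    ?sqr_ge0//.
  rewrite ler_wpM2l ?(ltW C0)//; have := HV k; have := Hc k.
  have kc : 0 <= kp * al k * c k by rewrite !mulr_ge0 ?(ltW kp0) ?(ltW (al0
    k)) ?c0.
  by lra.
have [K4 K40 Ha] : exists2 K, 0 <= K & forall k, a k <= K * al k.
  apply: (@slow_recursion _ _ (fun k =>
    m * al k) al (C * (K3 + 1 + K1 + K2) / m)) => //.
  near=> k; have pe : al k <= e by near: k.
  have r1 : a k.+1 <= (1 - m * al k) * a k + C * al k * b k
               + C * al k ^+ 2 * (1 + a k + b k + c k).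
    by have [] : [/\
     c k.+1 <= (1 - dl) * c k + C * (1 + a k + b k + al k ^+ 2 * c k),
     b k.+1 <= (1 - dl) * b k + C * al k ^+ 2 * (1 + a k + b k + c k) &
     a k.+1 <= (1 - m * al k) * a k + C * al k * b k
               + C * al k ^+ 2 * (1 + a k + b k + c k)] by near: k.
  have pd : al k - al k.+1 <= m / 2 * al k ^+ 2.
    by near: k; apply: ald; rewrite divr_gt0.
  have p1 : al k <= 1 by exact: le_trans He1.
  have p0 := al0 k.
  split.
  - by rewrite mulr_ge0 ?(ltW m0) ?(ltW p0)//=; apply: le_trans He5;
      rewrite ler_wpM2l// ltW.
  - by lra.
  apply: (le_trans r1); rewrite -addrA lerD2l.
  have -> : C * (K3 + 1 + K1 + K2) / m * (m * al k) * al k =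
     C * al k * (K3 * al k) + C * al k ^+ 2 * (1 + K1 + K2).
    by field; rewrite gt_eqF.
  apply: lerD.
    apply: ler_wpM2l; first exact: mulr_ge0 (ltW C0) (ltW p0).
    apply: (le_trans (Hb k)); apply: ler_wpM2l => //.
    by rewrite expr2 ler_piMr// ltW.
  apply: ler_wpM2l; first exact: mulr_ge0 (ltW C0) (sqr_ge0 _).
  have := HV k; have := Hc k.
  have kc : 0 <= kp * al k * c k by rewrite !mulr_ge0 ?(ltW kp0) ?(ltW (al0
    k)) ?c0.
  by lra.
exists (K2 + K3 + K4); first by rewrite !addr_ge0.
move=> k; split.
- by apply: (le_trans (Hc k)); rewrite mulr1 -addrA lerDl addr_ge0.
- by apply: (le_trans (Hb k));
    rewrite ler_wpM2r ?sqr_ge0// addrAC lerDr addr_ge0.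
- by apply: (le_trans (Ha k));
    rewrite ler_wpM2r ?(ltW (al0 k))// lerDr addr_ge0.
Unshelve. all: by end_near. Qed.

End coupled_recursion.

Section square_integrable.
Context {R : realType} {dT : measure_display} {T : measurableType dT}
  (P : probability T R).

Definition sqint m p (M : T -> 'M[R]_(m, p)) :=
  measurable_cV M /\ L1 P (fun w => fro2 (M w)).

Lemma sqint_le m p q r (M : T -> 'M[R]_(m, p)) (N : T -> 'M[R]_(q, r)) c :
  measurable_cV M -> sqint N -> (forall w, fro2 (M w) <= c * fro2 (N w)) ->
    sqint M.
Proof.
move=> mM [_ LN] h; split => //; apply: (L1_le _ (L1Z c LN)) => [|w].
  exact: measurable_fro2.
by rewrite ger0_norm ?fro2_ge0.
Qed.

Lemma sqint_cst m p (A : 'M[R]_(m, p)) : sqint (fun=> A).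
Proof. by split; [exact: measurable_cV_cst|exact: L1_cst]. Qed.

Lemma sqintD m p (M N : T -> 'M[R]_(m, p)) :
  sqint M -> sqint N -> sqint (fun w => M w + N w).
Proof.
move=> [mM LM] [mN LN]; have mMN := measurable_cV_D mM mN; split => //.
apply: (L1_le _ (L1D (L1Z 2 LM) (L1Z 2 LN))) => [|w];
  first exact: measurable_fro2.
by rewrite ger0_norm ?fro2_ge0// fro2D2.
Qed.

Lemma sqintN m p (M : T -> 'M[R]_(m, p)) : sqint M -> sqint (fun w => - M w).
Proof.
move=> sM; apply: (@sqint_le _ _ _ _ _ M 1) => // [|w];
  last by rewrite fro2N mul1r.
by case: sM => mM _; exact: measurable_cV_N.
Qed.

Lemma sqintB m p (M N : T -> 'M[R]_(m, p)) :
  sqint M -> sqint N -> sqint (fun w => M w - N w).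
Proof. by move=> sM sN; apply: sqintD => //; exact: sqintN. Qed.

Lemma sqintZ m p c (M : T -> 'M[R]_(m, p)) : sqint M -> sqint (fun w =>
  c *: M w).
Proof.
move=> sM; apply: (@sqint_le _ _ _ _ _ M (c ^+ 2)) => // [|w];
  last by rewrite fro2Z.
by case: sM => mM _; exact: measurable_cV_Z.
Qed.

Lemma sqint_mul q m p (A : 'M[R]_(q, m)) (M : T -> 'M[R]_(m, p)) :
  sqint M -> sqint (fun w => A *m M w).
Proof.
move=> sM; apply: (@sqint_le _ _ _ _ _ M (fro2 A)) => // [|w];
  last exact: fro2_mulmx.
by case: sM => mM _; exact: measurable_cV_mul.
Qed.

Lemma sqint_mulr m p q (A : 'M[R]_(p, q)) (M : T -> 'M[R]_(m, p)) :
  sqint M -> sqint (fun w => M w *m A).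
Proof.
move=> sM; apply: (@sqint_le _ _ _ _ _ M (fro2 A)) => // [|w].
  case: sM => mM _ i j; under eq_fun do rewrite mxE.
  apply: (@measurable_sum _ _ _ _ _ _ (fun k w => M w i k * A k j)) => k.
  by apply: measurable_funM.
by rewrite mulrC; exact: fro2_mulmx.
Qed.

Lemma sqint_sum m p k (M : nat -> T -> 'M[R]_(m, p)) :
  (forall t, (t < k)%N -> sqint (M t)) -> sqint (fun w => \sum_(t < k) M t w).
Proof.
elim: k => [|k IH] h.
  by under eq_fun do rewrite big_ord0; exact: sqint_cst.
under eq_fun do rewrite big_ord_recr; apply: sqintD; last exact: h.
by apply: IH => t tk; apply: h; exact: ltnW.
Qed.

Lemma sqint_entry m p (M : T -> 'M[R]_(m, p)) i j : sqint M -> L1 P (fun w =>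
  M w i j).
Proof. by case=> mM LM; exact: L1_entry. Qed.

Lemma L1_fdot m p (K : 'M[R]_(m, p)) (M : T -> 'M[R]_(m, p)) :
  sqint M -> L1 P (fun w => fdot K (M w)).
Proof.
move=> sM; rewrite /fdot; apply: L1_sum => i; apply: L1_sum => j.
by apply: L1Z; exact: sqint_entry.
Qed.

Lemma Ex_fdot m p (K Mb : 'M[R]_(m, p)) (M : T -> 'M[R]_(m, p)) :
  sqint M -> (forall i j, Ex P (fun w => M w i j) = Mb i j) ->
  Ex P (fun w => fdot K (M w)) = fdot K Mb.
Proof.
move=> sM mean; rewrite /fdot Ex_sum.
  apply: eq_bigr => i _; rewrite Ex_sum.
    by apply: eq_bigr => j _; rewrite ExZ ?mean//; exact: sqint_entry.
  by move=> j; apply: L1Z; exact: sqint_entry.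
by move=> i; apply: L1_sum => j; apply: L1Z; exact: sqint_entry.
Qed.

Lemma Ex_mul q m p (A : 'M[R]_(q, m)) (Mb : 'M[R]_(m, p)) (M : T -> 'M[R]_(m,
  p)) :
  sqint M -> (forall i j, Ex P (fun w => M w i j) = Mb i j) ->
  forall i j, Ex P (fun w => (A *m M w) i j) = (A *m Mb) i j.
Proof.
move=> sM mean i j; rewrite mxE; under [in LHS]eq_fun do rewrite mxE.
rewrite Ex_sum; last by move=> k; apply: L1Z; exact: sqint_entry.
by apply: eq_bigr => k _; rewrite ExZ ?mean//; exact: sqint_entry.
Qed.

Lemma Ex_fro2D m p (K Mb : 'M[R]_(m, p)) (M : T -> 'M[R]_(m, p)) :
  sqint M -> (forall i j, Ex P (fun w => M w i j) = Mb i j) ->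
  Ex P (fun w => fro2 (K + M w)) = fro2 K + 2 * fdot K Mb + Ex P (fun w =>
    fro2 (M w)).
Proof.
move=> sM mean; under eq_fun do rewrite fro2D.
have LK := L1_fdot K sM; have [_ LM] := sM.
rewrite ExD//; last by apply: L1D; [exact: L1_cst|exact: L1Z].
rewrite ExD ?Ex_cst ?ExZ ?(Ex_fdot _ sM mean)//; [exact: L1_cst|exact: L1Z].
Qed.

End square_integrable.

Section adapted_recursion.
Context {R : realType} {n : nat}.

(** Young's inequality with weight d0 / 2 keeps half of the contraction: (1 + d0/2) (1 - d0) <= 1 -
    d0/2. *)
Lemma adapted_step (M : 'M[R]_n) N : fro2 (M ^+ N.+1) <= 2^-1 ->
  exists dl C : R, [/\ 0 < dl <= 1, 0 < C & forall p (X Y : 'M[R]_(n, p)),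
    adapted M N.+1 (M *m X + Y) <= (1 - dl) * adapted M N.+1 X + C * fro2 Y].
Proof.
move=> contr; pose d0 : R := (N.+1%:R * 2)^-1.
have d00 : 0 < d0 by rewrite invr_gt0 mulr_gt0.
have d01 : d0 <= 1 / 2.
  rewrite /d0 invfM mul1r -[leRHS]mul1r ler_wpM2r ?invr_ge0// invf_le1//.
  by rewrite ler1n.
have [C C0 hC] := adapted_le M N.+1.
exists (d0 / 2), ((1 + (d0 / 2)^-1) * C); split.
- by rewrite divr_gt0//=; lra.
- by rewrite mulr_gt0// addr_gt0// invr_gt0 divr_gt0.
move=> p X Y; have e0 : 0 < d0 / 2 by rewrite divr_gt0.
apply: (le_trans (adaptedD_le _ _ _ _ e0)); apply: lerD.
  have := adapted_contraction X contr; rewrite -/d0;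
    have := adapted_ge0 M N.+1 X.
  move: (adapted _ _ X) (adapted _ _ (M *m X)) => W W1 W0 h.
  apply: (@le_trans _ _ ((1 + d0 / 2) * ((1 - d0) * W)));
    first by rewrite ler_wpM2l//; lra.
  have : 0 <= d0 ^+ 2 * W by rewrite mulr_ge0 ?sqr_ge0.
  lra.
rewrite -mulrA; apply: ler_wpM2l; last exact: hC.
by rewrite addr_ge0// invr_ge0 ltW.
Qed.

End adapted_recursion.

(** Reading the matrix as a column makes the function continuous on column vectors, hence Borel.
    This provides the measurability of the mean gradient. *)
Lemma lipschitz_measurable (R : realType) n d (f : 'M[R]_(n, d) -> R) C
    dE (E : measurableType dE) (X : E -> 'M[R]_(n, d)) :
  0 <= C -> (forall X Y, (f X - f Y) ^+ 2 <= C * fro2 (X - Y)) ->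
  measurable_cV X -> measurable_fun [set: E] (fun w => f (X w)).
Proof.
move=> C0 lip mX.
pose h (x : 'cV[R]_(n * d)) := f (vec_mx x^T).
have ch : continuous h.
  move=> x S /nbhs_ballP[e e0 eS].
  pose D := 1 + C * (n * d)%:R.
  have D1 : 1 <= D by rewrite lerDl mulr_ge0.
  have D0 : 0 < D by exact: lt_le_trans D1.
  have dl0 : 0 < e / D by exact: divr_gt0.
  apply/nbhs_ballP; exists (e / D); first exact: dl0.
  move=> y [_ xy]; apply: eS; rewrite /ball /=.
  rewrite -(@ltr_pXn2r _ 2) ?nnegrE ?(ltW e0)// real_normK ?num_real//.
  apply: (le_lt_trans (lip _ _)).
  have -> : vec_mx x^T - vec_mx y^T = vec_mx (x - y)^T by rewrite !linearB.
  have hf : fro2 (vec_mx (x - y)^T : 'M[R]_(n, d)) <= (n * d)%:R * (e / D) ^+ 2.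
    rewrite /fro2 /fdot.
    apply: (@le_trans _ _ (\sum_(i < n) \sum_(j < d) (e / D) ^+ 2)).
      apply: ler_sum => i _; apply: ler_sum => j _; rewrite mxE mxE -expr2.
      have := xy (mxvec_index i j) 0; rewrite /ball /= => xyl.
      rewrite -(real_normK (num_real ((x - y) _ _))) lerXn2r ?nnegrE ?(ltW
        dl0)//.
      by apply: ltW; apply: le_lt_trans xyl; rewrite !mxE.
    by rewrite !sumr_const !card_ord -mulrnA mulr_natl mulnC.
  apply: (le_lt_trans (ler_wpM2l C0 hf));
    rewrite expr_div_n mulrA mulrA ltr_pdivrMr ?exprn_gt0//.
  rewrite mulrC ltr_pM2l ?exprn_gt0//.
  apply: (@lt_le_trans _ _ D); first by rewrite /D ltrDr.
  by rewrite expr2 ler_peMr// ltW.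
have -> : (fun w => f (X w)) = (fun w => h (mxvec (X w))^T).
  by apply/funext => w; rewrite /h trmxK mxvecK.
apply: (measurableT_comp (continuous_measurable_cV ch)).
apply: measurable_fun_borel_cV => i; under eq_fun do rewrite mxE.
case/mxvec_indexP: i => i j; under eq_fun do rewrite mxvecE.
exact: mX.
Qed.

(** * Remainders whose sums are o(sqrt k) in mean *)

Section negligible.
Context {R : realType} {dT : measure_display} {T : measurableType dT}
  (P : probability T R).
Variable al : R ^nat.
Hypothesis al0 : forall k, 0 < al k.
Hypothesis aln : forall k, al k.+1 <= al k.
Hypothesis al_sqrt : forall e, 0 < e -> \forall k \near \oo, al k <= e /
  Num.sqrt k.+1%:R.
Hypothesis al_inv : forall e, 0 < e -> \forall k \near \oo, k%:R^-1 <= e * al k.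

(** The absolute value stands outside the sum, which leaves room for cancellation in telescoping and
    martingale terms. *)
Definition negligible (r : nat -> T -> R) := (forall t, L1 P (r t)) /\
  (Num.sqrt k%:R)^-1 * Ex P (fun w =>
    `|\sum_(t < k) r t w|) @[k --> \oo] --> (0 : R).

Lemma Ex_norm_le_sqrt (f : T -> R) v : measurable_fun [set: T] f -> L1 P (fun
  w => f w ^+ 2) ->
  0 <= v -> Ex P (fun w => f w ^+ 2) <= v -> L1 P f /\ Ex P (fun w =>
    `|f w|) <= Num.sqrt v.
Proof.
move=> mf L2 v0 fv; have [L le] := Ex_norm_sqr mf L2; split => //.
rewrite -(@ler_pXn2r _ 2) ?nnegrE ?sqrtr_ge0//; last by apply: Ex_ge0.
by rewrite sqr_sqrtr//; exact: le_trans fv.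
Qed.

Lemma negligible_le (r : nat -> T -> R) (s : R ^nat) : (forall t, L1 P (r t)) ->
  (forall k, Ex P (fun w => `|\sum_(t < k) r t w|) <= s k) ->
  (Num.sqrt k%:R)^-1 * s k @[k --> \oo] --> (0 : R) -> negligible r.
Proof.
move=> Lr rs s0; split => //; apply: squeeze_cvgr (cvg_cst 0) s0.
near=> k; apply/andP; split.
  by rewrite mulr_ge0 ?invr_ge0 ?sqrtr_ge0//; exact: Ex_ge0.
by rewrite ler_wpM2l ?invr_ge0 ?sqrtr_ge0.
Unshelve. all: by end_near. Qed.

Let L1_sum_ord k (r : nat -> T -> R) : (forall t, L1 P (r t)) ->
  L1 P (fun w => \sum_(t < k) r t w).
Proof. by move=> Lr; apply: L1_sum => t. Qed.

Lemma negligibleD (r r' : nat -> T -> R) : negligible r -> negligible r' ->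
  negligible (fun t w => r t w + r' t w).
Proof.
move=> [Lr cr] [Lr' cr']; apply: (@negligible_le _ (fun k =>
    Ex P (fun w => `|\sum_(t < k) r t w|) + Ex P (fun w =>
      `|\sum_(t < k) r' t w|))).
- by move=> t; exact: L1D.
- move=> k; have La := L1_norm (L1_sum_ord k Lr);
    have Lb := L1_norm (L1_sum_ord k Lr').
  rewrite -ExD//; apply: Ex_le => [||w]; [|exact: L1D|].
    by apply: L1_norm; apply: L1_sum => t; exact: L1D.
  by rewrite big_split; exact: ler_normD.
- by under eq_fun do rewrite mulrDr; have h := cvgD cr cr';
    rewrite addr0 in h; exact: h.
Qed.

Lemma negligibleZ c (r : nat -> T -> R) : negligible r -> negligible (fun t w
  => c * r t w).
Proof.
move=> [Lr cr]; apply: (@negligible_le _ (fun k => `|c| * Ex P (fun w =>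
  `|\sum_(t < k) r t w|))).
- by move=> t; exact: L1Z.
- move=> k; have La := L1_norm (L1_sum_ord k Lr).
  rewrite -ExZ// le_eqVlt; apply/orP; left; apply/eqP; congr Ex;
    apply/funext => w.
  by rewrite -mulr_sumr normrM.
- by under eq_fun do rewrite mulrCA; have h := cvgM (cvg_cst `|c|) cr;
    rewrite mulr0 in h; exact: h.
Qed.

Lemma negligible_rate (r : nat -> T -> R) C : 0 <= C -> (forall t, L1 P (r t))
  ->
  (\forall t \near \oo, Ex P (fun w => `|r t w|) <= C * al t) -> negligible r.
Proof.
move=> C0 Lr rate; apply: (@negligible_le _ (fun k =>
  \sum_(t < k) Ex P (fun w => `|r t w|))) => //.
- move=> k; rewrite -Ex_sum; last by move=> t; exact: L1_norm.
  apply: Ex_le => [||w].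
  + by apply: L1_norm; exact: L1_sum_ord.
  + by apply: L1_sum => t; exact: L1_norm.
  + exact: ler_norm_sum.
apply: (mean_sqrt_cvg0 (s := fun t => Ex P (fun w => `|r t w|))) => [k|e e0];
  first exact: Ex_ge0.
have e1 : 0 < e / (C + 1) by rewrite divr_gt0// ltr_wpDl.
near=> k.
have h1 : Ex P (fun w => `|r k w|) <= C * al k by near: k.
have h2 : al k <= e / (C + 1) / Num.sqrt k.+1%:R by near: k; exact: al_sqrt.
apply: (le_trans h1); apply: (@le_trans _ _ ((C + 1) * al k)).
  by rewrite ler_wpM2r ?lerDl// ltW.
by rewrite -ler_pdivlMl ?ltr_wpDl// mulrA [_ * e]mulrC.
Unshelve. all: by end_near. Qed.

Lemma sum_al_mean : k%:R^-1 * \sum_(t < k) al t @[k --> \oo] --> (0 : R).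
Proof.
have h := mean_sqrt_cvg0 (fun k => ltW (al0 k)) al_sqrt.
apply: squeeze_cvgr (cvg_cst 0) h; near=> k.
have k1 : (1 <= k)%N by near: k; exact: nbhs_infty_ge.
have k1R : (1 : R) <= k%:R by rewrite ler1n.
have S0 : 0 <= \sum_(t < k) al t by apply: sumr_ge0 => t _; exact: ltW.
rewrite mulr_ge0 ?invr_ge0//= ler_wpM2r//.
have s1 : 1 <= Num.sqrt k%:R :> R by rewrite -{1}sqrtr1 ler_wsqrtr.
rewrite lef_pV2 ?posrE ?(lt_le_trans ltr01)//.
by rewrite -[leRHS]sqr_sqrtr ?ler0n// expr2 ler_peMr// (le_trans ler01).
Unshelve. all: by end_near. Qed.

(** By Jensen's inequality the first moment of the sum is at most the root of C times the sum of the
    al t; divided by sqrt k it is the root of a multiple of the Cesàro mean of al, which tends to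
    0. *)
Lemma negligible_square (r : nat -> T -> R) C : 0 <= C -> (forall t, L1 P (r
  t)) ->
  (forall k, L1 P (fun w => (\sum_(t < k) r t w) ^+ 2) /\
     Ex P (fun w => (\sum_(t < k) r t w) ^+ 2) <= C * \sum_(t < k) al t) ->
  negligible r.
Proof.
move=> C0 Lr h; apply: (@negligible_le _ (fun k =>
  Num.sqrt (C * \sum_(t < k) al t))) => //.
- move=> k; have [L2 le] := h k.
  have := Ex_norm_le_sqrt (L1_meas (L1_sum_ord k Lr)) L2 _ le; case=> //.
  by rewrite mulr_ge0// sumr_ge0// => t _; exact: ltW.
have -> : (fun k => (Num.sqrt k%:R)^-1 * Num.sqrt (C * \sum_(t < k) al t)) =
    (fun k => Num.sqrt (C * (k%:R^-1 * \sum_(t < k) al t)) : R).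
  apply/funext => k; rewrite -sqrtrV ?ler0n// -sqrtrM ?invr_ge0//;
    congr Num.sqrt; ring.
have lim0 : Num.sqrt (C * (k%:R^-1 * \sum_(t < k) al t)) @[k --> \oo] -->
  Num.sqrt (C * (0 : R)).
  apply: continuous_cvg; first exact: sqrt_continuous.
  by apply: cvgM; [exact: cvg_cst|exact: sum_al_mean].
by rewrite mulr0 sqrtr0 in lim0.
Qed.

Lemma abel_sum (c u : R ^nat) k :
  \sum_(t < k) (c t - c t.+1) * u t =
  c 0%N * u 0%N + \sum_(t < k) c t.+1 * (u t.+1 - u t) - c k * u k.
Proof.
elim: k => [|k IH]; first by rewrite !big_ord0 addr0 subrr.
by rewrite !big_ord_recr /= IH; ring.
Qed.

(** Abel summation moves the differences onto 1 / al t = v_t^2. As E|c_t| <= C / v_t, an increment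
    v_(t+1)^2 - v_t^2 contributes at most 2 C (v_(t+1) - v_t), which telescopes. With the boundary
    terms the total is at most 3 C v_k, and this is o(sqrt k) because 1/k = o(al k). *)
Lemma negligible_telescope (c : nat -> T -> R) C : 0 <= C -> (forall t, L1 P
  (c t)) ->
  (forall t, Ex P (fun w => `|c t w|) <= C * Num.sqrt (al t)) ->
  negligible (fun t w => (c t w - c t.+1 w) / al t).
Proof.
move=> C0 Lc hc; pose v t := (Num.sqrt (al t))^-1.
have v0 t : 0 < v t by rewrite invr_gt0 sqrtr_gt0.
have vE t : (al t)^-1 = v t ^+ 2 by rewrite /v exprVn sqr_sqrtr// ltW.
have sv t : Num.sqrt (al t) * v t = 1 by rewrite mulfV// gt_eqF// sqrtr_gt0.
have vmono t : v t <= v t.+1.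
  by rewrite lef_pV2 ?posrE ?sqrtr_gt0// ler_wsqrtr.
have cv t : Ex P (fun w => `|c t w|) * v t <= C.
  by apply: (le_trans (ler_wpM2r (ltW (v0 t)) (hc t))); rewrite -mulrA sv mulr1.
have Lr t : L1 P (fun w => (c t w - c t.+1 w) / al t).
  under eq_fun do rewrite mulrC; apply/L1Z/L1B => //.
apply: (@negligible_le _ (fun k => 3 * C * v k)) => // [k|].
  have Lt t : L1 P (fun w => `|c t.+1 w| * (v t.+1 ^+ 2 - v t ^+ 2)).
    by under eq_fun do rewrite mulrC; apply: L1Z; exact: L1_norm.
  have Lt' : L1 P (fun w =>
    \sum_(t < k) `|c t.+1 w| * (v t.+1 ^+ 2 - v t ^+ 2)).
    by apply: L1_sum => t.
  have Lz t : L1 P (fun w => v t ^+ 2 * `|c t w|) by apply: L1Z; exact: L1_norm.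
  apply: (@le_trans _ _ (Ex P (fun w => v 0%N ^+ 2 * `|c 0%N w| +
     \sum_(t < k) `|c t.+1 w| * (v t.+1 ^+ 2 - v t ^+ 2) + v k ^+ 2 * `|c k
       w|))).
    apply: Ex_le => [||w].
    - exact: L1_norm (L1_sum_ord k Lr).
    - by apply: L1D => //; exact: L1D.
    under eq_bigr do rewrite vE.
    rewrite (abel_sum (fun t => c t w) (fun t => v t ^+ 2)).
    apply: (le_trans (ler_normB _ _)); apply: lerD; last first.
      by rewrite normrM mulrC [X in X * _]ger0_norm// exprn_ge0// ltW.
    apply: (le_trans (ler_normD _ _)); apply: lerD.
      by rewrite normrM mulrC [X in X * _]ger0_norm// exprn_ge0// ltW.
    apply: (le_trans (ler_norm_sum _ _ _)); apply: ler_sum => t _.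
    rewrite normrM [X in _ * X]ger0_norm// subr_ge0 lerXn2r ?nnegrE ?(ltW (v0
      _))//.
  rewrite ExD//; last exact: L1D.
  rewrite ExD// !ExZ; try exact: L1_norm.
  rewrite Ex_sum//.
  have b1 t : v t ^+ 2 * Ex P (fun w => `|c t w|) <= C * v t.
    by rewrite expr2 -mulrA mulrC [v t * _]mulrC; apply: ler_wpM2r;
      [exact: ltW|exact: cv].
  have b2 t : Ex P (fun w =>
    `|c t.+1 w| * (v t.+1 ^+ 2 - v t ^+ 2)) <= 2 * C * (v t.+1 - v t).
    under eq_fun do rewrite mulrC; rewrite ExZ; last exact: L1_norm.
    have -> : (v t.+1 ^+ 2 - v t ^+ 2) * Ex P (fun w => `|c t.+1 w|) =
      (v t.+1 - v t) * ((v t.+1 + v t) * Ex P (fun w => `|c t.+1 w|)) by ring.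
    rewrite [leRHS]mulrC; apply: ler_wpM2l; first by rewrite subr_ge0.
    have e0 : 0 <= Ex P (fun w => `|c t.+1 w|) by exact: Ex_ge0.
    apply: (@le_trans _ _ ((v t.+1 + v t.+1) * Ex P (fun w => `|c t.+1 w|))).
      by rewrite ler_wpM2r// lerD2l.
    by have := cv t.+1; lra.
  have b3 : \sum_(t < k) Ex P (fun w =>
    `|c t.+1 w| * (v t.+1 ^+ 2 - v t ^+ 2)) <= 2 * C * (v k - v 0%N).
    apply: (@le_trans _ _ (\sum_(t < k) 2 * C * (v t.+1 - v t))).
      by apply: ler_sum => t _; exact: b2.
    rewrite -mulr_sumr; apply: ler_wpM2l; first by rewrite mulr_ge0.
    by rewrite -(big_mkord xpredT (fun t => v t.+1 - v t)) telescope_sumr.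
  have vk : v 0%N <= v k by elim: (k) => // j; move=> /le_trans; apply.
  have := b1 0%N; have := b1 k; have := mulr_ge0 C0 (ltW (v0 0%N)).
  by move: b3; set S := \sum_(t < k) _; lra.
apply/cvgrPdist_le => e e0.
pose e' := (e / (3 * C + 1)) ^+ 2.
have D0 : 0 < 3 * C + 1 by rewrite ltr_wpDl// mulr_ge0.
have e'0 : 0 < e' by rewrite exprn_gt0// divr_gt0.
near=> k.
have k1 : (1 <= k)%N by near: k; exact: nbhs_infty_ge.
have k0 : (0 : R) < k%:R by rewrite ltr0n.
have h : k%:R^-1 <= e' * al k by near: k; exact: al_inv.
have w0 : 0 <= (Num.sqrt k%:R)^-1 * v k by rewrite mulr_ge0 ?invr_ge0
  ?sqrtr_ge0// ltW.
rewrite sub0r normrN ger0_norm; last by rewrite mulrCA mulr_ge0// mulr_ge0.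
have hw : (Num.sqrt k%:R)^-1 * v k <= e / (3 * C + 1).
  rewrite -(@ler_pXn2r _ 2) ?nnegrE ?(ltW (divr_gt0 e0 D0))//.
  rewrite exprMn exprVn sqr_sqrtr ?ler0n// -vE -/e' ler_pdivrMr//.
rewrite mulrCA; apply: (@le_trans _ _ (3 * C * (e / (3 * C + 1)))).
  by apply: ler_wpM2l => //; rewrite mulr_ge0.
by rewrite mulrCA ler_piMr ?(ltW e0)// ler_pdivrMr// mul1r lerDl.
Unshelve. all: by end_near. Qed.

End negligible.

(** * The iteration driven by an abstract gradient oracle *)

Section iteration.
Context {R : realType} {dT dE : measure_display} {T : measurableType dT}
  {E : measurableType dE} (P : probability T R) {n d : nat}.
Variables (Z0 : T -> E) (Zs : nat -> T -> E).
Hypothesis mZ0 : measurable_fun [set: T] Z0.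
Hypothesis mZs : forall k, measurable_fun [set: T] (Zs k).
Hypothesis iid : iid_copies P Z0 Zs.
Variables (Gam : 'M[R]_(n, d) -> E -> 'M[R]_(n, d)) (Gbar : 'M[R]_(n, d) ->
  'M[R]_(n, d)) (Lg : R).
Hypothesis mGam : forall dW (W : measurableType dW) (X : W -> 'M[R]_(n, d)) (Y
  : W -> E),
  measurable_cV X -> measurable_fun [set: W] Y -> measurable_cV (fun w =>
    Gam (X w) (Y w)).
Hypothesis Gmoment : forall X, L1 P (fun w => fro2 (Gam X (Z0 w))).
Hypothesis Lg0 : 0 <= Lg.
Hypothesis Glip : forall X Y,
  Ex P (fun w => fro2 (Gam X (Z0 w) - Gam Y (Z0 w))) <= Lg * fro2 (X - Y).
Hypothesis Gmean : forall X i j, Ex P (fun w => Gam X (Z0 w) i j) = Gbar X i j.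
Variables (A B : 'M[R]_n) (pi : 'rV[R]_n) (pr : 'cV[R]_n) (al : R ^nat) (X0 :
  'M[R]_(n, d)).

Let one : 'cV[R]_n := const_mx 1.
Let oneT : 'rV[R]_n := const_mx 1.
Let PiB : 'M[R]_n := 1%:M - pr *m oneT.

(* The pair (X_k, Q_k): the rows of X_k are the deviations x_(i,k) - x*, and Q_k
   stands for the tracker through Y_k = G_k + (I - B) Q_k, which keeps the sum
     of
   the rows of Q_k equal to 0 (see tracker_iteration). *)
Fixpoint state k (w : T) : 'M[R]_(n, d) * 'M[R]_(n, d) :=
  if k is k'.+1 then
    let G := Gam (state k' w).1 (Zs k' w) in
    (A *m (state k' w).1 - al k' *: (G + (1%:M - B) *m (state k' w).2),
     B *m (state k' w).2 - PiB *m G)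
  else (X0, 0).

Definition iterX k w := (state k w).1.
Definition iterQ k w := (state k w).2.
Definition iterG k w := Gam (iterX k w) (Zs k w).

Lemma sqint_Gam X : sqint P (fun w => Gam X (Z0 w)).
Proof. by split; [apply: mGam => //;
  exact: measurable_cV_cst|exact: Gmoment]. Qed.

(** The step from k to [k.+1] uses sample k, so state k is a function of the samples before k, and
    sample k is still fresh. *)
Lemma measurable_iter k :
  measurable_cV (iterX k : past Zs k -> _) /\ measurable_cV (iterQ k : past Zs
    k -> _).
Proof.
elim: k => [|k [mX mQ]]; first by split; exact: measurable_cV_cst.
have widen (M : T -> 'M[R]_(n, d)) : measurable_cV (M : past Zs k -> _) ->
    measurable_cV (M : past Zs k.+1 -> _).
  by move=> mM i j; exact: (measurable_past_widen (leqnSn k) (mM i j)).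
have mZk := @measurable_past_sample _ _ _ _ Zs k k.+1 (ltnSn k).
have mG : measurable_cV (iterG k : past Zs k.+1 -> _).
  by apply: mGam => //; exact: widen.
have mX' := widen _ mX; have mQ' := widen _ mQ.
split.
- apply: (measurable_cV_D (measurable_cV_mul A mX')).
  exact: (measurable_cV_N (measurable_cV_Z (al k)
    (measurable_cV_D mG (measurable_cV_mul (1%:M - B) mQ')))).
- exact: (measurable_cV_D (measurable_cV_mul B mQ')
    (measurable_cV_N (measurable_cV_mul PiB mG))).
Qed.

(* The conditional expectation given the past integrates the sample Zs k out,
   as an independent copy of Z0. *)
Lemma fresh_sample k (F : T -> 'M[R]_(n, d) -> 'M[R]_(n, d) -> R) (h : T -> R) :
  (forall dW (W : measurableType dW) (S : W -> past Zs k) (M N : W ->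
    'M[R]_(n, d)),
     measurable_fun [set: W] S -> measurable_cV M -> measurable_cV N ->
     measurable_fun [set: W] (fun w => F (S w) (M w) (N w))) ->
  (forall w M N, 0 <= F w M N) -> L1 P h ->
  (forall w, L1 P (fun w' => F w (Gam (iterX k w) (Z0 w')) (Gam 0 (Z0 w'))) /\
     Ex P (fun w' => F w (Gam (iterX k w) (Z0 w')) (Gam 0 (Z0 w'))) <= h w) ->
  L1 P (fun w => F w (iterG k w) (Gam 0 (Zs k w))) /\
  Ex P (fun w => F w (iterG k w) (Gam 0 (Zs k w))) <= Ex P h.
Proof.
move=> mF F0 Lh Fh; have [mX _] := measurable_iter k.
pose F' w z := F w (Gam (iterX k w) z) (Gam 0 z).
apply: (@freezing_le _ _ _ _ _ P Z0 Zs mZ0 mZs iid k F' h) => //.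
- apply: mF; first exact: measurable_fst.
    apply: mGam; last exact: measurable_snd.
    by move=> i j; apply: (measurableT_comp (mX i j)); exact: measurable_fst.
  by apply: mGam; [exact: measurable_cV_cst|exact: measurable_snd].
- by move=> w z; exact: F0.
by move=> w; have [L le] := Fh w; rewrite integral_Ex// lee_fin.
Qed.

Let m0 : R := Ex P (fun w => fro2 (Gam 0 (Z0 w))).

Lemma Gam_moment_le X :
  Ex P (fun w => fro2 (Gam X (Z0 w))) <= 2 * m0 + 2 * Lg * fro2 X.
Proof.
have [_ L0] := sqint_Gam 0; have [_ LX] := sqint_Gam X.
have [_ LD] := sqintB (sqint_Gam X) (sqint_Gam 0).
have := Glip X 0; rewrite subr0 => lip.
apply: (@le_trans _ _ (Ex P (fun w =>
  2 * fro2 (Gam 0 (Z0 w)) + 2 * fro2 (Gam X (Z0 w) - Gam 0 (Z0 w))))).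
  apply: Ex_le => // [|w]; first by apply: L1D; exact: L1Z.
  by rewrite -{1}(subrK (Gam 0 (Z0 w)) (Gam X (Z0 w))) addrC; exact: fro2D2.
rewrite ExD ?ExZ//; try exact: L1Z.
rewrite lerD2l -mulrA ler_wpM2l//.
Qed.

Lemma sqint_iterG k : sqint P (iterX k) -> sqint P (iterG k) /\
  Ex P (fun w => fro2 (iterG k w)) <= 2 * m0 + 2 * Lg * Ex P (fun w =>
    fro2 (iterX k w)).
Proof.
move=> [mX LX].
have L : L1 P (fun w => 2 * m0 + 2 * Lg * fro2 (iterX k w)).
  by apply: L1D; [exact: L1_cst|exact: L1Z].
have [||w|LG le] := @fresh_sample k (fun _ M _ => fro2 M) _ _ _ L.
- by move=> dW W S M N mS mM mN; exact: measurable_fro2.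
- by move=> w M _; exact: fro2_ge0.
- by have [_ LG] := sqint_Gam (iterX k w); split => //; exact: Gam_moment_le.
split; last by rewrite ExD ?Ex_cst ?ExZ// in le; [exact: L1_cst|exact: L1Z].
by split => //; apply: mGam.
Qed.

Lemma sqint_iter k : sqint P (iterX k) /\ sqint P (iterQ k).
Proof.
elim: k => [|k [sX sQ]]; first by split; exact: sqint_cst.
have [sG _] := sqint_iterG sX; split.
- apply: sqintB; first exact: sqint_mul.
  by apply/sqintZ/sqintD => //; exact: sqint_mul.
- by apply: sqintB; exact: sqint_mul.
Qed.

Lemma sqint_iterX k : sqint P (iterX k). Proof. by have [] := sqint_iter k. Qed.
Lemma sqint_iterQ k : sqint P (iterQ k). Proof. by have [] := sqint_iter k. Qed.

(** The squared norm of a mean is at most the second moment, so the mean oracle inherits the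
    mean-square Lipschitz constant. *)
Lemma Gbar_lipschitz X Y : fro2 (Gbar X - Gbar Y) <= Lg * fro2 (X - Y).
Proof.
apply: le_trans (Glip X Y).
have sD := sqintB (sqint_Gam X) (sqint_Gam Y).
have mean i j : Ex P (fun w =>
  (Gam X (Z0 w) - Gam Y (Z0 w)) i j) = (Gbar X - Gbar Y) i j.
  have -> : (fun w => (Gam X (Z0 w) - Gam Y (Z0 w)) i j) =
      (fun w => Gam X (Z0 w) i j - Gam Y (Z0 w) i j).
    by apply/funext => w; rewrite mxE; congr (_ + _); rewrite mxE.
  rewrite ExB ?Gmean; [|exact: sqint_entry (sqint_Gam X)|exact: sqint_entry
    (sqint_Gam Y)].
  by rewrite [RHS]mxE; congr (_ + _); rewrite [RHS]mxE.
have := Ex_fro2D (- (Gbar X - Gbar Y)) sD mean.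
set e := Ex P _ => he.
have e0 : 0 <= e by apply: Ex_ge0 => w; exact: fro2_ge0.
have fN m p (M N : 'M[R]_(m, p)) : fdot (- M) N = - fdot M N.
  by rewrite -scaleN1r fdotZl mulN1r.
by move: he e0; rewrite fN fro2N -/(fro2 _) => -> ; lra.
Qed.

Let PiA : 'M[R]_n := 1%:M - one *m pi.
Let Ah : 'M[R]_n := A - one *m pi.
Let Bh : 'M[R]_n := B - pr *m oneT.

Hypothesis A1 : A *m one = one.
Hypothesis piA : pi *m A = pi.
Hypothesis pi1 : pi *m one = 1%:M.
Hypothesis B1 : oneT *m B = oneT.
Hypothesis pr1 : oneT *m pr = 1%:M.
Variables NA NB : nat.
Hypothesis contrA : fro2 (Ah ^+ NA.+1) <= 2^-1.
Hypothesis contrB : fro2 (Bh ^+ NB.+1) <= 2^-1.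
Variables (gam mu : R).
Hypothesis gamE : pi *m pr = gam%:M.
Hypothesis gam0 : 0 < gam.
Let F (th : 'rV[R]_d) : 'rV[R]_d := oneT *m Gbar (one *m th).
Hypothesis mu0 : 0 < mu.
Hypothesis Fmon : forall th, mu * fro2 th <= fdot (F th) th.
Hypothesis al0 : forall k, 0 < al k.
Hypothesis aln : forall k, al k.+1 <= al k.
Hypothesis alc : forall e, 0 < e -> \forall k \near \oo, al k <= e.
Hypothesis ald : forall e, 0 < e -> \forall k \near \oo, al k - al k.+1 <= e *
  al k ^+ 2.

Let X := iterX.
Let Q := iterQ.
Let G := iterG.

Let XS k w : X k.+1 w = A *m X k w - al k *: (G k w + (1%:M - B) *m Q k w).
Proof. by []. Qed.
Let QS k w : Q k.+1 w = B *m Q k w - PiB *m G k w. Proof. by []. Qed.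

Definition spread k w : 'M[R]_(n, d) := PiA *m X k w.
Definition center k w : 'rV[R]_d := pi *m X k w - al k *: (pi *m Q k w).

(** [B] preserves column sums and [PiB] produces columns of sum 0. Consequently [B] acts on [Q]
    through its deflation [Bh], which contracts. *)
Lemma sum_iterQ k w : oneT *m Q k w = 0.
Proof.
elim: k => [|k IH]; first by rewrite mulmx0.
rewrite QS mulmxBr mulmxA B1 IH mulmxA mulmxBr mulmx1 mulmxA pr1 mul1mx subrr.
by rewrite mul0mx subrr.
Qed.

Lemma deflate_iterQ k w : B *m Q k w = Bh *m Q k w.
Proof. by rewrite mulmxBl -mulmxA sum_iterQ mulmx0 subr0. Qed.

Lemma spreadS k w :
  spread k.+1 w = Ah *m spread k w - al k *: (PiA *m (G k w + (1%:M - B) *m Q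
    k w)).
Proof.
rewrite /spread XS mulmxBr -scalemxAr [X in X - _ = _]mulmxA [X in _ = X -
  _]mulmxA.
congr (_ *m _ - _); rewrite mulmxBl mul1mx mulmxBr mulmx1 -[one *m pi *m
  A]mulmxA piA.
by rewrite mulmxBl !mulmxA A1 -[one *m pi *m one]mulmxA pi1 mulmx1 subrr subr0.
Qed.

(** The correction in [center] is exactly what the tracker subtracts from [pi *m X k], so it
    disappears. The rest is grouped as a function of the past plus a fixed row times [G k], the form
    in which the fresh sample can be integrated out. *)
Lemma centerS k w : center k.+1 w =
  (center k w + (al k - al k.+1) *: (pi *m B *m Q k w))
  + (- (al k * gam) *: oneT - (al k - al k.+1) *: (pi *m PiB)) *m G k w.
Proof.
have piPi : pi *m PiB = pi - gam *: oneT.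
  by rewrite mulmxBr mulmx1 mulmxA gamE mul_scalar_mx.
rewrite /center XS QS.
have piG : pi *m (PiB *m G k w) = pi *m G k w - gam *: (oneT *m G k w).
  by rewrite mulmxA piPi mulmxBl -scalemxAl.
have -> : pi *m (A *m X k w - al k *: (G k w + (1%:M - B) *m Q k w)) =
    pi *m X k w - al k *: (pi *m G k w + (pi *m Q k w - pi *m B *m Q k w)).
  by rewrite mulmxBr mulmxA piA -scalemxAr mulmxDr mulmxBl mul1mx mulmxBr
    mulmxA.
have -> : pi *m (B *m Q k w - PiB *m G k w) =
    pi *m B *m Q k w - (pi *m G k w - gam *: (oneT *m G k w)).
  by rewrite mulmxBr piG mulmxA.
have -> : (- (al k * gam) *: oneT - (al k - al k.+1) *: (pi *m PiB)) *m G k w =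
    - (al k * gam) *: (oneT *m G k w) - (al k - al k.+1) *: (pi *m G k w - gam
        *: (oneT *m G k w)).
  by rewrite mulmxBl -!scalemxAl -mulmxA piG.
move: (pi *m X k w) (pi *m Q k w) (pi *m B *m Q k w) (pi *m G k w) (oneT *m G
  k w).
move=> p1 p2 p3 p4 p5; apply/rowP => j; rewrite !mxE; ring.
Qed.

Lemma iterX_split k w :
  X k w = one *m center k w + (al k *: (one *m pi *m Q k w) + spread k w).
Proof.
rewrite /center /spread mulmxBl mul1mx mulmxBr -scalemxAr !mulmxA.
by rewrite addrA subrK addrC subrK.
Qed.

Let WA m (M : 'M[R]_(n, m)) := adapted Ah NA.+1 M.
Let WB m (M : 'M[R]_(n, m)) := adapted Bh NB.+1 M.

Let CX : R := 2 * fro2 one + 4 * fro2 (one *m pi) + 4.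

Lemma iterX_le k w : fro2 (X k w) <=
  CX * (fro2 (center k w) + WA (spread k w) + al k ^+ 2 * WB (Q k w)).
Proof.
have h1 := fro2D2 (one *m center k w) (al k *: (one *m pi *m Q k w) + spread k
  w).
have h2 := fro2D2 (al k *: (one *m pi *m Q k w)) (spread k w).
rewrite fro2Z in h2; rewrite -iterX_split in h1.
have h3 := fro2_mulmx one (center k w);
  have h4 := fro2_mulmx (one *m pi) (Q k w).
have h5 := adapted_fro2 Bh NB (Q k w);
  have h6 := adapted_fro2 Ah NA (spread k w).
rewrite -/(WA _) -/(WB _) in h5 h6.
have c0 := fro2_ge0 (center k w); have s0 := adapted_ge0 Ah NA.+1 (spread k w).
have q0 := adapted_ge0 Bh NB.+1 (Q k w); rewrite -/(WA _) -/(WB _) in s0 q0.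
have f1 := fro2_ge0 one; have f2 := fro2_ge0 (one *m pi).
have h7 : al k ^+ 2 * fro2 (one *m pi *m Q k w) <= al k ^+ 2 * (fro2 (one *m
  pi) * WB (Q k w)).
  rewrite ler_wpM2l ?sqr_ge0//; apply: (le_trans h4); exact: ler_wpM2l.
have p0 : 0 <= al k ^+ 2 * WB (Q k w) by rewrite mulr_ge0 ?sqr_ge0.
have x1 := mulr_ge0 f1 s0; have x2 := mulr_ge0 f2 s0; have x3 := mulr_ge0 f2 c0.
have x4 := mulr_ge0 f1 p0; have x5 := mulr_ge0 f2 p0.
rewrite /CX; lra.
Qed.

Lemma L1_adapted m (M : 'M[R]_n) N (Y : T -> 'M[R]_(n, m)) :
  sqint P Y -> L1 P (fun w => adapted M N (Y w)).
Proof.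
by move=> sY; apply: L1_sum => i; apply: L1Z; have [] := sqint_mul (M ^+ i) sY.
Qed.

Let sX k : sqint P (X k).
Proof. exact: (sqint_iterX k). Qed.
Let sQ k : sqint P (Q k).
Proof. exact: (sqint_iterQ k). Qed.
Let sG k : sqint P (G k).
Proof. by have [] := sqint_iterG (sX k). Qed.

Let sqint_spread k : sqint P (spread k).
Proof. exact: sqint_mul. Qed.

Let sqint_center k : sqint P (center k).
Proof. by apply: sqintB; [exact: sqint_mul|apply: sqintZ;
  exact: sqint_mul]. Qed.

Definition centerM k := Ex P (fun w => fro2 (center k w)).
Definition spreadM k := Ex P (fun w => WA (spread k w)).
Definition trackM k := Ex P (fun w => WB (Q k w)).

Let La k : L1 P (fun w =>
  fro2 (center k w)). Proof. by have [] := sqint_center k. Qed.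
Let Lb k : L1 P (fun w => WA (spread k w)).
Proof. exact: L1_adapted (sqint_spread k). Qed.
Let Lc k : L1 P (fun w => WB (Q k w)). Proof. exact: L1_adapted (sQ k). Qed.

Lemma centerM_ge0 k : 0 <= centerM k. Proof. by apply: Ex_ge0 => w;
  exact: fro2_ge0. Qed.
Lemma spreadM_ge0 k : 0 <= spreadM k. Proof. by apply: Ex_ge0 => w;
  exact: adapted_ge0. Qed.
Lemma trackM_ge0 k : 0 <= trackM k. Proof. by apply: Ex_ge0 => w;
  exact: adapted_ge0. Qed.

Let CX0 : 0 < CX.
Proof. by have := fro2_ge0 one; have := fro2_ge0 (one *m pi); rewrite /CX;
  lra. Qed.

Lemma iterXM_le k : Ex P (fun w => fro2 (X k w)) <=
  CX * (centerM k + spreadM k + al k ^+ 2 * trackM k).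
Proof.
have L : L1 P (fun w =>
  CX * (fro2 (center k w) + WA (spread k w) + al k ^+ 2 * WB (Q k w))).
  by apply: L1Z; apply: L1D; [exact: L1D|exact: L1Z].
have := Ex_le (sX k).2 L (iterX_le k); rewrite ExZ ?ExD ?ExZ//.
- exact: L1D.
- exact: L1Z.
by apply: L1D; [exact: L1D|exact: L1Z].
Qed.

Let m00 : 0 <= m0. Proof. by apply: Ex_ge0 => w; exact: fro2_ge0. Qed.
Let Cg : R := 2 * m0 + 2 * Lg * CX + 1.
Let Cg0 : 0 < Cg.
Proof. by rewrite ltr_wpDl// addr_ge0// ?mulr_ge0 ?(ltW CX0). Qed.

Lemma iterGM_le k : Ex P (fun w => fro2 (G k w)) <=
  Cg * (1 + centerM k + spreadM k + al k ^+ 2 * trackM k).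
Proof.
have [_ le] := sqint_iterG (sX k).
apply: (le_trans le); rewrite -/m0.
have h := iterXM_le k; rewrite -/(Ex _ _) in h.
have U0 : 0 <= centerM k + spreadM k + al k ^+ 2 * trackM k.
  by rewrite !addr_ge0 ?centerM_ge0 ?spreadM_ge0// mulr_ge0 ?sqr_ge0
    ?trackM_ge0.
have h2 := ler_wpM2l (mulr_ge0 (ler0n _ 2) Lg0) h.
apply: (le_trans (lerD (lexx _) h2)).
have -> : 1 + centerM k + spreadM k + al k ^+ 2 * trackM k =
  1 + (centerM k + spreadM k + al k ^+ 2 * trackM k) by ring.
move: (centerM k + spreadM k + _) U0 (mulr_ge0 Lg0 (ltW CX0)) => U U0 m2.
have m1 := mulr_ge0 m00 U0; rewrite /Cg; lra.
Qed.

Lemma track_recursion : exists dl C : R, [/\ 0 < dl <= 1, 0 < C & forall k,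
  trackM k.+1 <= (1 - dl) * trackM k
    + C * (1 + centerM k + spreadM k + al k ^+ 2 * trackM k)].
Proof.
have [dl [C [dl01 C0 h]]] := adapted_step contrB.
exists dl, (C * (fro2 PiB + 1) * Cg); split => //.
  by rewrite !mulr_gt0// ltr_wpDl ?fro2_ge0.
move=> k.
have L1' : L1 P (fun w =>
  (1 - dl) * WB (Q k w) + C * (fro2 PiB + 1) * fro2 (G k w)).
  by apply: L1D; apply: L1Z => //; exact: (sG k).2.
have le : trackM k.+1 <= Ex P (fun w =>
  (1 - dl) * WB (Q k w) + C * (fro2 PiB + 1) * fro2 (G k w)).
  apply: Ex_le => // w; rewrite QS deflate_iterQ; apply: (le_trans (h _ _ _)).
  rewrite lerD2l -mulrA ler_wpM2l ?(ltW C0)// fro2N.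
  apply: (le_trans (fro2_mulmx _ _)); rewrite ler_wpM2r ?fro2_ge0// lerDl//.
apply: (le_trans le); rewrite ExD ?ExZ//;
  [|exact: (sG k).2|exact: L1Z|exact/L1Z/(sG k).2].
rewrite lerD2l -[leRHS]mulrA ler_wpM2l ?iterGM_le//.
by rewrite mulr_ge0 ?(ltW C0)// addr_ge0 ?fro2_ge0.
Qed.

Lemma spread_recursion : exists dl C : R, [/\ 0 < dl <= 1, 0 < C & forall k,
  al k <= 1 ->
  spreadM k.+1 <= (1 - dl) * spreadM k
    + C * al k ^+ 2 * (1 + centerM k + spreadM k + trackM k)].
Proof.
have [dl [C [dl01 C0 h]]] := adapted_step contrA.
pose f1 := fro2 PiA + 1; pose f2 := fro2 (1%:M - B).
have f10 : 0 < f1 by rewrite ltr_wpDl ?fro2_ge0.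
have f20 : 0 <= f2 by exact: fro2_ge0.
exists dl, (C * f1 * (2 * Cg + 2 * f2)); split => //.
  by rewrite !mulr_gt0// ltr_wpDr// ?mulr_ge0// mulr_gt0.
move=> k al1; have p0 := al0 k.
pose D := C * f1 * al k ^+ 2.
have D0 : 0 <= D by rewrite mulr_ge0 ?sqr_ge0// mulr_ge0// ltW.
have LG := (sG k).2.
have LL : L1 P (fun w => 2 * fro2 (G k w) + 2 * f2 * WB (Q k w)).
  by apply: L1D; apply: L1Z.
have le : spreadM k.+1 <= Ex P (fun w => (1 - dl) * WA (spread k w)
     + D * (2 * fro2 (G k w) + 2 * f2 * WB (Q k w))).
  apply: Ex_le => // [|w]; first by apply: L1D; exact: L1Z.
  rewrite spreadS; apply: (le_trans (h _ _ _)); rewrite lerD2l fro2N fro2Z.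
  have h1 := fro2_mulmx PiA (G k w + (1%:M - B) *m Q k w).
  have h2 := fro2D2 (G k w) ((1%:M - B) *m Q k w).
  have h3 := fro2_mulmx (1%:M - B) (Q k w).
  have h4 := ler_wpM2l f20 (adapted_fro2 Bh NB (Q k w)).
  have h5 : fro2 (G k w + (1%:M - B) *m Q k w) <= 2 * fro2 (G k w) + 2 * (f2 *
    WB (Q k w)).
    by rewrite -/f2 in h3; rewrite -/(WB _) in h4; lra.
  have h6 : fro2 (PiA *m (G k w + (1%:M - B) *m Q k w)) <=
      f1 * (2 * fro2 (G k w) + 2 * f2 * WB (Q k w)).
    rewrite -[2 * f2 * _]mulrA; apply: (le_trans h1); apply: ler_pM => //;
      rewrite ?fro2_ge0//.
    by rewrite /f1 lerDl.
  move: (2 * fro2 (G k w) + _) h6 => V h6.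
  have -> : D * V = C * (al k ^+ 2 * (f1 * V)) by rewrite /D; ring.
  apply: ler_wpM2l; first exact: ltW.
  by apply: ler_wpM2l; first exact: sqr_ge0.
apply: (le_trans le).
rewrite ExD; [|exact: L1Z|exact: L1Z].
rewrite ExZ// ExZ// ExD ?ExZ//; [|exact: L1Z|exact: L1Z].
rewrite lerD2l /D [leRHS](_ : _ = C * f1 * al k ^+ 2 *
   ((2 * Cg + 2 * f2) * (1 + centerM k + spreadM k + trackM k))); last by ring.
apply: ler_wpM2l => //.
have g := iterGM_le k.
have a2 : al k ^+ 2 * trackM k <= trackM k.
  by rewrite ler_piMl ?trackM_ge0// expr_le1// ltW.
have U0 : 0 <= 1 + centerM k + spreadM k by rewrite !addr_ge0 ?centerM_ge0
  ?spreadM_ge0.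
have t0 := trackM_ge0 k.
rewrite -/(trackM k).
have g2 : Cg * (1 + centerM k + spreadM k + al k ^+ 2 * trackM k) <= Cg * (1 +
  centerM k + spreadM k + trackM k).
  by rewrite ler_wpM2l ?(ltW Cg0)// lerD2l.
have := mulr_ge0 f20 U0; lra.
Qed.

(** Coefficients for the drift estimate. With U = 1 + |center|^2 + WA + WB, the squared norms of
    Gbar, of pi B Q, and of the images of Gbar under 1^T and pi PiB are at most [Cb], [Cr], [Cs] and
    [Ct] times U. [CD] measures the error of replacing all agents by the center, [CK] al^2 bounds
    the row in front of G, and [CC] adds up the coefficients of [T1] to [T7], plus 1. *)
Let Cb : R := 2 * fro2 (Gbar 0) + 2 * Lg * CX.
Let Cr : R := fro2 (pi *m B).
Let Cs : R := fro2 oneT * Cb.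
Let Ct : R := fro2 (pi *m PiB) * Cb.
Let CD : R := fro2 oneT * (Lg * (2 + 2 * fro2 (one *m pi))).
Let CK : R := 2 * gam ^+ 2 * fro2 oneT + 2 * fro2 (pi *m PiB).
Let CC : R := 2 + 3 * Cr + gam / mu * CD + gam * (Cr + Cs) + 2 * Ct + CK * (2
  * m0 + 2 * Lg * CX) + 1.

(** With the past frozen, the left side bounds the conditional second moment of the next center.
    Strong monotonicity supplies the dissipation 2 gam mu al |center|^2; half of it pays for the gap
    between the oracle at X and at consensus. Apart from the disagreement, everything else is of
    order al^2, since the steps change by at most al^2. *)
Lemma center_drift k w (K := - (al k * gam) *: oneT - (al k - al k.+1) *: (pi
  *m PiB)) :
  al k <= 1 -> al k - al k.+1 <= al k ^+ 2 ->
  fro2 (center k w + (al k - al k.+1) *: (pi *m B *m Q k w))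
  + 2 * fdot (center k w + (al k - al k.+1) *: (pi *m B *m Q k w)) (K *m Gbar
      (X k w))
  + fro2 K * (2 * m0 + 2 * Lg * fro2 (X k w))
  <= (1 - gam * mu * al k) * fro2 (center k w) + CC * al k * WA (spread k w)
     + CC * al k ^+ 2 * (1 + fro2 (center k w) + WA (spread k w) + WB (Q k w)).
Proof.
move=> p1 bp2; have p0 := al0 k;
  have be0 : 0 <= al k - al k.+1 by rewrite subr_ge0.
have hX0 := iterX_le k w; have hsplit := iterX_split k w.
have hr0 := fro2_mulmx (pi *m B) (Q k w).
have hq := adapted_fro2 Bh NB (Q k w);
  have hsp := adapted_fro2 Ah NA (spread k w).
have wq0 := adapted_ge0 Bh NB.+1 (Q k w);
  have ws0 := adapted_ge0 Ah NA.+1 (spread k w).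
rewrite -/(WA _) -/(WB _) in hq hsp wq0 ws0.
rewrite /K; move: (al k) (al k - al k.+1) p0 p1 be0 bp2 hX0 hsplit =>
  p be p0 p1 be0 bp2 hX0 hsplit.
move: (pi *m B *m Q k w) hr0 => r hr0.
have ph0 := fro2_ge0 (center k w).
set s := oneT *m Gbar (X k w); set t := (pi *m PiB) *m Gbar (X k w).
set phi := center k w in ph0 hX0 hsplit *.
have GE : (- (p * gam) *: oneT - be *: (pi *m PiB)) *m Gbar (X k w) = - (p *
  gam) *: s - be *: t.
  by rewrite mulmxBl -!scalemxAl.
have hD : fro2 (s - F phi) <= fro2 oneT * (Lg * (2 * (p ^+ 2 * (fro2 (one *m
  pi) * WB (Q k w))) + 2 * WA (spread k w))).
  rewrite /s /F -mulmxBr; apply: (le_trans (fro2_mulmx _ _)).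
  rewrite ler_wpM2l ?fro2_ge0//.
  apply: (le_trans (Gbar_lipschitz _ _)).
  rewrite ler_wpM2l// {1}hsplit addrAC subrr add0r.
  apply: (le_trans (fro2D2 _ _)); rewrite fro2Z; apply: lerD.
    rewrite ler_wpM2l// ler_wpM2l ?sqr_ge0//;
      apply: (le_trans (fro2_mulmx _ _)).
    by rewrite ler_wpM2l ?fro2_ge0.
  by rewrite ler_wpM2l.
have hG : fro2 (Gbar (X k w)) <= 2 * fro2 (Gbar 0) + 2 * Lg * fro2 (X k w).
  have h1 := Gbar_lipschitz (X k w) 0.
  have := fro2D2 (Gbar 0) (Gbar (X k w) - Gbar 0); rewrite addrC subrK.
  rewrite subr0 in h1; lra.
have hs0 := fro2_mulmx oneT (Gbar (X k w)); rewrite -/s in hs0.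
have ht0 := fro2_mulmx (pi *m PiB) (Gbar (X k w)); rewrite -/t in ht0.
have pp0 : 0 <= p ^+ 2 by exact: sqr_ge0.
have pp1 : p ^+ 2 <= 1 by rewrite expr_le1// ltW.
have ppp : p ^+ 2 <= p by rewrite expr2 ler_piMr// ltW.
(* Up to constants U dominates all squared norms involved, so second-order terms become multiples of
   [p ^+ 2 * U]. *)
pose U : R := 1 + fro2 phi + WA (spread k w) + WB (Q k w).
rewrite -/U; have U1 : 1 <= U by rewrite /U; lra.
have Uph : fro2 phi <= U by rewrite /U; lra.
have Uq : WB (Q k w) <= U by rewrite /U; lra.
have hX : fro2 (X k w) <= CX * U.
  apply: (le_trans hX0); rewrite ler_wpM2l ?(ltW CX0)//.
  have : p ^+ 2 * WB (Q k w) <= WB (Q k w) by rewrite ler_piMl.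
  by rewrite /U; lra.
have U0 : 0 <= U by lra.
have hGU : fro2 (Gbar (X k w)) <= Cb * U.
  apply: (le_trans hG); have a1 := ler_wpM2l Lg0 hX.
  have a2 := ler_peMr (fro2_ge0 (Gbar 0)) U1; rewrite /Cb; lra.
have hs : fro2 s <= Cs * U.
  by apply: (le_trans hs0); rewrite /Cs -mulrA ler_wpM2l ?fro2_ge0.
have ht : fro2 t <= Ct * U.
  by apply: (le_trans ht0); rewrite /Ct -mulrA ler_wpM2l ?fro2_ge0.
have hr : fro2 r <= Cr * U.
  apply: (le_trans hr0); rewrite ler_wpM2l ?fro2_ge0//; exact: le_trans Uq.
have hK : fro2 (- (p * gam) *: oneT - be *: (pi *m PiB)) <= CK * p ^+ 2.
  apply: (le_trans (fro2D2 _ _)); rewrite fro2N !fro2Z sqrrN exprMn /CK.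
  have : be ^+ 2 * fro2 (pi *m PiB) <= p ^+ 2 * fro2 (pi *m PiB).
    rewrite ler_wpM2r ?fro2_ge0// expr2; apply: (@le_trans _ _ (be * 1));
      last by rewrite mulr1.
    by rewrite ler_wpM2l//; exact: le_trans pp1.
  lra.
have be2 : be ^+ 2 <= p ^+ 2.
  rewrite expr2; apply: (@le_trans _ _ (be * 1)); last by rewrite mulr1.
  by rewrite ler_wpM2l//; exact: le_trans pp1.
have mulV (x c e : R) : 0 <= x -> x <= c * U -> e <= p ^+ 2 -> e * x <= c * (p
  ^+ 2 * U).
  move=> x0 xc ec; apply: (@le_trans _ _ (p ^+ 2 * x));
    first by rewrite ler_wpM2r.
  by rewrite mulrCA ler_wpM2l.
have T1 : be * (fro2 phi + fro2 r) <= (1 + Cr) * (p ^+ 2 * U).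
  by apply: mulV; rewrite ?addr_ge0 ?fro2_ge0// mulrDl mul1r lerD.
have T2 : be ^+ 2 * fro2 r <= Cr * (p ^+ 2 * U) by apply: mulV;
  rewrite ?fro2_ge0.
have T4 : p * gam * be * (fro2 r + fro2 s) <= gam * (Cr + Cs) * (p ^+ 2 * U).
  have -> : p * gam * be * (fro2 r + fro2 s) = p * be * (gam * (fro2 r + fro2
    s)) by ring.
  apply: mulV.
  - by rewrite mulr_ge0 ?(ltW gam0)// addr_ge0 ?fro2_ge0.
  - by rewrite -mulrA ler_wpM2l ?(ltW gam0)// mulrDl lerD.
  by apply: (@le_trans _ _ (1 * be)); [rewrite ler_wpM2r|rewrite mul1r].
have T5 : be * (fro2 phi + fro2 t) <= (1 + Ct) * (p ^+ 2 * U).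
  by apply: mulV; rewrite ?addr_ge0 ?fro2_ge0// mulrDl mul1r lerD.
have T6 : be ^+ 2 * (fro2 r + fro2 t) <= (Cr + Ct) * (p ^+ 2 * U).
  by apply: mulV; rewrite ?addr_ge0 ?fro2_ge0// mulrDl lerD.
have T7 : fro2 (- (p * gam) *: oneT - be *: (pi *m PiB)) * (2 * m0 + 2 * Lg *
  fro2 (X k w))
    <= CK * (2 * m0 + 2 * Lg * CX) * (p ^+ 2 * U).
  have -> : CK * (2 * m0 + 2 * Lg * CX) * (p ^+ 2 * U) = CK * p ^+ 2 * ((2 *
    m0 + 2 * Lg * CX) * U) by ring.
  apply: ler_pM => //; first exact: fro2_ge0.
    by rewrite addr_ge0// mulr_ge0 ?fro2_ge0// mulr_ge0.
  have a1 := ler_wpM2l Lg0 hX; have a2 := ler_peMr m00 U1; lra.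
(* The only error of first order in the step: the disagreement enters the drift through the
   Lipschitz bound of Gbar. *)
have T3 : p * gam * (mu^-1 * fro2 (s - F phi)) <= gam / mu * CD * (p * WA
  (spread k w)) + gam / mu * CD * (p ^+ 2 * U).
  have gm0 : 0 <= p * (gam / mu) by exact: mulr_ge0 (ltW p0) (divr_ge0 (ltW
    gam0) (ltW mu0)).
  have h1 : fro2 (s - F phi) <= CD * (WA (spread k w) + p ^+ 2 * U).
    apply: (le_trans hD); rewrite /CD -!mulrA ler_wpM2l ?fro2_ge0// ler_wpM2l//.
    have b1 : p ^+ 2 * WB (Q k w) <= p ^+ 2 * U by rewrite ler_wpM2l.
    have b2 := ler_wpM2l (fro2_ge0 (one *m pi)) b1.
    have b3 := mulr_ge0 (fro2_ge0 (one *m pi)) ws0;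
      have b4 := mulr_ge0 pp0 U0; lra.
  have -> : p * gam * (mu^-1 * fro2 (s - F phi)) = p * (gam / mu) * fro2 (s -
    F phi) by ring.
  apply: (le_trans (ler_wpM2l gm0 h1)).
  have CD0 : 0 <= gam / mu * CD.
    rewrite mulr_ge0 ?divr_ge0 ?(ltW gam0) ?(ltW mu0)// mulr_ge0 ?fro2_ge0//
      mulr_ge0//.
    by rewrite addr_ge0// mulr_ge0 ?fro2_ge0.
  have : gam / mu * CD * (p * (p ^+ 2 * U)) <= gam / mu * CD * (p ^+ 2 * U).
    by rewrite ler_wpM2l// ler_piMl// mulr_ge0.
  lra.
have E1 : fro2 (phi + be *: r) = fro2 phi + be * (2 * fdot phi r) + be ^+ 2 *
  fro2 r.
  by rewrite fro2D fro2Z fdotZr; ring.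
have E2 : 2 * fdot (phi + be *: r) (- (p * gam) *: s - be *: t) =
   - (p * gam) * (2 * fdot phi s) + p * gam * be * (- (2 * fdot r s))
   + be * (- (2 * fdot phi t)) + be ^+ 2 * (- (2 * fdot r t)).
  rewrite fdotDl fdotZl !fdotDr !fdotNr !fdotZr; ring.
have [Y1 _] := fdot_le_half phi r; have [_ Y2] := fdot_le_half r s.
have [_ Y3] := fdot_le_half phi t; have [_ Y4] := fdot_le_half r t.
(* Young's inequality with weight mu, so that half of the dissipation survives. *)
have Y5 : - (2 * fdot phi s) <= - (2 * (mu * fro2 phi)) + (mu * fro2 phi +
  mu^-1 * fro2 (s - F phi)).
  have y := fdot_young phi (- (s - F phi)) mu0.
  have -> : fdot phi s = fdot phi (F phi) + fdot phi (s - F phi) by rewrite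
    -fdotDr addrC subrK.
  have m := Fmon phi; rewrite fdotC in m.
  rewrite fro2N fdotNr in y; lra.
have Z1 := ler_wpM2l be0 Y1.
have pg0 : 0 <= p * gam by rewrite mulr_ge0 ?(ltW p0) ?(ltW gam0).
have Z2 := ler_wpM2l (mulr_ge0 pg0 be0) Y2.
have Z3 := ler_wpM2l be0 Y3; have Z4 := ler_wpM2l (sqr_ge0 be) Y4.
have Z5 := ler_wpM2l pg0 Y5.
have pos : 0 <= p * WA (spread k w) by rewrite mulr_ge0 ?(ltW p0).
have hCC : gam / mu * CD * (p * WA (spread k w)) <= CC * (p * WA (spread k w)).
  rewrite ler_wpM2r// /CC.
  have Cb0 : 0 <= Cb by rewrite /Cb addr_ge0// mulr_ge0 ?fro2_ge0//
    ?mulr_ge0// ltW.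
  have Cr0 : 0 <= Cr by exact: fro2_ge0.
  have Cs0 : 0 <= Cs by rewrite mulr_ge0 ?fro2_ge0.
  have Ct0 : 0 <= Ct by rewrite mulr_ge0 ?fro2_ge0.
  have g1 : 0 <= gam * (Cr + Cs) by rewrite mulr_ge0 ?addr_ge0// ltW.
  have g2 : 0 <= CK * (2 * m0 + 2 * Lg * CX).
    rewrite mulr_ge0 ?addr_ge0 ?mulr_ge0 ?fro2_ge0 ?sqr_ge0// ?(ltW gam0)//.
    exact: ltW.
  move: (gam / mu * CD) (gam * _) (CK * _) g1 g2 => z1 z2 z3 g1 g2; lra.
have V0 : 0 <= p ^+ 2 * U by rewrite mulr_ge0.
rewrite GE E1 E2.
have -> : CC * p * WA (spread k w) = CC * (p * WA (spread k w)) by rewrite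
  mulrA.
have -> : CC * p ^+ 2 * U = (2 + 3 * Cr + gam / mu * CD + gam * (Cr + Cs) + 2
  * Ct + CK * (2 * m0 + 2 * Lg * CX) + 1) * (p ^+ 2 * U).
  by rewrite mulrA.
move: (p ^+ 2 * U) (p * WA (spread k w)) (fro2 _ * (2 * m0 + _)) (CK * _) (gam
  / mu * CD) (gam * (Cr + Cs)) T1 T2 T3 T4 T5 T6 T7 hCC V0 Z1 Z2 Z3 Z4 Z5 =>
    V pW t7 c7 c3 c4 T1 T2 T3 T4 T5 T6 T7 hCC V0 Z1 Z2 Z3 Z4 Z5.
lra.
Qed.

Lemma center_recursion k : al k <= 1 -> al k - al k.+1 <= al k ^+ 2 ->
  centerM k.+1 <= (1 - gam * mu * al k) * centerM k + CC * al k * spreadM k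
    + CC * al k ^+ 2 * (1 + centerM k + spreadM k + trackM k).
Proof.
move=> p1 bp2.
pose K : 'rV[R]_n := - (al k * gam) *: oneT - (al k - al k.+1) *: (pi *m PiB).
pose M w : 'rV[R]_d := center k w + (al k - al k.+1) *: (pi *m B *m Q k w).
pose h w := (1 - gam * mu * al k) * fro2 (center k w) + CC * al k * WA (spread
  k w)
     + CC * al k ^+ 2 * (1 + fro2 (center k w) + WA (spread k w) + WB (Q k w)).
have LU : L1 P (fun w => 1 + fro2 (center k w) + WA (spread k w) + WB (Q k w)).
  by apply: L1D => //; apply: L1D => //; apply: L1D => //; exact: L1_cst.
have L12 : L1 P (fun w =>
  (1 - gam * mu * al k) * fro2 (center k w) + CC * al k * WA (spread k w)).
  by apply: L1D; exact: L1Z.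
have Lh : L1 P h by apply: L1D => //; exact: L1Z.
have -> : (1 - gam * mu * al k) * centerM k + CC * al k * spreadM k
    + CC * al k ^+ 2 * (1 + centerM k + spreadM k + trackM k) = Ex P h.
  rewrite /h ExD//; last exact: L1Z.
  rewrite ExD ?ExZ//; [|exact: L1Z|exact: L1Z].
  rewrite ExD//; last by apply: L1D => //; apply: L1D => //; exact: L1_cst.
  rewrite ExD//; last by apply: L1D => //; exact: L1_cst.
  by rewrite ExD ?Ex_cst//; exact: L1_cst.
have [mX mQ] := measurable_iter k.
have mM : measurable_cV (M : past Zs k -> _).
  apply: measurable_cV_D.
    apply: (measurable_cV_D (measurable_cV_mul pi mX)).
    exact: (measurable_cV_N (measurable_cV_Z (al k) (measurable_cV_mul pi mQ))).
  exact: (measurable_cV_Z _ (measurable_cV_mul (pi *m B) mQ)).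
have [|||_ le] := @fresh_sample k
  (fun w N _ => fro2 (M w + K *m N)) h _ _ Lh.
- move=> dW W S N N' mS mN _; apply: measurable_fro2; apply: measurable_cV_D.
    by move=> i j; exact: (measurableT_comp (mM i j) mS).
  exact: measurable_cV_mul.
- by move=> w N _; exact: fro2_ge0.
- move=> w; have sKG := sqint_mul K (sqint_Gam (X k w)).
  split; first by have [] := sqintD (sqint_cst P (M w)) sKG.
  have := Ex_fro2D (M w) sKG (Ex_mul K (sqint_Gam (X k w)) (Gmean (X k w))).
  move=> ->; apply: le_trans (center_drift w p1 bp2).
  rewrite -/K -/(M w) lerD2l.
  have LG := (sqint_Gam (X k w)).2.
  apply: (@le_trans _ _ (Ex P (fun w' => fro2 K * fro2 (Gam (X k w) (Z0 w'))))).
    by apply: Ex_le => [||w']; [exact: sKG.2|exact: L1Z|exact: fro2_mulmx].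
  rewrite ExZ// ler_wpM2l ?fro2_ge0//.
  exact: Gam_moment_le.
have hE : (fun w => fro2 (M w + K *m G k w)) = (fun w => fro2 (center k.+1 w)).
  by apply/funext => w; rewrite centerS.
by move: le; rewrite hE.
Qed.

Theorem second_moment_rates : exists2 K, 0 <= K & forall k,
  [/\ trackM k <= K, spreadM k <= K * al k ^+ 2 & centerM k <= K * al k].
Proof.
have [d1 [C1 [/andP[d10 d11] C10 h1]]] := track_recursion.
have [d2 [C2 [/andP[d20 d21] C20 h2]]] := spread_recursion.
pose dl := Num.min d1 d2.
pose C := C1 + C2 + `|CC|.
have CCn := ler_norm CC; have CC0 := normr_ge0 CC.
have C0 : 0 < C by rewrite ltr_wpDr// addr_gt0.
apply: (@coupled_recursion _ al _ _ _ dl (gam * mu) C) => //.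
- by rewrite lt_min d10 d20 ge_min d11.
- exact: mulr_gt0.
- exact: centerM_ge0.
- exact: spreadM_ge0.
- exact: trackM_ge0.
near=> k.
have p1 : al k <= 1 by near: k; exact: alc.
have bp2 : al k - al k.+1 <= al k ^+ 2.
  by rewrite -[leRHS]mul1r; near: k; exact: ald.
have a0 := centerM_ge0 k; have b0 := spreadM_ge0 k; have c0 := trackM_ge0 k.
have p0 := al0 k; have pp0 := sqr_ge0 (al k).
have q0 : 0 <= al k ^+ 2 * trackM k by exact: mulr_ge0.
have U0 : 0 <= al k ^+ 2 * (1 + centerM k + spreadM k + trackM k).
  by apply: mulr_ge0 => //; lra.
have dl1 : dl <= d1 by rewrite ge_min lexx.
have dl2 : dl <= d2 by rewrite ge_min lexx orbT.
split.
- apply: (le_trans (h1 k)); apply: lerD; first by rewrite ler_wpM2r//; lra.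
  by rewrite ler_wpM2r//; rewrite /C; lra.
- apply: (le_trans (h2 k p1)); apply: lerD; first by rewrite ler_wpM2r//; lra.
  by rewrite -!mulrA ler_wpM2r//; rewrite /C; lra.
- apply: (le_trans (center_recursion p1 bp2)); apply: lerD.
    rewrite lerD2l -!mulrA ler_wpM2r//; first by rewrite mulr_ge0// ltW.
    by rewrite /C; lra.
  by rewrite -!mulrA ler_wpM2r//; rewrite /C; lra.
Unshelve. all: by end_near. Qed.

Theorem iterate_rates : exists2 K, 0 <= K & forall k,
  [/\ Ex P (fun w => fro2 (Q k w)) <= K,
     Ex P (fun w => fro2 (spread k w)) <= K * al k ^+ 2,
     Ex P (fun w => fro2 (center k w)) <= K * al k &
     Ex P (fun w => fro2 (X k w)) <= K * al k].
Proof.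
have [K K0 h] := second_moment_rates.
have al00 := ltW (al0 0%N).
have D0 : 0 <= CX * (1 + 2 * al 0%N).
  by apply: mulr_ge0 (ltW CX0) _; rewrite addr_ge0// mulr_ge0.
(* The extra factor serves the bound for X, where al k ^+ 2 is replaced by al 0 times al k. *)
exists (K * (1 + CX * (1 + 2 * al 0%N))); first by rewrite mulr_ge0// addr_ge0.
have big x : 0 <= x -> x <= x * (1 + CX * (1 + 2 * al 0%N)).
  by move=> x0; rewrite ler_peMr// lerDl.
move=> k; have [hc hb ha] := h k; have p0 := al0 k; have pp0 := sqr_ge0 (al k).
have le (f g : T -> R) c : L1 P f -> L1 P g -> (forall w, f w <= g w) -> Ex P
  g <= c -> Ex P f <= c.
  by move=> Lf Lg' fg; apply: le_trans; exact: Ex_le.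
split.
- apply: (le _ _ _ (sQ k).2 (Lc k)) => [w|]; first exact: adapted_fro2.
  exact: le_trans (big _ _).
- apply: (le _ _ _ (sqint_spread k).2 (Lb k)) => [w|];
    first exact: adapted_fro2.
  by apply: (le_trans hb); rewrite ler_wpM2r ?big.
- by apply: (le_trans ha); rewrite ler_wpM2r ?big// ltW.
have p1 : al k <= al 0%N by elim: (k) => // j; exact: le_trans.
have ap : al k ^+ 2 <= al 0%N * al k by rewrite expr2 ler_wpM2r// ltW.
apply: (le_trans (iterXM_le k)).
have -> : K * (1 + CX * (1 + 2 * al 0%N)) * al k =
  K * al k + CX * (K * al k + K * (al 0%N * al k) + K * (al 0%N * al k)) by
    ring.
apply: ler_wpDl; first by rewrite mulr_ge0// ltW.
apply: ler_wpM2l; first exact: ltW.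
apply: lerD; first apply: lerD => //.
  by apply: (le_trans hb); rewrite ler_wpM2l.
apply: (@le_trans _ _ (al k ^+ 2 * K)); first by rewrite ler_wpM2l.
by rewrite mulrC ler_wpM2l.
Qed.

(** * Linearization of the averaged iterates *)

Variables (Hs : 'M[R]_d) (cl : R).
Hypothesis Hunit : Hs \in unitmx.
Hypothesis cl0 : 0 <= cl.
Hypothesis Flin : forall th, fro2 (F th - th *m Hs) <= cl * fro2 th ^+ 2.
Hypothesis al_sqrt : forall e, 0 < e -> \forall k \near \oo, al k <= e /
  Num.sqrt k.+1%:R.
Hypothesis al_inv : forall e, 0 < e -> \forall k \near \oo, k%:R^-1 <= e * al k.

Definition rowdot m (x : 'rV[R]_m) (s : 'cV[R]_m) : R := (x *m s) 0 0.

Lemma rowdot_sqr m (x : 'rV[R]_m) s : rowdot x s ^+ 2 <= fro2 s * fro2 x.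
Proof. by rewrite mulrC; apply: le_trans (fro2_mulmx _ _);
  exact: fro2_entry. Qed.

Lemma rowdotD m (x y : 'rV[R]_m) s : rowdot (x + y) s = rowdot x s + rowdot y s.
Proof. by rewrite /rowdot mulmxDl mxE. Qed.

Lemma rowdotN m (x : 'rV[R]_m) s : rowdot (- x) s = - rowdot x s.
Proof. by rewrite /rowdot mulNmx mxE. Qed.

Lemma rowdotZ m c (x : 'rV[R]_m) s : rowdot (c *: x) s = c * rowdot x s.
Proof. by rewrite /rowdot -scalemxAl mxE. Qed.

Lemma rowdot_moment m (x : T -> 'rV[R]_m) s v : sqint P x -> 0 <= v ->
  Ex P (fun w => fro2 (x w)) <= v ->
  [/\ L1 P (fun w => rowdot (x w) s), L1 P (fun w => rowdot (x w) s ^+ 2) &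
     Ex P (fun w => `|rowdot (x w) s|) <= Num.sqrt (fro2 s * v)].
Proof.
move=> sx v0 xv; have [mxs _] := sqint_mulr s sx.
have L2 : L1 P (fun w => rowdot (x w) s ^+ 2).
  apply: (L1_le _ (L1Z (fro2 s) sx.2)) => [|w];
    first by apply: measurable_funX; exact: mxs.
  by rewrite ger0_norm ?sqr_ge0//; exact: rowdot_sqr.
have [] := @Ex_norm_le_sqrt _ _ _ P (fun w =>
  rowdot (x w) s) (fro2 s * v) (mxs 0 0) L2; last by split.
  by rewrite mulr_ge0 ?fro2_ge0.
apply: (@le_trans _ _ (Ex P (fun w => fro2 s * fro2 (x w)))).
  by apply: Ex_le => // [|w]; [apply: L1Z; exact: sx.2|exact: rowdot_sqr].
by rewrite ExZ ?ler_wpM2l ?fro2_ge0//; exact: sx.2.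
Qed.

Lemma L1_rowdot m (x : T -> 'rV[R]_m) s : sqint P x ->
  L1 P (fun w => rowdot (x w) s) /\ L1 P (fun w => rowdot (x w) s ^+ 2).
Proof.
move=> sx; have x0 : 0 <= Ex P (fun w => fro2 (x w)) by apply: Ex_ge0 => w;
  exact: fro2_ge0.
by have [] := rowdot_moment s sx x0 (lexx _).
Qed.

Lemma measurable_Gbar dW (W : measurableType dW) (Y : W -> 'M[R]_(n, d)) :
  measurable_cV Y -> measurable_cV (fun w => Gbar (Y w)).
Proof.
move=> mY i j; apply: (@lipschitz_measurable _ _ _ (fun M =>
  Gbar M i j) Lg) => // M M'.
apply: le_trans (Gbar_lipschitz M M').
have -> : Gbar M i j - Gbar M' i j = (Gbar M - Gbar M') i j by rewrite !mxE.
exact: fro2_entry.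
Qed.

Lemma sqint_Gbar (Y : T -> 'M[R]_(n, d)) : sqint P Y -> sqint P (fun w =>
  Gbar (Y w)).
Proof.
move=> [mY LY]; have mG := measurable_Gbar mY; split => //.
apply: (L1_le _ (L1D (L1_cst P (2 * fro2 (Gbar 0))) (L1Z (2 * Lg) LY))) => [|w].
  exact: measurable_fro2.
rewrite ger0_norm ?fro2_ge0//.
have := fro2D2 (Gbar 0) (Gbar (Y w) - Gbar 0); rewrite addrC subrK.
have := Gbar_lipschitz (Y w) 0; rewrite subr0; lra.
Qed.

Let sG0 : sqint P (fun w => Gam 0 (Z0 w)). Proof. exact: sqint_Gam. Qed.

Lemma sqint_sample k : sqint P (fun w => Gam 0 (Zs k w)).
Proof.
have [||w|L _] := @fresh_sample k
  (fun _ _ M => fro2 M) _ _ _ (L1_cst P (Ex P (fun w => fro2 (Gam 0 (Z0 w))))).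
- by move=> dW W S M N mS mM mN; exact: measurable_fro2.
- by move=> w M N; exact: fro2_ge0.
- by split => //; exact: sG0.2.
by split => //; apply: mGam => //; exact: measurable_cV_cst.
Qed.

(** One family for two martingales: weights (1, -1) give the difference between the noise at X_k and
    at the optimum, with small variance, and weights (0, 1) the noise at the optimum. *)
Definition noise a b k w : 'rV[R]_d :=
  oneT *m (a *: (G k w - Gbar (X k w)) + b *: (Gam 0 (Zs k w) - Gbar 0)).

Lemma measurable_noise a b k t : (k < t)%N ->
  measurable_cV (noise a b k : past Zs t -> _).
Proof.
move=> kt; have [mX _] := measurable_iter k.
have mX' : measurable_cV (X k : past Zs t -> _).
  by move=> i j; exact: (measurable_past_widen (ltnW kt) (mX i j)).
have mZk := @measurable_past_sample _ _ _ _ Zs k t kt.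
apply: measurable_cV_mul; apply: measurable_cV_D; apply: measurable_cV_Z.
  apply: measurable_cV_D; first exact: mGam.
  by apply: measurable_cV_N; exact: measurable_Gbar.
apply: measurable_cV_D; last exact: measurable_cV_cst.
by apply: mGam => //; exact: measurable_cV_cst.
Qed.

Lemma measurable_noise_sum a b k :
  measurable_cV ((fun w => \sum_(t < k) noise a b t w) : past Zs k -> _).
Proof.
move=> i j.
have -> : (fun w : past Zs k => (\sum_(t < k) noise a b t w) i j) =
    (fun w : past Zs k => \sum_(t < k) noise a b t w i j).
  by apply/funext => w; rewrite summxE.
apply: (@measurable_sum _ (past Zs k) _ _ _ _ (fun (t : 'I_k) w =>
  noise a b t w i j)) => t.
exact: (measurable_noise a b (ltn_ord t)).
Qed.

Lemma sqint_noise a b k : sqint P (noise a b k).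
Proof.
apply: sqint_mul; apply: sqintD; apply: sqintZ; apply: sqintB => //.
- exact: sqint_Gbar.
- exact: sqint_sample.
- exact: sqint_cst.
Qed.

(* Martingale increments are orthogonal, so their second moments add up. *)
Lemma noise_sum a b c0 c1 : 0 <= c1 ->
  (forall Y, Ex P (fun w => fro2 (oneT *m (a *: (Gam Y (Z0 w) - Gbar Y)
      + b *: (Gam 0 (Z0 w) - Gbar 0)))) <= c0 + c1 * fro2 Y) ->
  forall k, Ex P (fun w => fro2 (\sum_(t < k) noise a b t w)) <=
    \sum_(t < k) (c0 + c1 * Ex P (fun w => fro2 (X t w))).
Proof.
move=> c10 hv; elim=> [|k IH].
  by under eq_fun do rewrite big_ord0 fro20; rewrite Ex_cst big_ord0.
pose S w := \sum_(t < k) noise a b t w.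
have sS : sqint P S by apply: sqint_sum => t _; exact: sqint_noise.
have mS : measurable_cV (S : past Zs k -> 'rV[R]_d) := @measurable_noise_sum a
  b k.
have LX := (sX k).2.
pose h w := fro2 (S w) + (c0 + c1 * fro2 (X k w)).
have Lk : L1 P (fun w => c0 + c1 * fro2 (X k w)).
  by apply: L1D; [exact: L1_cst|exact: L1Z].
have Lh : L1 P h by apply: L1D => //; exact: sS.2.
pose FF w M N := fro2 (S w + oneT *m (a *: (M - Gbar (X k w)) + b *: (N - Gbar
  0))).
have [mX _] := measurable_iter k.
have [|||_ le] := @fresh_sample k
  FF h _ _ Lh.
- move=> dW W V M N mV mM mN; apply: measurable_fro2; apply: measurable_cV_D.
    by move=> i j; exact: (measurableT_comp (mS i j) mV).
  apply: measurable_cV_mul; apply: measurable_cV_D; apply: measurable_cV_Z.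
    apply: measurable_cV_D => //; apply: measurable_cV_N.
    apply: measurable_Gbar => i j; exact: (measurableT_comp (mX i j) mV).
  by apply: measurable_cV_D => //; exact: measurable_cV_cst.
- by move=> w M N; exact: fro2_ge0.
- move=> w; rewrite /FF; set Y := X k w.
  have sY := sqint_Gam Y.
  have sI : sqint P (fun w' =>
    a *: (Gam Y (Z0 w') - Gbar Y) + b *: (Gam 0 (Z0 w') - Gbar 0)).
    by apply: sqintD; apply: sqintZ; apply: sqintB => //; exact: sqint_cst.
  have mean i j : Ex P (fun w' => (a *: (Gam Y (Z0 w') - Gbar Y)
      + b *: (Gam 0 (Z0 w') - Gbar 0)) i j) = (0 : 'M[R]_(n, d)) i j.
    have cE V : Ex P (fun w' => Gam V (Z0 w') i j - Gbar V i j) = 0.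
      rewrite ExB ?Gmean ?Ex_cst ?subrr//; last exact: L1_cst.
      exact: sqint_entry (sqint_Gam V).
    have LE V : L1 P (fun w' => Gam V (Z0 w') i j - Gbar V i j).
      apply: L1B; last exact: L1_cst.
      exact: sqint_entry (sqint_Gam V).
    have -> : (fun w' => (a *: (Gam Y (Z0 w') - Gbar Y) + b *: (Gam 0 (Z0 w')
      - Gbar 0)) i j) =
       (fun w' => a * (Gam Y (Z0 w') i j - Gbar Y i j) + b * (Gam 0 (Z0 w') i
         j - Gbar 0 i j)).
      by apply/funext => w'; rewrite !mxE.
    by rewrite ExD ?ExZ ?cE ?mulr0 ?addr0 ?mxE//; exact: L1Z.
  have sK := sqint_mul oneT sI.
  split; first by have [] := sqintD (sqint_cst P (S w)) sK.
  rewrite (Ex_fro2D (S w) sK (Ex_mul oneT sI mean)) mulmx0.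
  have -> : fdot (S w) 0 = 0.
    by rewrite -[X in fdot _ X](scale0r 0) fdotZr mul0r.
  by rewrite mulr0 addr0 lerD2l.
have hE : (fun w => FF w (G k w) (Gam 0 (Zs k w))) =
    (fun w => fro2 (\sum_(t < k.+1) noise a b t w)).
  by apply/funext => w; rewrite /FF big_ord_recr.
move: le; rewrite hE => le; apply: (le_trans le).
rewrite big_ord_recr /h ExD//; last exact: sS.2.
rewrite ExD ?Ex_cst ?ExZ//; [|exact: L1_cst|exact: L1Z].
by rewrite lerD2r.
Qed.

Lemma mean_at_optimum : oneT *m Gbar 0 = 0.
Proof.
apply: fro2_eq0; have := Flin 0.
by rewrite /F mulmx0 mul0mx subr0 fro20 expr0n mulr0.
Qed.

Let negl := negligible P.

Lemma negligible_row (x : nat -> T -> 'rV[R]_d) s C : 0 <= C -> (forall k,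
  sqint P (x k)) ->
  (forall k, Ex P (fun w => fro2 (x k w)) <= C * al k ^+ 2) ->
  negl (fun k w => rowdot (x k w) s).
Proof.
move=> C0 sx hx.
have h k := rowdot_moment s (sx k) (mulr_ge0 C0 (sqr_ge0 (al k))) (hx k).
apply: (@negligible_rate _ _ _ P al al0 al_sqrt _ (Num.sqrt (fro2 s * C))) =>
  //.
- by move=> k; have [] := h k.
near=> k; have [_ _] := h k;
  rewrite mulrA sqrtrM ?mulr_ge0 ?fro2_ge0// sqrtr_sqr.
by rewrite (ger0_norm (ltW (al0 k))).
Unshelve. all: by end_near. Qed.

(** With s' = H^-1 s, the center tested against s is center H tested against s'. Two expressions for
    1^T G are equated: one from the center recursion, the other splitting it into center H,
    linearization error, disagreement error, noise difference and gradient at the optimum. Six terms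
    remain, each negligible for its own reason. *)
Lemma iterate_remainder i (s : 'cV[R]_d) :
  negl (fun k w => rowdot (row i (X k w)) s
     + rowdot (oneT *m Gam 0 (Zs k w)) (invmx Hs *m s)).
Proof.
have [K K0 hK] := iterate_rates.
pose s' := invmx Hs *m s.
pose ei k w : 'M[R]_(n, d) := al k *: (one *m pi *m Q k w) + spread k w.
have sei k : sqint P (ei k).
  by apply: sqintD => //; apply: sqintZ; exact: sqint_mul.
pose Ce := 2 * fro2 (one *m pi) * K + 2 * K.
have Ce0 : 0 <= Ce by rewrite addr_ge0 ?mulr_ge0 ?fro2_ge0.
have hei k : Ex P (fun w => fro2 (ei k w)) <= Ce * al k ^+ 2.
  have [hQ hS _ _] := hK k; have pp0 := sqr_ge0 (al k).
  have f0 := fro2_ge0 (one *m pi).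
  have c0 : 0 <= 2 * (al k ^+ 2 * fro2 (one *m pi)) by rewrite mulr_ge0//
    mulr_ge0.
  apply: (@le_trans _ _ (Ex P (fun w =>
    2 * (al k ^+ 2 * fro2 (one *m pi)) * fro2 (Q k w) + 2 * fro2 (spread k
      w)))).
    apply: Ex_le => [||w]; first exact: (sei k).2.
      by apply: L1D; apply: L1Z; [exact: (sQ k).2|exact: (sqint_spread k).2].
    apply: (le_trans (fro2D2 _ _)); rewrite lerD2r fro2Z -[leRHS]mulrA;
      apply: ler_wpM2l => //.
    rewrite -[leRHS]mulrA; apply: ler_wpM2l => //.
    exact: fro2_mulmx.
  rewrite ExD ?ExZ//; [|exact: (sqint_spread k).2|exact: (sQ
    k).2|exact/L1Z/(sQ k).2|exact/L1Z/(sqint_spread k).2].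
  have := ler_wpM2l c0 hQ; rewrite /Ce; lra.
pose rho k w := F (center k w) - center k w *m Hs.
pose Dl k w := oneT *m Gbar (X k w) - F (center k w).
pose be k := al k - al k.+1.
have sF k : sqint P (fun w => F (center k w)).
  by apply: sqint_mul; apply: sqint_Gbar; exact: sqint_mul.
have srho k : sqint P (rho k) by apply: sqintB => //; exact: sqint_mulr.
have sDl k : sqint P (Dl k) by apply: sqintB => //; apply: sqint_mul;
  exact: sqint_Gbar.
have N1 : negl (fun k w => rowdot (row i (ei k w)) s).
  have srow k : sqint P (fun w => row i (ei k w)).
    by under eq_fun do rewrite rowE; exact: sqint_mul.
  apply: (@negligible_row _ _ Ce) => // k.
  apply: le_trans (hei k); apply: Ex_le => [||w];
    [exact: (srow k).2|exact: (sei k).2|].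
  exact: fro2_row_le.
(* Effect of the changing step: the coefficient is at most al / gam, while Q is bounded in mean
   square. *)
have N2 : negl (fun k w => be k / (al k * gam) * rowdot (pi *m Q k.+1 w) s').
  have q0 : 0 <= fro2 pi * K by rewrite mulr_ge0 ?fro2_ge0.
  have h k : [/\ L1 P (fun w => rowdot (pi *m Q k.+1 w) s'), L1 P (fun w =>
    rowdot (pi *m Q k.+1 w) s' ^+ 2) &
     Ex P (fun w => `|rowdot (pi *m Q k.+1 w) s'|) <= Num.sqrt (fro2 s' *
       (fro2 pi * K))].
    apply: rowdot_moment => //; first exact: sqint_mul.
    have [hQ _ _ _] := hK k.+1;
      apply: (@le_trans _ _ (Ex P (fun w => fro2 pi * fro2 (Q k.+1 w)))).
      apply: Ex_le => [||w];
        [exact: (sqint_mul pi (sQ k.+1)).2|exact/L1Z/(sQ k.+1).2|exact: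
          fro2_mulmx].
    by rewrite ExZ ?ler_wpM2l ?fro2_ge0//; exact: (sQ k.+1).2.
  set C := Num.sqrt _ in h; have C0 : 0 <= C by exact: sqrtr_ge0.
  apply: (@negligible_rate _ _ _ P al al0 al_sqrt _ (gam^-1 * C)).
  - by rewrite mulr_ge0// invr_ge0 ltW.
  - by move=> k; apply: L1Z; have [] := h k.
  near=> k.
  have bp2 : be k <= 1 * al k ^+ 2 by near: k; exact: ald.
  have p0 := al0 k; have be0 : 0 <= be k by rewrite subr_ge0.
  have [L _ le] := h k.
  have c0 : 0 <= be k / (al k * gam) by rewrite divr_ge0// mulr_ge0 ?ltW.
  under eq_fun do rewrite normrM (ger0_norm c0); rewrite ExZ;
    last exact: L1_norm.
  apply: (le_trans (ler_wpM2l c0 le)).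
  have -> : gam^-1 * C * al k = al k / gam * C by ring.
  apply: ler_wpM2r => //; rewrite ler_pdivrMr ?mulr_gt0//.
  have -> : al k / gam * (al k * gam) = al k ^+ 2 by field; rewrite gt_eqF.
  by rewrite -[leRHS]mul1r.
(* The linearization error is at most quadratic in the center, so its first moment needs only the
   second moment of the center, which is O(al). *)
have N3 : negl (fun k w => - 1 * rowdot (rho k w) s').
  apply: negligibleZ; set C := Num.sqrt (cl * fro2 s').
  have C0 : 0 <= C by exact: sqrtr_ge0.
  have Lr k : L1 P (fun w => rowdot (rho k w) s').
    by have [] := L1_rowdot s' (srho k).
  apply: (@negligible_rate _ _ _ P al al0 al_sqrt _ (C * K)) => //;
    first exact: mulr_ge0.
  near=> k; have [_ _ hc _] := hK k; have Lk := (sqint_center k).2.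
  apply: (@le_trans _ _ (Ex P (fun w => C * fro2 (center k w)))); last first.
    by rewrite ExZ// -mulrA ler_wpM2l.
  apply: Ex_le => [||w]; [exact: L1_norm|exact: L1Z|].
  rewrite -(@ler_pXn2r _ 2) ?nnegrE ?mulr_ge0 ?fro2_ge0// real_normK
    ?num_real//.
  apply: (le_trans (rowdot_sqr _ _));
    rewrite exprMn sqr_sqrtr ?mulr_ge0 ?fro2_ge0//.
  by rewrite mulrAC mulrC ler_wpM2r ?fro2_ge0//; exact: Flin.
(* The oracle sees the disagreement [ei] through its Lipschitz bound. *)
have N4 : negl (fun k w => - 1 * rowdot (Dl k w) s').
  apply: negligibleZ; apply: (@negligible_row _ _ (fro2 oneT * (Lg * Ce))) =>
    //.
    by rewrite mulr_ge0 ?fro2_ge0// mulr_ge0.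
  move=> k; rewrite -!mulrA.
  apply: (@le_trans _ _ (Ex P (fun w => fro2 oneT * (Lg * fro2 (ei k w))))).
    apply: Ex_le => [||w]; [exact: (sDl k).2|exact/L1Z/L1Z/(sei k).2|].
    rewrite /Dl /F -mulmxBr; apply: (le_trans (fro2_mulmx _ _)).
    rewrite ler_wpM2l ?fro2_ge0//.
    apply: (le_trans (Gbar_lipschitz _ _)).
    by rewrite ler_wpM2l// {1}iterX_split addrAC subrr add0r.
  rewrite ExZ ?ExZ//; [|exact: (sei k).2|exact/L1Z/(sei k).2].
  by rewrite ler_wpM2l ?fro2_ge0// ler_wpM2l.
(* Increments of the center divided by al, summed by parts; the center has first moments O(sqrt
   al). *)
have N5 : negl (fun k w =>
  gam^-1 * ((rowdot (center k w) s' - rowdot (center k.+1 w) s') / al k)).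
  apply: negligibleZ.
  have h k : [/\ L1 P (fun w => rowdot (center k w) s'), L1 P (fun w =>
    rowdot (center k w) s' ^+ 2) &
     Ex P (fun w => `|rowdot (center k w) s'|) <= Num.sqrt (fro2 s' * (K * al
       k))].
    have [_ _ hc _] := hK k; apply: rowdot_moment => //.
    by rewrite mulr_ge0// ltW.
  apply: (@negligible_telescope _ _ _ P al al0 aln al_inv (fun k w =>
    rowdot (center k w) s') (Num.sqrt (fro2 s' * K))) => //.
    by move=> k; have [] := h k.
  by move=> k; have [_ _] := h k; rewrite mulrA sqrtrM// mulr_ge0 ?fro2_ge0.
(* Centred increments of conditional variance at most a multiple of |X|^2, whose mean is O(al);
   orthogonality adds these up. *)
have N6 : negl (fun k w => - 1 * rowdot (noise 1 (- 1) k w) s').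
  apply: negligibleZ.
  have sN k : sqint P (fun w => \sum_(t < k) noise 1 (- 1) t w).
    by apply: sqint_sum => t _; exact: sqint_noise.
  have c10 : 0 <= fro2 oneT * (4 * Lg) by rewrite mulr_ge0 ?fro2_ge0// mulr_ge0.
  have hN := @noise_sum 1 (- 1) 0 _ c10 _.
  have {}hN k : Ex P (fun w => fro2 (\sum_(t < k) noise 1 (- 1) t w)) <=
      fro2 oneT * (4 * Lg) * K * \sum_(t < k) al t.
    apply: le_trans (hN _ k) _ => [Y|].
      rewrite add0r -mulrA.
      have sD := sqintB (sqint_Gam Y) sG0.
      have LL : L1 P (fun w =>
        2 * fro2 (Gam Y (Z0 w) - Gam 0 (Z0 w)) + 2 * fro2 (Gbar Y - Gbar 0)).
        by apply: L1D; [apply: L1Z; exact: sD.2|exact: L1_cst].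
      apply: (@le_trans _ _ (Ex P (fun w =>
        fro2 oneT * (2 * fro2 (Gam Y (Z0 w) - Gam 0 (Z0 w)) + 2 * fro2 (Gbar Y
          - Gbar 0))))).
        apply: Ex_le => [||w]; last 1 first.
        - apply: (le_trans (fro2_mulmx _ _)); rewrite ler_wpM2l ?fro2_ge0//.
          have -> : 1 *: (Gam Y (Z0 w) - Gbar Y) + -1 *: (Gam 0 (Z0 w) - Gbar
            0) =
            (Gam Y (Z0 w) - Gam 0 (Z0 w)) + - (Gbar Y - Gbar 0).
            by apply/matrixP => a j; rewrite !mxE; ring.
          by rewrite -[fro2 (Gbar Y - _)]fro2N; exact: fro2D2.
        - have [] := @sqint_mul _ _ _ P _ _ _ oneT (fun w =>
            1 *: (Gam Y (Z0 w) - Gbar Y) + -1 *: (Gam 0 (Z0 w) - Gbar 0)) => //.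
          apply: sqintD; apply: sqintZ; apply: sqintB => //;
            try exact: sqint_cst.
          exact: sqint_Gam.
        - exact: L1Z.
      rewrite ExZ// ler_wpM2l ?fro2_ge0// ExD ?Ex_cst ?ExZ//;
        [|exact: sD.2|exact/L1Z/sD.2|exact: L1_cst].
      have := Glip Y 0; have := Gbar_lipschitz Y 0.
      rewrite subr0; lra.
    rewrite -mulrA mulr_sumr mulr_sumr; apply: ler_sum => t _;
      rewrite add0r ler_wpM2l//.
    by have [_ _ _ hX] := hK t.
  apply: (@negligible_square _ _ _ P al al0 al_sqrt _ (fro2 s' * (fro2 oneT *
    (4 * Lg) * K))).
  - by rewrite mulr_ge0 ?fro2_ge0// mulr_ge0.
  - by move=> k; have [] := L1_rowdot s' (sqint_noise 1 (- 1) k).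
  move=> k.
  have E1 : (fun w => (\sum_(t < k) rowdot (noise 1 (- 1) t w) s') ^+ 2) =
      (fun w => rowdot (\sum_(t < k) noise 1 (- 1) t w) s' ^+ 2).
    by apply/funext => w; rewrite /rowdot mulmx_suml summxE.
  rewrite E1; have [_ L2] := L1_rowdot s' (sN k).
  split => //; rewrite -[leRHS]mulrA.
  apply: (@le_trans _ _ (Ex P (fun w =>
    fro2 s' * fro2 (\sum_(t < k) noise 1 (- 1) t w)))).
    by apply: Ex_le => // [|w]; [apply: L1Z; exact: (sN k).2|exact: rowdot_sqr].
  by rewrite ExZ ?ler_wpM2l ?fro2_ge0//; exact: (sN k).2.
have := negligibleD N1 (negligibleD N2 (negligibleD N3 (negligibleD N4
  (negligibleD N5 N6)))).
rewrite /negl; congr negligible; apply/funext => k; apply/funext => w.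
(* The center recursion, solved for 1^T G. *)
have gE : al k * gam * rowdot (oneT *m G k w) s' =
    rowdot (center k w) s' - rowdot (center k.+1 w) s' + be k * rowdot (pi *m
      Q k.+1 w) s'.
  rewrite -!rowdotZ -rowdotN -!rowdotD; congr rowdot.
  rewrite centerS QS -/(be k).
  have -> : pi *m (B *m Q k w - PiB *m G k w) = pi *m B *m Q k w - pi *m PiB
    *m G k w.
    by rewrite mulmxBr !mulmxA.
  have -> : (- (al k * gam) *: oneT - be k *: (pi *m PiB)) *m G k w =
      - (al k * gam) *: (oneT *m G k w) - be k *: (pi *m PiB *m G k w).
    by rewrite mulmxBl -!scalemxAl.
  move: (center k w) (pi *m B *m Q k w) (oneT *m G k w) (pi *m PiB *m G k w)
    => c1 c2 c3 c4.
  by apply/rowP => j; rewrite !mxE; ring.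
have gD : rowdot (oneT *m G k w) s' = rowdot (rho k w) s' + rowdot (center k w
  *m Hs) s'
    + rowdot (Dl k w) s' + rowdot (noise 1 (- 1) k w) s' + rowdot (oneT *m Gam
        0 (Zs k w)) s'.
  rewrite -!rowdotD; congr rowdot; rewrite /rho /Dl /noise scale1r scaleN1r.
  rewrite mulmxBr !mulmxBr mean_at_optimum subr0.
  move: (oneT *m G k w) (oneT *m Gbar (X k w)) (F (center k w)) (center k w *m
    Hs) (oneT *m Gam 0 _) => c1 c2 c3 c4 c5.
  by apply/rowP => j; rewrite !mxE; ring.
have hc : rowdot (center k w *m Hs) s' = rowdot (center k w) s.
  by rewrite /rowdot /s' -mulmxA mulKVmx.
have hX : rowdot (row i (X k w)) s = rowdot (center k w) s + rowdot (row i (ei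
  k w)) s.
  rewrite -rowdotD iterX_split -/(ei k w) linearD /= row_mul.
  have -> : row i one = 1%:M by apply/rowP => j; rewrite ord1 !mxE.
  by rewrite mul1mx.
rewrite hX -hc -/s'.
move: gE; rewrite gD => gE.
have p0 : al k != 0 by rewrite gt_eqF.
have g0 : gam != 0 by rewrite gt_eqF.
move: (rowdot (rho k w) s') (rowdot (center k w *m Hs) s') (rowdot (Dl k w)
  s') (rowdot (noise 1 (- 1) k w) s')
  (rowdot (oneT *m Gam 0 (Zs k w)) s') (rowdot (center k w) s') (rowdot
    (center k.+1 w) s')
  (rowdot (pi *m Q k.+1 w) s') (rowdot (row i (ei k w)) s) (be k) (al k) gam
    p0 g0 gE.
move=> r h D N M c c' q e b p g p0 g0 gE.
have -> : e + (b / (p * g) * q + (-1 * r + (-1 * D + (g^-1 * ((c - c') / p) +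
  -1 * N)))) =
   (c - c' + b * q) / (p * g) + e - r - D - N by field; rewrite p0 g0.
by rewrite -gE; field; rewrite p0 g0.
Unshelve. all: by end_near. Qed.

Definition average i k w : 'cV[R]_d := (Num.sqrt k%:R)^-1 *: \sum_(t < k) (row
  i (X t w))^T.

(** The influence of one sample on the limit, tested against s: minus H^-1 applied to the total
    gradient at the optimum. *)
Definition score (s : 'cV[R]_d) z : R := - rowdot (oneT *m Gam 0 z) (invmx Hs
  *m s).

Lemma dotp_rowdot (s x : 'cV[R]_d) : dotp s x = rowdot x^T s.
Proof.
rewrite /rowdot mxE /dotp; apply: eq_bigr => j _.
by rewrite mulrC; congr (_ * _); rewrite mxE.
Qed.

Lemma measurable_score s : measurable_fun [set: E] (score s).
Proof.
apply: measurableT_comp => //.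
have mG0 : measurable_cV (fun z : E => Gam 0 z).
  by apply: mGam; [exact: measurable_cV_cst|exact: measurable_id].
under eq_fun do rewrite /rowdot mxE.
apply: (@measurable_sum _ _ _ _ _ _ (fun j z =>
  (oneT *m Gam 0 z) 0 j * (invmx Hs *m s) j 0)) => j.
by apply: measurable_funM => //; exact: measurable_cV_mul.
Qed.

Lemma score_L2 s : L1 P (fun w => score s (Z0 w)) /\ L1 P (fun w =>
  score s (Z0 w) ^+ 2).
Proof.
have [L L2] := L1_rowdot (invmx Hs *m s) (sqint_mul oneT sG0); split.
  exact: L1N.
by under eq_fun do rewrite /score sqrrN.
Qed.

Lemma score_mean s : Ex P (fun w => score s (Z0 w)) = 0.
Proof.
have sM := sqint_mul oneT sG0.
have mean := Ex_mul oneT sG0 (Gmean 0); rewrite mean_at_optimum in mean.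
have -> : (fun w => score s (Z0 w)) = (fun w =>
  - 1 * (\sum_j (invmx Hs *m s) j 0 * (oneT *m Gam 0 (Z0 w)) 0 j)).
  apply/funext => w; rewrite mulN1r /score /rowdot mxE; congr (- _).
  by apply: eq_bigr => j _; rewrite mulrC.
have L j : L1 P (fun w => (invmx Hs *m s) j 0 * (oneT *m Gam 0 (Z0 w)) 0 j).
  by apply: L1Z; exact: sqint_entry.
rewrite ExZ; last exact: L1_sum.
rewrite Ex_sum// big1 ?mulr0// => j _; rewrite ExZ ?mean ?mxE ?mulr0//.
exact: sqint_entry.
Qed.

Let rem i s k w := rowdot (row i (X k w)) s + rowdot (oneT *m Gam 0 (Zs k w))
  (invmx Hs *m s).

Let averageE i k s w : dotp s (average i k w) =
  (Num.sqrt k%:R)^-1 * \sum_(t < k) score s (Zs t w) + (Num.sqrt k%:R)^-1 *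
    \sum_(t < k) rem i s t w.
Proof.
rewrite dotp_rowdot /average linearZ /= linear_sum /= rowdotZ -mulrDr;
  congr (_ * _).
rewrite -big_split /rowdot mulmx_suml summxE; apply: eq_bigr => t _ /=.
by rewrite trmxK -/(rowdot _ s) /score /rem [RHS]addrC addrK.
Qed.

Lemma sqint_average i k : sqint P (average i k).
Proof.
apply: sqintZ; apply: (@sqint_sum _ _ _ _ _ _ k (fun t w =>
  (row i (X t w))^T)) => t _.
apply: (@sqint_le _ _ _ _ _ _ _ _ _ (X t) 1) => // [a j|w].
  by under eq_fun do rewrite !mxE; have [mX _] := sX t; exact: mX.
by rewrite fro2_tr mul1r; exact: fro2_row_le.
Qed.

Lemma measurable_average i k : measurable_cV (average i k).
Proof. by have [] := sqint_average i k. Qed.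

(** Cosine is 1-Lipschitz, so a remainder that is negligible in L^1 does not change the limit
    obtained for the normalized sum of scores. *)
Theorem average_charf i c s : charf P (average i k) c s @[k --> \oo] -->
  expR (- (Ex P (fun w => score s (Z0 w) ^+ 2) / 2)) * cos c.
Proof.
have h1 := @clt_cos _ _ _ _ _ P _ _ mZ0 mZs iid _ (measurable_score s)
  (score_L2 s).2 (score_mean s) c.
have [Lr h2] := iterate_remainder i s.
pose Y k w := c + (Num.sqrt k%:R)^-1 * \sum_(t < k) score s (Zs t w).
have mY k : measurable_fun [set: T] (Y k).
  apply: measurable_funD => //; apply: measurable_funM => //.
  apply: (@measurable_sum _ _ _ _ _ _ (fun (t : 'I_k) w =>
    score s (Zs t w))) => t.
  exact: (measurableT_comp (measurable_score s)).
have d0 : (charf P (average i k) c s - Ex P (fun w =>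
  cos (Y k w))) @[k --> \oo] --> (0 : R).
  apply/norm_cvg0P; apply: squeeze_cvgr (cvg_cst 0) h2; near=> k.
  rewrite normr_ge0 /charf -ExB; last 2 first.
  - exact: L1_charf (measurable_average i k).
  - by apply: L1_cos; exact: mY.
  have Lsum : L1 P (fun w => `|\sum_(t < k) rem i s t w|).
    by apply: L1_norm; apply: L1_sum => t; exact: Lr.
  rewrite -ExZ//; apply: Ex_bound.
  - apply: L1B; first exact: L1_charf (measurable_average i k).
    by apply: L1_cos; exact: mY.
  - exact: L1Z.
  move=> w; apply: (le_trans (norm_cos_sub_le _ _)).
  by rewrite averageE /Y addrA [X in `|X|]addrC addKr normrM ger0_norm.
have h3 := cvgD d0 h1; rewrite add0r in h3.
have -> : (fun k => charf P (average i k) c s) = (fun k =>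
  charf P (average i k) c s
    - Ex P (fun w => cos (Y k w)) + Ex P (fun w => cos (Y k w))).
  by apply/funext => k; rewrite subrK.
exact: h3.
Unshelve. all: by end_near. Qed.

(** Markov's inequality with first absolute moments bounded in k: the scores are handled by
    orthogonality of the noise, the remainder because a convergent sequence is bounded. *)
Lemma average_tight i (e : R) : 0 < e -> exists K0 : R, forall (K : R) k, K0
  <= K ->
  tails P K (average i k) <= e.
Proof.
move=> e0.
have bnd j : exists2 B, 0 <= B & forall k, Ex P (fun w =>
  `|average i k w j 0|) <= B.
  pose s : 'cV[R]_d := delta_mx j 0.
  have [Lr h2] := iterate_remainder i s.
  have [b1 b10 hb1] : exists2 B, 0 <= B & forall k, (Num.sqrt k%:R)^-1 * Ex P
    (fun w => `|\sum_(t < k) rem i s t w|) <= B.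
    have [M [_ hM]] := cvg_seq_bounded (cvgP _ h2).
    exists (`|M| + 1) => [|k]; first by rewrite addr_ge0.
    apply: le_trans (ler_norm _) _; apply: hM => //.
    by apply: (le_lt_trans (ler_norm M)); rewrite ltrDl.
  pose v := fro2 (invmx Hs *m s) * (fro2 oneT * Ex P (fun w =>
    fro2 (Gam 0 (Z0 w)))).
  have v0 : 0 <= v.
    by rewrite mulr_ge0 ?fro2_ge0// mulr_ge0 ?fro2_ge0//; apply: Ex_ge0 => w;
      exact: fro2_ge0.
  exists (Num.sqrt v + b1); first by rewrite addr_ge0 ?sqrtr_ge0.
  move=> k.
  (* As the mean oracle at the optimum sums to 0, [noise 0 1] is the total gradient there, that is,
     the score before testing. *)
  have sN : sqint P (fun w => \sum_(t < k) noise 0 1 t w).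
    by apply: sqint_sum => t _; exact: sqint_noise.
  have hN : Ex P (fun w => fro2 (\sum_(t < k) noise 0 1 t w)) <=
     k%:R * (fro2 oneT * Ex P (fun w => fro2 (Gam 0 (Z0 w)))).
    have E0 Y w : oneT *m (0 *: (Gam Y (Z0 w) - Gbar Y) + 1 *: (Gam 0 (Z0 w) -
      Gbar 0)) = oneT *m Gam 0 (Z0 w).
      by rewrite scale0r add0r scale1r mulmxBr mean_at_optimum subr0.
    have hv Y : Ex P (fun w =>
      fro2 (oneT *m (0 *: (Gam Y (Z0 w) - Gbar Y) + 1 *: (Gam 0 (Z0 w) - Gbar
        0))))
        <= fro2 oneT * Ex P (fun w => fro2 (Gam 0 (Z0 w))) + 0 * fro2 Y.
      under eq_fun do rewrite E0.
      rewrite mul0r addr0 -ExZ; last exact: sG0.2.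
      by apply: Ex_le => [||w];
        [exact: (sqint_mul oneT sG0).2|exact/L1Z/sG0.2|exact: fro2_mulmx].
    apply: (le_trans (noise_sum (lexx _) hv k)).
    under eq_bigr do rewrite mul0r addr0.
    by rewrite sumr_const card_ord mulr_natl.
  have SE : (fun w => \sum_(t < k) score s (Zs t w)) =
      (fun w => - rowdot (\sum_(t < k) noise 0 1 t w) (invmx Hs *m s)).
    apply/funext => w; rewrite /rowdot mulmx_suml summxE -sumrN;
      apply: eq_bigr => t _.
    by rewrite /noise scale0r add0r scale1r mulmxBr mean_at_optimum subr0.
  have [LS LS2] := L1_rowdot (invmx Hs *m s) sN.
  have hS : Ex P (fun w =>
    `|\sum_(t < k) score s (Zs t w)|) <= Num.sqrt (k%:R * v).
    rewrite (_ : (fun w => `|_|) = (fun w =>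
      `|rowdot (\sum_(t < k) noise 0 1 t w) (invmx Hs *m s)|)); last first.
      by apply/funext => w; rewrite (congr1 (fun f => f w) SE) normrN.
    have kv0 : 0 <= k%:R * (fro2 oneT * Ex P (fun w => fro2 (Gam 0 (Z0 w)))).
      by rewrite mulr_ge0// mulr_ge0 ?fro2_ge0//; apply: Ex_ge0 => w;
        exact: fro2_ge0.
    have [_ _] := rowdot_moment (invmx Hs *m s) sN kv0 hN.
    by rewrite [fro2 (invmx Hs *m s) * (k%:R * _)]mulrCA.
  have LSc : L1 P (fun w => \sum_(t < k) score s (Zs t w)) by rewrite SE;
    exact: L1N.
  have LR : L1 P (fun w => \sum_(t < k) rem i s t w) by apply: L1_sum => t;
    exact: Lr.
  pose c := (Num.sqrt (k%:R : R))^-1.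
  have c0 : 0 <= c by rewrite invr_ge0 sqrtr_ge0.
  apply: (@le_trans _ _ (Ex P (fun w =>
    c * `|\sum_(t < k) score s (Zs t w)| + c * `|\sum_(t < k) rem i s t w|))).
    apply: Ex_le => [||w].
    - by apply: L1_norm; exact: sqint_entry (sqint_average i k).
    - by apply: L1D; apply: L1Z; exact: L1_norm.
    have -> : average i k w j 0 = dotp s (average i k w) by rewrite dotp_delta.
    rewrite averageE.
    by apply: (le_trans (ler_normD _ _)); rewrite !normrM (ger0_norm c0).
  rewrite ExD; [|exact/L1Z/L1_norm|exact/L1Z/L1_norm].
  rewrite !ExZ; [|exact: L1_norm|exact: L1_norm].
  apply: lerD; last exact: hb1.
  apply: (le_trans (ler_wpM2l c0 hS)); rewrite /c.
  (* For k = 0 the normalization is the inverse of 0, which is 0. *)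
  case: (k) => [|k']; first by rewrite sqrtr0 invr0 mul0r sqrtr_ge0.
  by rewrite sqrtrM ?ler0n// mulrA mulVf ?mul1r// gt_eqF// sqrtr_gt0 ltr0n.
have /choice[bd hbd] : forall j, exists b, 0 <= b /\ forall k, Ex P (fun w =>
  `|average i k w j 0|) <= b.
  by move=> j; have [b' b'0 h] := bnd j; exists b'.
pose SB := \sum_j bd j.
have SB0 : 0 <= SB by apply: sumr_ge0 => j _; have [] := hbd j.
exists ((SB + 1) / e) => K k K0K.
have K0 : 0 < K by apply: lt_le_trans K0K; rewrite divr_gt0// ltr_wpDl.
apply: (@le_trans _ _ (SB / K)); last first.
  rewrite ler_pdivrMr// mulrC -ler_pdivrMr//; apply: le_trans K0K.
  by rewrite ler_wpM2r ?lerDl// invr_ge0 ltW.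
rewrite /tails /SB mulr_suml; apply: ler_sum => j _.
have [bd0 hbdj] := hbd j.
have LA : L1 P (fun w => `|average i k w j 0|).
  by apply: L1_norm; exact: sqint_entry (sqint_average i k).
apply: (@le_trans _ _ (Ex P (fun w => K^-1 * `|average i k w j 0|))).
  apply: Ex_le => [||w]; [apply: L1_tail;
    exact: measurable_average|exact: L1Z|].
  by rewrite mulrC; exact: tail_le.
by rewrite ExZ// mulrC ler_wpM2r ?invr_ge0 ?(ltW K0).
Qed.

End iteration.

(** * Weights, covariance and identification of the iteration *)

Section weights.
Context {R : realType} {n : nat}.

Lemma root_connect (M : 'M[R]_n) r : roots M r -> forall i, connect (edge M) r
  i.
Proof.
move=> [t [te _ _ conn]] i; apply: connect_sub (conn i) => j l /te jl.
exact: connect1.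
Qed.

(** The row is also fixed by the power of [M] whose column r is positive; were its entry at r zero,
    all entries would vanish. *)
Lemma fixed_row_pos (M : 'M[R]_n) (pi : 'rV[R]_n) r :
  row_stochastic M -> (forall i, 0 < M i i) -> (forall i, connect (edge M) r
    i) ->
  (forall i, 0 <= pi 0 i) -> pi *m M = pi -> pi *m const_mx 1 = 1%:M -> 0 < pi
    0 r.
Proof.
move=> sM diag conn pi0 piM pi1.
have [k pos] := stochastic_powers_pos sM diag conn.
have piMk : pi *m (M ^+ k) = pi.
  elim: (k) => [|j IH]; first by rewrite expr0 mulmx1.
  by rewrite exprSr -[X in _ *m X]/(_ *m _) mulmxA IH.
rewrite -piMk mxE.
have sum1 : \sum_i pi 0 i = 1.
  have := congr1 (fun A : 'M[R]_1 => A 0 0) pi1; rewrite mxE [RHS]mxE eqxx => h.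
  apply: etrans h; by apply: eq_bigr => i _; rewrite mxE mulr1.
have ge0 i : 0 <= pi 0 i * (M ^+ k) i r by rewrite mulr_ge0// ltW.
rewrite lt_def sumr_ge0 ?andbT//; apply/eqP => z.
have z0 i : pi 0 i = 0.
  apply/eqP; have /eqP := psumr_eq0P (fun i _ => ge0 i) z (i := i) isT.
  by rewrite mulf_eq0 (gt_eqF (pos i)) orbF.
by move: sum1; rewrite big1 => [/esym/eqP|//]; rewrite oner_eq0.
Qed.

Lemma trmx_exp (M : 'M[R]_n) k : (M^T ^+ k) = (M ^+ k)^T.
Proof.
elim: k => [|k IH]; first by rewrite !expr0 trmx1.
by rewrite exprS exprSr IH -[LHS]/(_ *m _) -trmx_mul.
Qed.

End weights.

Section covariance_matrix.
Context {R : realType} {dT : measure_display} {T : measurableType dT}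
  (P : probability T R) {d : nat}.
Variable X : T -> 'cV[R]_d.
Hypothesis sX : sqint P X.
Hypothesis X0 : forall i, Ex P (fun w => X w i 0) = 0.

Lemma cov_mxE i j : cov_mx P X i j = Ex P (fun w => X w i 0 * X w j 0).
Proof.
rewrite mxE unlock /= unlock.
have e (l : 'I_d) : fine (\int[P]_x (X x l 0)%:E)%E = 0 by exact: X0.
rewrite /Ex /Rintegral; congr fine; apply: eq_integral => w _.
rewrite /= !e; congr EFin.
by rewrite -[LHS]/((X w i 0 - 0) * (X w j 0 - 0)) !subr0.
Qed.

Let L1_prod i j : L1 P (fun w => X w i 0 * X w j 0).
Proof.
have [mX LX] := sX.
apply: (L1_le _ (L1Z 2 LX)) => [|w]; first by apply: measurable_funM.
have h1 := fro2_entry (X w) i 0; have h2 := fro2_entry (X w) j 0.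
have f0 := fro2_ge0 (X w).
rewrite ler_norml; apply/andP; split.
  by have := sqr_ge0 (X w i 0 + X w j 0); rewrite sqrrD; lra.
by have := sqr_ge0 (X w i 0 - X w j 0); rewrite sqrrB; lra.
Qed.

Lemma cov_mx_quadratic t : dotp t (cov_mx P X *m t) = Ex P (fun w =>
  dotp t (X w) ^+ 2).
Proof.
have -> : (fun w => dotp t (X w) ^+ 2) =
    (fun w => \sum_i \sum_j t i 0 * t j 0 * (X w i 0 * X w j 0)).
  apply/funext => w; rewrite expr2 /dotp mulr_suml; apply: eq_bigr => i _.
  by rewrite mulr_sumr; apply: eq_bigr => j _; ring.
rewrite Ex_sum; last by move=> i; apply: L1_sum => j; exact: L1Z.
apply: eq_bigr => i _; rewrite mxE mulr_sumr Ex_sum; last by move=> j;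
  exact: L1Z.
by apply: eq_bigr => j _; rewrite ExZ// cov_mxE; ring.
Qed.

Lemma cov_mx_sym : (cov_mx P X)^T = cov_mx P X.
Proof.
apply/matrixP => i j; rewrite mxE !cov_mxE; congr Ex.
by apply/funext => w; rewrite mulrC.
Qed.

End covariance_matrix.

Section convergence_in_distribution.
Context {R : realType} {dT : measure_display} {T : measurableType dT}
  (P : probability T R) {d : nat}.

Lemma charf_cvg_in_distribution (X : nat -> T -> 'cV[R]_d) (Sigma : 'M[R]_d) :
  Sigma^T = Sigma -> psd Sigma -> (forall k, measurable_cV (X k)) ->
  (forall e, 0 < e -> exists K0 : R, forall (K : R) k, K0 <= K -> tails P K (X
    k) <= e) ->
  (forall c t, charf P (X k) c t @[k --> \oo] --> expR (- (dotp t (Sigma *m t)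
    / 2)) * cos c) ->
  exists2 nu : probability (borel_cV R d) R,
    is_mvnormal 0 Sigma nu & cvg_in_distribution P X nu.
Proof.
move=> symS psdS mX tight conv.
have [nu normal charE] := mvnormal_exists symS psdS; exists nu => //; split.
  by move=> k; apply: measurable_fun_borel_cV => i; exact: mX.
move=> h ch [M hM].
have mh := continuous_measurable_cV ch.
have mid : measurable_cV (fun x : borel_cV R d => x : 'cV[R]_d).
  by move=> i j; rewrite ord1; exact: measurable_coord.
have main := @levy_continuity R d _ _ P X _ _ nu _ h M mX mid tight _ ch hM.
have {main} main : Ex P (fun w => h (X k w)) @[k --> \oo] --> Ex nu h.
  by apply: main => c t; rewrite /charf charE; exact: conv.
have LX k : L1 P (fun w => h (X k w)).
  apply: (@L1_bounded _ _ _ _ _ M) => //.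
  by apply: (measurableT_comp mh); apply: measurable_fun_borel_cV => i;
    exact: mX.
have Lnu : L1 nu h by apply: (@L1_bounded _ _ _ _ _ M).
have -> : (fun k => 'E_P[h \o X k])%E = (fun k => (Ex P (fun w =>
  h (X k w)))%:E).
  by apply/funext => k; rewrite unlock -integral_Ex.
have -> : ('E_nu[h])%E = (Ex nu h)%:E by rewrite unlock -integral_Ex.
by apply: cvg_EFin => //; near=> k.
Unshelve. all: by end_near. Qed.

End convergence_in_distribution.

Section identification.
Context {R : realType} {dT dZ : measure_display} {T : measurableType dT}
  {Z : measurableType dZ} (P : probability T R) {n d : nat}.
Variables (g : 'I_n -> 'cV[R]_d -> Z -> R) (xstar : 'cV[R]_d)
  (A B : 'M[R]_n) (pr : 'cV[R]_n) (al : R ^nat)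
  (zetas : nat -> 'I_n -> {RV P >-> Z}) (x0 : 'I_n -> 'cV[R]_d)
  (x y : nat -> 'I_n -> T -> 'cV[R]_d).
Hypothesis A1 : A *m const_mx 1 = const_mx 1 :> 'cV[R]_n.
Hypothesis Bpr : B *m pr = pr.
Hypothesis Hxy : SAB_iteration g A B al zetas x0 x y.

Let Zs k := joint (zetas k : 'I_n -> T -> Z).
Definition initial_deviation : 'M[R]_(n, d) := \matrix_(i, j) (x0 i - xstar) j
  0.
Let X := iterX Zs (oracle g xstar) A B pr al initial_deviation.
Let Q := iterQ Zs (oracle g xstar) A B pr al initial_deviation.
Let G := iterG Zs (oracle g xstar) A B pr al initial_deviation.

Let row_mulE (M : 'M[R]_n) (Y : 'M[R]_(n, d)) i :
  (row i (M *m Y))^T = \sum_j M i j *: (row j Y)^T.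
Proof.
apply/colP => l; rewrite summxE !mxE; apply: eq_bigr => j _.
by rewrite !mxE.
Qed.

(** Since [B] fixes [pr], (I - B) (I - pr 1^T) = I - B. Hence (I - B) Q_(k+1) = B (I - B) Q_k - G_k
    + B G_k, which reproduces the tracking update. *)
Lemma tracker_iteration k w :
  G k.+1 w + (1%:M - B) *m Q k.+1 w =
  B *m (G k w + (1%:M - B) *m Q k w) + G k.+1 w - G k w.
Proof.
have -> : Q k.+1 w = B *m Q k w - (1%:M - pr *m const_mx 1) *m G k w by [].
have BB : (1%:M - B) *m (1%:M - pr *m (const_mx 1 : 'rV[R]_n)) = 1%:M - B.
  by rewrite mulmxBr mulmx1 mulmxA mulmxBl mul1mx Bpr subrr mul0mx subr0.
rewrite mulmxBr [(1%:M - B) *m (_ *m G k w)]mulmxA BB mulmxDr !mulmxBl !mul1mx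
  mulmxBr !mulmxA.
move: (G k.+1 w) (G k w) (B *m G k w) (B *m Q k w) (B *m B *m Q k w) =>
  c1 c2 c3 c4 c5.
by apply/matrixP => i j; rewrite !mxE; ring.
Qed.

Lemma iterationE k : (forall i w, x k i w = xstar + (row i (X k w))^T) /\
  (forall i w, y k i w = (row i (G k w + (1%:M - B) *m Q k w))^T).
Proof.
have [hx0 hy0 hxS hyS] := Hxy.
have GE k' i w : (row i (G k' w))^T = sgrad g i (xstar + (row i (X k' w))^T)
  (zetas k' i w).
  by rewrite /G /iterG row_oracle trmxK /agent_point tnth_mktuple.
elim: k => [|k [IHx IHy]].
  have X0E i : xstar + (row i initial_deviation)^T = x0 i.
    by apply/colP => j; rewrite !mxE addrC subrK.
  split=> i w; first by rewrite hx0 X0E.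
  rewrite hy0; have -> : Q 0%N w = 0 by [].
  rewrite mulmx0 addr0 GE; have -> : X 0%N w = initial_deviation by [].
  by rewrite X0E.
have xS i w : x k.+1 i w = xstar + (row i (X k.+1 w))^T.
  rewrite hxS; have -> : X k.+1 w = A *m X k w - al k *: (G k w + (1%:M - B)
    *m Q k w) by [].
  rewrite IHy; under eq_bigr do rewrite IHx scalerDr.
  rewrite big_split /= -scaler_suml -row_mulE.
  (* Row sums equal to 1 let the constant [xstar] pass through the averaging. *)
  have -> : \sum_j A i j = 1.
    have := congr1 (fun M : 'cV[R]_n => M i 0) A1; rewrite !mxE => h.
    by apply: etrans h; apply: eq_bigr => j _; rewrite mxE mulr1.
  by rewrite scale1r -addrA; congr (_ + _); rewrite !linearB /= !linearZ.
split=> // i w; rewrite hyS xS IHx -!GE tracker_iteration.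
under eq_bigr do rewrite IHy.
by rewrite -row_mulE !linearB !linearD.
Qed.

End identification.

Section perron.
Context {R : realType} {n : nat}.
Variables (A B : 'M[R]_n) (u v : 'cV[R]_n).
Hypothesis n_gt0 : (0 < n)%N.
Hypothesis Hnet : network_assumption A B.
Hypothesis Hu : left_perron A u.
Hypothesis Hv : right_perron B v.

Definition row_weight : 'rV[R]_n := n%:R^-1 *: u^T.
Definition col_weight : 'cV[R]_n := n%:R^-1 *: v.

Let n0 : (n%:R : R) != 0. Proof. by rewrite pnatr_eq0 -lt0n. Qed.

Lemma row_weight_fixed : row_weight *m A = row_weight.
Proof. by have [uA _ _] := Hu; rewrite -scalemxAl uA. Qed.

Lemma row_weight_sum : row_weight *m const_mx 1 = 1%:M.
Proof.
have [_ _ us] := Hu; apply/rowP => j; rewrite ord1 -scalemxAl !mxE.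
under eq_bigr do rewrite !mxE mulr1.
by rewrite us mulVf.
Qed.

Lemma row_weight_ge0 i : 0 <= row_weight 0 i.
Proof. by have [_ u0 _] := Hu; rewrite !mxE mulr_ge0 ?invr_ge0. Qed.

Lemma col_weight_fixed : B *m col_weight = col_weight.
Proof. by have [Bv _ _] := Hv; rewrite -scalemxAr Bv. Qed.

Lemma col_weight_sum : const_mx 1 *m col_weight = 1%:M.
Proof.
have [_ _ vs] := Hv; apply/rowP => j; rewrite ord1 -scalemxAr !mxE.
under eq_bigr do rewrite !mxE mul1r.
by rewrite vs mulVf.
Qed.

Lemma col_weight_ge0 i : 0 <= col_weight i 0.
Proof. by have [_ v0 _] := Hv; rewrite !mxE mulr_ge0 ?invr_ge0. Qed.

Let trB : row_stochastic B^T.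
Proof.
have [_ [B0 B1] _ _ _] := Hnet; split => [i j|]; first by rewrite mxE.
by rewrite -[const_mx 1]trmxK trmx_const -trmx_mul B1 trmx_const.
Qed.

Lemma row_contraction : exists N, fro2 ((A - const_mx 1 *m row_weight) ^+
  N.+1) <= 2^-1.
Proof.
have [sA _ diag _ [r [rA _]]] := Hnet.
apply: (stochastic_convergence (r := r)) => //.
- by move=> i; have [] := diag i.
- exact: root_connect.
- exact: row_weight_ge0.
- exact: row_weight_fixed.
- exact: row_weight_sum.
Qed.

(** Transposition makes [B] row stochastic, with the root taken in the graph of its transpose, and
    leaves the Frobenius norm unchanged. *)
Lemma col_contraction : exists N, fro2 ((B - col_weight *m const_mx 1) ^+
  N.+1) <= 2^-1.
Proof.
have [_ _ diag _ [r [_ rB]]] := Hnet.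
have [|||||||N hN] := @stochastic_convergence R n B^T r col_weight^T 2^-1 => //.
- by move=> i; rewrite mxE; have [] := diag i.
- exact: root_connect.
- by move=> i; rewrite mxE; exact: col_weight_ge0.
- by rewrite -trmx_mul col_weight_fixed.
- by rewrite -[const_mx 1]trmxK -trmx_mul trmx_const col_weight_sum trmx1.
exists N; have E : B^T - const_mx 1 *m col_weight^T = (B - col_weight *m
  const_mx 1)^T.
  by rewrite linearB /= trmx_mul trmx_const.
by rewrite E trmx_exp fro2_tr in hN.
Qed.

(** A common root has positive weight in both vectors; the other terms of the product are
    nonnegative. *)
Lemma weights_product : exists2 gam, 0 < gam & row_weight *m col_weight =
  gam%:M.
Proof.
have [sA _ diag _ [r [rA rB]]] := Hnet.
exists ((row_weight *m col_weight) 0 0); last exact: mx11_scalar.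
have r1 : 0 < row_weight 0 r.
  apply: (fixed_row_pos sA) => //.
  - by move=> i; have [] := diag i.
  - exact: root_connect.
  - exact: row_weight_ge0.
  - exact: row_weight_fixed.
  - exact: row_weight_sum.
have r2 : 0 < col_weight r 0.
  have -> : col_weight r 0 = col_weight^T 0 r by rewrite [RHS]mxE.
  apply: (fixed_row_pos trB) => //.
  - by move=> i; rewrite mxE; have [] := diag i.
  - exact: root_connect.
  - by move=> i; rewrite mxE; exact: col_weight_ge0.
  - by rewrite -trmx_mul col_weight_fixed.
  - by rewrite -[const_mx 1]trmxK -trmx_mul trmx_const col_weight_sum trmx1.
rewrite mxE (bigD1 r)//= ltr_wpDr ?mulr_gt0// sumr_ge0// => i _.
by rewrite mulr_ge0 ?row_weight_ge0 ?col_weight_ge0.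
Qed.

End perron.

Unset Implicit Arguments.

Theorem theorem2 (R : realType)
  (dT dZ : measure_display) (T : measurableType dT) (Z : measurableType dZ)
  (P : probability T R) (n d : nat) (n_gt0 : (0 < n)%N) (d_gt0 : (0 < d)%N)
  (g : 'I_n -> 'cV[R]_d -> Z -> R) (zeta : 'I_n -> {RV P >-> Z})
  (g_ok : cost_well_defined g zeta)
  (xstar : 'cV[R]_d) (xstar_opt : forall x, cost g zeta xstar <= cost g zeta x)
  (Lip : 'I_n -> Z -> R) (Hobj : objective_assumption g zeta Lip xstar)
  (A B : 'M[R]_n) (Hnet : network_assumption A B)
  (u v : 'cV[R]_n) (Hu : left_perron A u) (Hv : right_perron B v)
  (a b alpha : R) (a_gt0 : 0 < a) (b_gt0 : 0 < b)
  (alpha_bounds : 2^-1 < alpha < 1)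
  (Hstep : a / b `^ alpha
    <= Num.min 1 (n%:R / (dotp u v * max_lipschitz zeta Lip)))
  (zetas : nat -> 'I_n -> {RV P >-> Z})
  (Hiid : iid_copies P (joint zeta) (fun k => joint (zetas k)))
  (x0 : 'I_n -> 'cV[R]_d) (x y : nat -> 'I_n -> T -> 'cV[R]_d)
  (Hxy : SAB_iteration g A B (fun k => a / (k%:R + b) `^ alpha) zetas x0 x y) :
  let H := hessian (cost g zeta) xstar in
  let S := cov_mx P (fun w => \sum_(j < n) sgrad g j xstar (zeta j w)) in
  forall i : 'I_n,
    exists2 nu : probability (borel_cV R d) R,
      is_mvnormal 0 (invmx H *m S *m invmx H) nu &
      cvg_in_distribution P
        (fun k w => (Num.sqrt k%:R)^-1 *: \sum_(t < k) (x t i w - xstar)) nu.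
Proof.
move=> H S i.
pose Zs k := joint (fun j => zetas k j : T -> Z).
pose Z0 := joint (fun j => zeta j : T -> Z).
have mZ0 : measurable_fun [set: T] Z0 := measurable_joint zeta.
have mZs k : measurable_fun [set: T] (Zs k) := measurable_joint (zetas k).
pose Gam := oracle g xstar; pose Gbar := mean_oracle g zeta xstar.
have mGam dW (W : measurableType dW) (X : W -> 'M[R]_(n, d)) (Y : W ->
  n.-tuple Z) :
    measurable_cV X -> measurable_fun [set: W] Y -> measurable_cV (fun w =>
      Gam (X w) (Y w)).
  exact: (measurable_oracle g_ok Hobj).
have Gmoment X : L1 P (fun w =>
  fro2 (Gam X (Z0 w))) := oracle_moment g_ok Hobj X.
have Lg0 := oracle_lip_ge0 zeta Lip.
have Glip X Y : Ex P (fun w =>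
  fro2 (Gam X (Z0 w) - Gam Y (Z0 w))) <= oracle_lip zeta Lip * fro2 (X - Y).
  by have [] := oracle_lipschitz g_ok Hobj X Y.
have Gmean X l j : Ex P (fun w =>
  Gam X (Z0 w) l j) = Gbar X l j := oracle_mean g_ok Hobj X l j.
have [[_ A1] [_ B1] _ _ _] := Hnet.
have [NA contrA] := row_contraction n_gt0 Hnet Hu.
have [NB contrB] := col_contraction n_gt0 Hnet Hv.
have [gam gam0 gamE] := weights_product n_gt0 Hnet Hu Hv.
have [mu mu0 Fmon] := consensus_grad_monotone g_ok Hobj.
have [cl cl0 Flin] := consensus_grad_linearization g_ok Hobj.
have Hunit := hessian_unit Hobj; have Hsym := hessian_sym Hobj;
  rewrite -/H in Hunit Hsym.
pose al := stepsize a b alpha.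
have al0 := stepsize_gt0 alpha a_gt0 b_gt0.
have aln := stepsize_nonincr a_gt0 b_gt0 alpha_bounds.
have alc := stepsize_cvg0 a b_gt0 alpha_bounds.
have al_sqrt := stepsize_lt_inv_sqrt a_gt0 b_gt0 alpha_bounds.
have ald := stepsize_decr_sqr a_gt0 b_gt0 alpha_bounds.
have al_inv := stepsize_gt_inv a_gt0 b_gt0 alpha_bounds.
pose pi := row_weight u; pose pr := col_weight v.
have piA := row_weight_fixed (A := A) Hu; have pi1 := row_weight_sum n_gt0 Hu.
have Bpr := col_weight_fixed (B := B) Hv; have pr1 := col_weight_sum n_gt0 Hv.
pose X0 := initial_deviation xstar x0.
have xE k j w := (iterationE xstar A1 Bpr Hxy k).1 j w.
have avgE k w : (Num.sqrt k%:R)^-1 *: \sum_(t < k) (x t i w - xstar) =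
    average Zs Gam A B pr al X0 i k w.
  rewrite /average; congr (_ *: _); apply: eq_bigr => t _.
  by rewrite xE addrAC subrr add0r.
have -> : (fun k w => (Num.sqrt k%:R)^-1 *: \sum_(t < k) (x t i w - xstar)) =
    average Zs Gam A B pr al X0 i.
  by apply/funext => k; apply/funext => w; exact: avgE.
(* At zero deviation every agent sits at [xstar], so the oracle sums to the vector whose covariance
   is [S]. *)
pose G0 w := \sum_(j < n) sgrad g j xstar (zeta j w).
have G0E w : G0 w = (const_mx 1 *m Gam 0 (Z0 w))^T.
  apply/colP => l; rewrite /G0 summxE !mxE; apply: eq_bigr => j _.
  rewrite [const_mx _ _ _]mxE mul1r [RHS]mxE tnth_mktuple /agent_point.
  by rewrite row0 trmx0 addr0.
have sG0 : sqint P G0.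
  have [mG LG] := sqint_mul (const_mx 1 : 'rV[R]_n) (sqint_Gam mZ0 mGam
    Gmoment 0).
  split; last by under eq_fun do rewrite G0E fro2_tr.
  by move=> l j; under eq_fun do rewrite G0E mxE; exact: mG.
have mean0 l : Ex P (fun w => G0 w l 0) = 0.
  under eq_fun do rewrite G0E mxE.
  rewrite (Ex_mul _ (sqint_Gam mZ0 mGam Gmoment 0) (Gmean 0)).
  have := consensus_grad0 g_ok Hobj; rewrite /consensus_grad mulmx0 => ->.
  by rewrite mxE.
have symI : (invmx H)^T = invmx H by rewrite trmx_inv Hsym.
have dI t z : dotp t (invmx H *m z) = dotp (invmx H *m t) z.
  by rewrite dotp_mulmx symI.
(* The variance in direction t is the second moment of the score: by symmetry the outer inverses act
   on t, and for a centred vector the covariance form is a second moment. *)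
have quad t : dotp t (invmx H *m S *m invmx H *m t) =
    Ex P (fun w => score Gam H t (Z0 w) ^+ 2).
  rewrite -!mulmxA dI (cov_mx_quadratic sG0 mean0); congr Ex; apply/funext => w.
  by rewrite /score sqrrN dotp_rowdot G0E trmxK.
apply: charf_cvg_in_distribution.
- by rewrite !trmx_mul symI cov_mx_sym// mulmxA.
- by move=> t; rewrite quad; apply: Ex_ge0 => w; exact: sqr_ge0.
- move=> k; exact: (measurable_average mZ0 mZs Hiid mGam Gmoment Glip).
- move=> e; exact: (average_tight mZ0 mZs Hiid mGam Gmoment Lg0 Glip Gmean X0
    A1 piA pi1 B1 pr1
    contrA contrB gamE gam0 mu0 Fmon al0 aln alc ald Hunit (ltW cl0) Flin
      al_sqrt al_inv i).
- move=> c t; rewrite quad.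
  exact: (average_charf mZ0 mZs Hiid mGam Gmoment Lg0 Glip Gmean X0 A1 piA pi1
    B1 pr1
    contrA contrB gamE gam0 mu0 Fmon al0 aln alc ald Hunit (ltW cl0) Flin
      al_sqrt al_inv i).
Qed.
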